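(* Consider the MAD-Path proposal on $\mathbb{R}^d$ over the horizon $[0,T]$ with step size $h=T/N$, with an approximate score $\widehat s_t$ in the backward pass in place of the exact score $s_t=\nabla\log p_t$, score error $\delta_t:=\widehat s_t-s_t$, and log Metropolis–Hastings ratio $\Delta_h$ (all defined in the context). Under the standing assumptions, Assumption R and Assumption S stated in the context, and under stationarity $x_0\sim p_0=p$, $$\mathbb E[\Delta_h]=-\mathcal E_{\mathrm{score}}(\delta,T)+O(h),\qquad h\to0,$$ where $$\mathcal E_{\mathrm{score}}(\delta,T):=\frac12\int_0^Tg_t^2\Big\{\mathbb E\big[\|\delta_t(X_t)\|^2\big]+\mathbb E\big[\|\delta_t(\widehat Y_t)\|^2\big]\Big\}\,dt .$$ Consequently, the acceptance probability satisfies $$\mathbb E[1\wedge e^{\Delta_h}]\ge\tfrac12\exp\big(-\mathcal E_{\mathrm{score}}(\delta,T)+O(h)\big).$$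
   Context: Forward diffusion: $dX_t=f_t(X_t)\,dt+g_t\,dB_t$, $X_0\sim p$, $t\in[0,T]$, on $\mathbb{R}^d$, with $f:[0,T]\times\mathbb{R}^d\to\mathbb{R}^d$, $g:[0,T]\to\mathbb{R}$; $p_t$ is the density of $X_t$ ($p_0=p$), $L_t=\log p_t$, $s_t=\nabla L_t$. For a drift $b$, ''the reverse diffusion with drift $b$'' is the process $(Y_t)$ with $Y_T=X_T\sim p_T$ such that $\widetilde Y_\tau=Y_{T-\tau}$ solves $d\widetilde Y_\tau=b_{T-\tau}(\widetilde Y_\tau)\,d\tau+g_{T-\tau}\,dW_\tau$, where, conditionally on $X_T$, $W$ is a Brownian motion independent of the forward path. $Y$ denotes the reverse diffusion with exact drift $b^\star_t=-f_t+g_t^2s_t$, and $\widehat Y$ the one with approximate drift $\widehat b_t=-f_t+g_t^2\widehat s_t$. Discretization: $h=T/N$, $t_k=kh$; $x_0\sim p$, $x_{k+1}=x_k+hf_{t_k}(x_k)+\sqrt h\,g_{t_k}\varepsilon_k$; $y_N=x_N$, $y_k=y_{k+1}+h\widehat b_{t_k}(y_{k+1})+\sqrt h\,g_{t_k}\zeta_k$ for $k=N-1,\dots,0$; all $\varepsilon_k,\zeta_k$ i.i.d. $\mathcal N(0,I_d)$, independent of $x_0$. Let $y_k^\star$ denote the analogous scheme with $b^\star$ in place of $\widehat b$. With $\varphi(x;\mu,\Sigma)$ the $\mathcal N(\mu,\Sigma)$ density at $x$, $\overrightarrow{p}_k(x'\mid x)=\varphi(x';x+hf_{t_k}(x),g_{t_k}^2hI_d)$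 and $\overleftarrow{p}_k(y\mid y')=\varphi(y;y'+h\widehat b_{t_k}(y'),g_{t_k}^2hI_d)$. Then $$\Delta_h:=\log\left[\frac{p(y_0)}{p(x_0)}\cdot\frac{\prod_{k=0}^{N-1}\overleftarrow{p}_k(x_k\mid x_{k+1})\prod_{k=0}^{N-1}\overrightarrow{p}_k(y_{k+1}\mid y_k)}{\prod_{k=0}^{N-1}\overrightarrow{p}_k(x_{k+1}\mid x_k)\prod_{k=0}^{N-1}\overleftarrow{p}_k(y_k\mid y_{k+1})}\right].$$ Standing assumptions: each $p_t$ is strictly positive; $\partial_tp_t=-\nabla\cdot(f_tp_t)+\tfrac12\Delta(g_t^2p_t)$; the Jacobian $\nabla f_t(x)$ is symmetric for all $t,x$. $C^{r,s}$ denotes the (scalar- or $\mathbb{R}^d$-valued) functions on $[0,T]\times\mathbb{R}^d$ whose mixed derivatives up to order $r$ in time and order $s$ in space are continuous and grow at most polynomially in $x$, uniformly in $t$. Assumption R. There is $h_0>0$ such that: (i) $g\in C^1([0,T])$ is bounded away from zero and infinity; (ii) $f\in C^{1,3}$ and $L\in C^{2,4}$; (iii) the forward SDE and the exact reverse SDE have unique solutions, and for every $q\ge2$ the variables $X_t,Y_t,x_k,y_k^\star$ have $L^q$ norms bounded uniformly in $t$, $k$ and $0<h\le h_0$; (iv) for every $q\ge2$ the Euler schemes can be coupled to the exact solutions through shared Brownian increments so that $\max_{0\le k\le N}(\|x_k-X_{t_k}\|_{L^q}+\|y_k^\star-Y_{t_k}\|_{L^q})\le C_qh^{1/2}$ for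 $0<h\le h_0$. Assumption S. $\delta\in C^{1,3}$; the approximate reverse diffusion $\widehat Y$ is well-posed; its Euler scheme $(y_k)$ satisfies the same uniform $L^q$ moment bounds and the strong-error bound in (iv), with $Y_{t_k}$ replaced by $\widehat Y_{t_k}$ (and $y_k^\star$ by $y_k$). Moreover, the forward and approximate-reverse Euler schemes have weak order one, uniformly over the time grid. *)

(* Defs.v *)
From HB Require Import structures.
From mathcomp Require Import all_boot all_order all_algebra.
From mathcomp Require Import all_classical all_reals all_analysis.

Set Implicit Arguments.
Unset Strict Implicit.
Unset Printing Implicit Defensive.
Import Order.TTheory GRing.Theory Num.Theory.
Import numFieldNormedType.Exports.
Local Open Scope classical_set_scope.
Local Open Scope ring_scope.

Definition measure_matrix_display : measure_display -> measure_display.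
Proof. exact. Qed.

(* The product sigma-algebra on matrices; on 'rV[R]_d it is the Borel
   sigma-algebra of R^d. *)
Section measurable_matrix.
Context {dT : measure_display} {T : measurableType dT} (m n : nat).

Definition mx_cylinder : set (set 'M[T]_(m, n)) :=
  [set E | exists i j (A : set T),
     measurable A /\ E = (fun M : 'M[T]_(m, n) => M i j) @^-1` A].

Let mx_set0 : <<s mx_cylinder >> set0.
Proof. exact: sigma_algebra0. Qed.

Let mx_setC A : <<s mx_cylinder >> A -> <<s mx_cylinder >> (~` A).
Proof. exact: sigma_algebraC. Qed.

Let mx_bigcup (F : (set 'M[T]_(m, n))^nat) :
  (forall i, <<s mx_cylinder >> (F i)) -> <<s mx_cylinder >> (\bigcup_i F i).
Proof. exact: sigma_algebra_bigcup. Qed.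

HB.instance Definition _ := @isMeasurable.Build (measure_matrix_display dT)
  'M[T]_(m, n) <<s mx_cylinder >> mx_set0 mx_setC mx_bigcup.

End measurable_matrix.

Section lebesgue_rV.
Context {R : realType}.

Definition rV_cons (n : nat) (z : measurableTypeR R * 'rV[R]_n) : 'rV[R]_n.+1 :=
  row_mx (const_mx z.1 : 'rV[R]_1) z.2.

Lemma rV_cons_head n (x : R) (y : 'rV[R]_n) : rV_cons (x, y) 0 0 = x.
Proof.
have -> : (0 : 'I_n.+1) = lshift n (0 : 'I_1) by apply/val_inj.
by rewrite (@row_mxEl _ 1 1 n (const_mx x) y 0 0) mxE.
Qed.

Lemma rV_cons_tail n (x : R) (y : 'rV[R]_n) :
  rsubmx (rV_cons (x, y) : 'rV[R]_(1 + n)) = y.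
Proof. by rewrite /rV_cons row_mxKr. Qed.

Lemma measurable_rV_cons n : measurable_fun setT (@rV_cons n).
Proof.
apply: (@measurability _ _ _ _ _ _ (@mx_cylinder _ R 1 n.+1)) => //.
move=> _ [_ [i [j [A [mA ->]]]] <-]; rewrite setTI.
pose c := fun M : 'rV[R]_n.+1 => M i j.
suff mc : measurable_fun setT (c \o @rV_cons n).
  have := mc measurableT A mA; by rewrite setTI.
rewrite /c /comp /rV_cons.
have [k jE|k jE] := split_ordP (j : 'I_(1 + n)).
  apply: (eq_measurable_fun fst); last exact: measurable_fst.
  by move=> z _; rewrite jE /= (@row_mxEl _ 1 1 n (const_mx z.1) z.2 i k) mxE.
apply: (eq_measurable_fun ((fun M : 'rV[R]_n => M i k) \o snd)).
  by move=> z _; rewrite jE /= (@row_mxEr _ 1 1 n (const_mx z.1) z.2 i k).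
apply: measurableT_comp; last exact: measurable_snd.
move=> _ B mB; rewrite setTI; apply: sub_sigma_algebra.
by exists i, k, B.
Qed.

HB.instance Definition _ n :=
  isMeasurableFun.Build _ _ _ _ (@rV_cons n) (@measurable_rV_cons n).

Variables (n : nat) (mu : {sigma_finite_measure set 'rV[R]_n -> \bar R}).

Definition lebesgue_rV_step : set 'rV[R]_n.+1 -> \bar R :=
  pushforward (lebesgue_measure \x mu)%E (@rV_cons n).

Let step0 : lebesgue_rV_step set0 = 0%E.
Proof. exact: (measure0 (pushforward (lebesgue_measure \x mu)%E (@rV_cons n))). Qed.

Let step_ge0 A : (0 <= lebesgue_rV_step A)%E.
Proof. exact: (measure_ge0 (lebesgue_measure \x mu)%E). Qed.

Let step_sigma_additive : semi_sigma_additive lebesgue_rV_step.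
Proof.
exact: (@measure_semi_sigma_additive _ _ _
  (pushforward (lebesgue_measure \x mu)%E (@rV_cons n))).
Qed.

HB.instance Definition _ := isMeasure.Build _ _ _ lebesgue_rV_step
  step0 step_ge0 step_sigma_additive.

Let lebesgue_rV_step_sigma_finite : sigma_finite setT lebesgue_rV_step.
Proof.
have [F FT Ffin] := sigma_finiteT mu.
have [G GT Gfin] := sigma_finiteT (@lebesgue_measure R).
have mhead : measurable_fun setT (fun v : 'rV[R]_n.+1 => v 0 0).
  by move=> _ B mB; rewrite setTI; apply: sub_sigma_algebra; exists 0, 0, B.
have mtail : measurable_fun setT (fun v : 'rV[R]_n.+1 => rsubmx (v : 'rV[R]_(1 + n))).
  apply: (@measurability _ _ _ _ _ _ (@mx_cylinder _ R 1 n)) => //.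
  move=> _ [_ [i [j [A [mA ->]]]] <-]; rewrite setTI.
  apply: sub_sigma_algebra; exists i, (rshift 1 j), A; split => //.
  by apply/seteqP; split => v /=; rewrite mxE.
exists (fun k => [set v : 'rV[R]_n.+1 |
    G (CodeSeq.decode k)`_0%N (v 0 0) /\
    F (CodeSeq.decode k)`_1%N (rsubmx (v : 'rV[R]_(1 + n)))]).
  apply/seteqP; split=> // v _.
  have [a _ Ga] : (\bigcup_i G i) (v 0 0) by rewrite -GT.
  have [b _ Fb] : (\bigcup_i F i) (rsubmx (v : 'rV[R]_(1 + n))) by rewrite -FT.
  by exists (CodeSeq.code [:: a; b]); rewrite /mkset ?CodeSeq.codeK.
move=> k; set a := _`_0; set b := _`_1.
have [mG Goo] := Gfin a; have [mF Foo] := Ffin b.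
have mGF : measurable [set v : 'rV[R]_n.+1 |
    G a (v 0 0) /\ F b (rsubmx (v : 'rV[R]_(1 + n)))].
  apply: measurableI.
    by have := mhead measurableT _ mG; rewrite setTI.
  by have := mtail measurableT _ mF; rewrite setTI.
split => //.
rewrite /lebesgue_rV_step /pushforward.
rewrite [X in (_ \x _)%E X](_ : _ = G a `*` F b); last first.
  by apply/seteqP; split=> -[x y] /=; rewrite rV_cons_head rV_cons_tail.
by rewrite product_measure1E// lte_mul_pinfty// ge0_fin_numE.
Qed.

HB.instance Definition _ := Measure_isSigmaFinite.Build _ _ _
  lebesgue_rV_step lebesgue_rV_step_sigma_finite.
End lebesgue_rV.

(* The dimension-0 case is the unit mass on the one-point space 'rV_0. *)
Fixpoint lebesgue_rV (R : realType) (d : nat) :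
    {sigma_finite_measure set 'rV[R]_d -> \bar R} :=
  match d return {sigma_finite_measure set 'rV[R]_d -> \bar R} with
  | 0 => \d_(0 : 'rV[R]_0)
  | n.+1 => lebesgue_rV_step (lebesgue_rV R n)
  end.

Section calculus.
Context {R : realType} {d : nat}.
Implicit Types (u : 'rV[R]_d -> R) (F : 'rV[R]_d -> 'rV[R]_d).

(* The library norm on 'rV[R]_d is the sup norm. *)
Definition enorm (x : 'rV[R]_d) : R := Num.sqrt (\sum_(i < d) x 0 i ^+ 2).

Definition basis_vec (i : 'I_d) : 'rV[R]_d := delta_mx 0 i.

Definition grad u (x : 'rV[R]_d) : 'rV[R]_d :=
  \row_(i < d) 'D_(basis_vec i) u x.

Definition divergence F (x : 'rV[R]_d) : R :=
  \sum_(i < d) 'D_(basis_vec i) (fun z => F z 0 i) x.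

Definition laplacian u (x : 'rV[R]_d) : R :=
  \sum_(i < d) 'D_(basis_vec i) (fun z => 'D_(basis_vec i) u z) x.

(* Density of N(mu, v I_d), v > 0. *)
Definition gauss_pdf (mu : 'rV[R]_d) (v : R) (x : 'rV[R]_d) : R :=
  ((2 * pi * v) `^ (d%:R / 2))^-1 * expR (- (enorm (x - mu) ^+ 2 / (2 * v))).

Definition C1_time (T : R) (g : R -> R) : Prop :=
  exists dg : R -> R,
    [/\ {within `[0, T], continuous g},
        {within `[0, T], continuous dg}
      & forall t, t \in `]0, T[ -> is_derive t 1 g (dg t)].

(* [D a al] is the mixed derivative of order [a] in time and along the spatial
   directions listed in [al].  At t = 0 and t = T the time derivative is the
   continuous extension of the derivative on the open interval (equivalently,
   the one-sided derivative). *)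
Definition classC (r s : nat) (T : R) (u : R -> 'rV[R]_d -> R) : Prop :=
  exists D : nat -> seq 'I_d -> R -> 'rV[R]_d -> R,
    [/\ forall t x, t \in `[0, T] -> D 0%N [::] t x = u t x,
        forall a al, (a <= r)%N -> (size al <= s)%N ->
          {within `[0, T] `*` [set: 'rV[R]_d],
             continuous (fun tx : R * 'rV[R]_d => D a al tx.1 tx.2)} /\
          exists (C : R) (m : nat), forall t x, t \in `[0, T] ->
            `|D a al t x| <= C * (1 + enorm x) ^+ m,
        forall a al t x, (a < r)%N -> (size al <= s)%N -> t \in `]0, T[ ->
          is_derive t 1 (fun t' => D a al t' x) (D a.+1 al t x)
      & forall a al i t x, (a <= r)%N -> (size al < s)%N -> t \in `[0, T] ->
          is_derive x (basis_vec i) (D a al t) (D a (i :: al) t x)].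

Definition classC_vec (r s : nat) (T : R) (F : R -> 'rV[R]_d -> 'rV[R]_d) :=
  forall i : 'I_d, classC r s T (fun t x => F t x 0 i).

End calculus.

Section probability.
Context {R : realType} {d : nat} {dO : measure_display} {Om : measurableType dO}.
Variable P : probability Om R.
Implicit Types (V : Om -> 'rV[R]_d) (X B W Y : R -> Om -> 'rV[R]_d).
Implicit Types (F : R -> set (set Om)).

Definition has_density V (rho : 'rV[R]_d -> R) : Prop :=
  [/\ measurable_fun setT V, measurable_fun setT rho, forall x, 0 <= rho x
    & forall A, measurable A ->
        P (V @^-1` A) = (\int[lebesgue_rV R d]_(x in A) (rho x)%:E)%E].

Definition Lq_norm (q : R) V : \bar R :=
  Lnorm P q%:E (fun w => (enorm (V w))%:E).

Definition mean_sqnorm V : \bar R := ('E_P[(fun w => enorm (V w) ^+ 2)%R])%E.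

Definition mutually_independent (I : finType) (V : I -> Om -> 'rV[R]_d) :=
  forall A : I -> set 'rV[R]_d, (forall i, measurable (A i)) ->
    P (\bigcap_i (V i @^-1` A i)) = (\prod_i P (V i @^-1` A i))%E.

Definition filtration (T : R) F : Prop :=
  [/\ forall t, t \in `[0, T] -> sigma_algebra setT (F t),
      forall t, t \in `[0, T] -> F t `<=` measurable
    & forall s t : R, 0 <= s -> s <= t -> t <= T -> F s `<=` F t].

Definition adapted (T : R) F X : Prop :=
  forall t (A : set 'rV[R]_d), t \in `[0, T] -> measurable A ->
    F t (X t @^-1` A).

Definition brownian (T : R) F B : Prop :=
  [/\ adapted T F B,
      {ae P, forall w, B 0 w = 0},
      {ae P, forall w, {within `[0, T], continuous (fun t => B t w)}},
      forall s t : R, 0 <= s -> s < t -> t <= T ->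
        has_density (fun w => B t w - B s w) (gauss_pdf 0 (t - s))
    & forall (s t : R) E (A : set 'rV[R]_d), 0 <= s -> s <= t -> t <= T ->
        F s E -> measurable A ->
        P (E `&` [set w | A (B t w - B s w)]) =
          (P E * P [set w | A (B t w - B s w)%R])%E].

(* [I] is (a version of) the stochastic integral of sigma dB over [0, t]: the
   L^2 limit of the Riemann-Ito sums, for sigma deterministic and continuous. *)
Definition ito_integral B (sigma : R -> R) (t : R) (I : Om -> 'rV[R]_d) : Prop :=
  measurable_fun setT I /\
  (fun n : nat => mean_sqnorm (fun w => I w - \sum_(k < n)
      sigma (k%:R * (t / n%:R)) *:
        (B (k.+1%:R * (t / n%:R)) w - B (k%:R * (t / n%:R)) w)))
    @ \oo --> 0%E.

(* dX_t = b_t(X_t) dt + sigma_t dB_t on [0, T]. *)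
Definition sde_solution (T : R) F B (b : R -> 'rV[R]_d -> 'rV[R]_d)
    (sigma : R -> R) X : Prop :=
  [/\ [/\ filtration T F, brownian T F B & adapted T F X],
      {ae P, forall w, {within `[0, T], continuous (fun t => X t w)}},
      {ae P, forall w, forall i : 'I_d, lebesgue_measure.-integrable `[0, T]
         (fun s => (b s (X s w) 0 i)%:E)}
    & forall t, t \in `[0, T] -> exists2 I, ito_integral B sigma t I &
        {ae P, forall w, X t w = X 0 w +
           \row_i (\int[lebesgue_measure]_(s in `[0, t]) b s (X s w) 0 i) +
           I w}].

Definition path_events (T : R) X : set (set Om) :=
  <<s [set E | exists t (A : set 'rV[R]_d),
         [/\ t \in `[0, T], measurable A & E = X t @^-1` A]] >>.

Definition independent_paths (T : R) X W : Prop :=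
  forall E E', path_events T X E -> path_events T W E' ->
    P (E `&` E') = (P E * P E')%E.

Definition forward_diffusion (T : R) (f : R -> 'rV[R]_d -> 'rV[R]_d)
    (g : R -> R) (p0 : 'rV[R]_d -> R) B X : Prop :=
  has_density (X 0) p0 /\ exists F, sde_solution T F B f g X.

(* [Y] is the reverse diffusion with drift b.  That W is, conditionally on X_T,
   a Brownian motion independent of the forward path amounts to W being a
   Brownian motion independent of the whole forward path, X_T included. *)
Definition reverse_diffusion (T : R) (b : R -> 'rV[R]_d -> 'rV[R]_d)
    (g : R -> R) X W Y : Prop :=
  [/\ independent_paths T X W,
      {ae P, forall w, Y T w = X T w}
    & exists G, sde_solution T G W (fun tau => b (T - tau))
        (fun tau => g (T - tau)) (fun tau => Y (T - tau))].

End probability.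

(* Pathwise uniqueness for the initial density rho0. *)
Definition sde_unique (R : realType) (d : nat) (T : R)
    (b : R -> 'rV[R]_d -> 'rV[R]_d) (sigma : R -> R) (rho0 : 'rV[R]_d -> R) :=
  forall (dO : measure_display) (Om : measurableType dO) (P : probability Om R)
    (F : R -> set (set Om)) (B X X' : R -> Om -> 'rV[R]_d),
    sde_solution P T F B b sigma X -> sde_solution P T F B b sigma X' ->
    has_density P (X 0) rho0 -> {ae P, forall w, X 0 w = X' 0 w} ->
    {ae P, forall w, forall t, t \in `[0, T] -> X t w = X' t w}.

Section euler_schemes.
Context {R : realType} {d : nat}.
Implicit Types (f b : R -> 'rV[R]_d -> 'rV[R]_d) (g : R -> R) (h : R).

Definition grid h (k : nat) : R := k%:R * h.

Fixpoint euler_fwd f g h (x0 : 'rV[R]_d) (eps : nat -> 'rV[R]_d) (k : nat) :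
    'rV[R]_d :=
  if k is j.+1 then
    let x := euler_fwd f g h x0 eps j in
    x + h *: f (grid h j) x + (Num.sqrt h * g (grid h j)) *: eps j
  else x0.

(* [euler_bwd_rev ... j] is y_{N - j}. *)
Fixpoint euler_bwd_rev b g h (N : nat) (yN : 'rV[R]_d)
    (zeta : nat -> 'rV[R]_d) (j : nat) : 'rV[R]_d :=
  if j is i.+1 then
    let y := euler_bwd_rev b g h N yN zeta i in
    let k := (N - j)%N in
    y + h *: b (grid h k) y + (Num.sqrt h * g (grid h k)) *: zeta k
  else yN.

Definition euler_bwd b g h (N : nat) (yN : 'rV[R]_d) (zeta : nat -> 'rV[R]_d)
  (k : nat) : 'rV[R]_d := euler_bwd_rev b g h N yN zeta (N - k).

(* Forward and backward transition densities. *)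
Definition fwd_kernel f g h (k : nat) (x' x : 'rV[R]_d) : R :=
  gauss_pdf (x + h *: f (grid h k) x) (g (grid h k) ^+ 2 * h) x'.

Definition bwd_kernel b g h (k : nat) (y y' : 'rV[R]_d) : R :=
  gauss_pdf (y' + h *: b (grid h k) y') (g (grid h k) ^+ 2 * h) y.

Definition log_MH_ratio f b g h (N : nat) (p0 : 'rV[R]_d -> R)
    (x y : nat -> 'rV[R]_d) : R :=
  ln (p0 (y 0%N) / p0 (x 0%N) *
      ((\prod_(k < N) bwd_kernel b g h k (x k) (x k.+1) *
        \prod_(k < N) fwd_kernel f g h k (y k.+1) (y k)) /
       (\prod_(k < N) fwd_kernel f g h k (x k.+1) (x k) *
        \prod_(k < N) bwd_kernel b g h k (y k) (y k.+1)))).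

Definition euler_noise {dO : measure_display} {Om : measurableType dO}
    (P : probability Om R) (p0 : 'rV[R]_d -> R) (N : nat)
    (x0 : Om -> 'rV[R]_d) (eps zeta : nat -> Om -> 'rV[R]_d) : Prop :=
  [/\ has_density P x0 p0,
      forall k, (k < N)%N -> has_density P (eps k) (gauss_pdf 0 1),
      forall k, (k < N)%N -> has_density P (zeta k) (gauss_pdf 0 1)
    & mutually_independent P
        (fun i : option ('I_N + 'I_N) => match i with
           | None => x0
           | Some (inl k) => eps k
           | Some (inr k) => zeta k
         end)].

End euler_schemes.

Section assumptions.
Context {R : realType} {d : nat}.
Variables (T : R) (f : R -> 'rV[R]_d -> 'rV[R]_d) (g : R -> R)
  (p : R -> 'rV[R]_d -> R) (shat : R -> 'rV[R]_d -> 'rV[R]_d).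

Definition logdens (t : R) (x : 'rV[R]_d) : R := ln (p t x).
Definition score (t : R) (x : 'rV[R]_d) : 'rV[R]_d := grad (logdens t) x.
Definition score_error (t : R) (x : 'rV[R]_d) : 'rV[R]_d :=
  shat t x - score t x.

Definition reverse_drift (s : R -> 'rV[R]_d -> 'rV[R]_d) (t : R)
  (x : 'rV[R]_d) : 'rV[R]_d := - f t x + g t ^+ 2 *: s t x.

Definition step (N : nat) : R := T / N%:R.

Definition standing_assumptions : Prop :=
  [/\ forall t x, t \in `[0, T] -> 0 < p t x,
      forall t x, t \in `]0, T[ ->
        is_derive t 1 (fun t' => p t' x)
          (- divergence (fun z => p t z *: f t z) x +
           2^-1 * laplacian (fun z => g t ^+ 2 * p t z) x)
    & forall t x i j, t \in `[0, T] ->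
        'D_(basis_vec i) (fun z => f t z 0 j) x =
        'D_(basis_vec j) (fun z => f t z 0 i) x].

Section schemes.
Context {dE : measure_display} {OmE : measurableType dE}.
Variables (x0 : nat -> OmE -> 'rV[R]_d) (eps zeta : nat -> nat -> OmE -> 'rV[R]_d).

Definition scheme_x (N k : nat) (w : OmE) : 'rV[R]_d :=
  euler_fwd f g (step N) (x0 N w) (fun j => eps N j w) k.

(* The backward scheme started at y_N = x_N, with the score s. *)
Definition scheme_y (s : R -> 'rV[R]_d -> 'rV[R]_d) (N k : nat) (w : OmE) :
    'rV[R]_d :=
  euler_bwd (reverse_drift s) g (step N) N (scheme_x N N w)
    (fun j => zeta N j w) k.

Definition Delta (N : nat) (w : OmE) : R :=
  log_MH_ratio f (reverse_drift shat) g (step N) N (p 0)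
    (fun k => scheme_x N k w) (fun k => scheme_y shat N k w).

End schemes.

Context {dO : measure_display} {Om : measurableType dO}.
Variable (P : probability Om R).
Variables (B W X Y Yhat : R -> Om -> 'rV[R]_d).

(* Standardized Brownian increments over the grid.  The backward step from
   t_{k+1} to t_k runs over [T - t_{k+1}, T - t_k] in the time of W. *)
Definition fwd_increment (N k : nat) (w : Om) : 'rV[R]_d :=
  (Num.sqrt (step N))^-1 *:
    (B (grid (step N) k.+1) w - B (grid (step N) k) w).

Definition bwd_increment (N k : nat) (w : Om) : 'rV[R]_d :=
  (Num.sqrt (step N))^-1 *:
    (W (T - grid (step N) k) w - W (T - grid (step N) k.+1) w).

Definition coupled_x := scheme_x (fun=> X 0) fwd_increment.
Definition coupled_y := scheme_y (fun=> X 0) fwd_increment bwd_increment.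

Definition strong_error (s : R -> 'rV[R]_d -> 'rV[R]_d)
    (Z : R -> Om -> 'rV[R]_d) (h0 : R) : Prop :=
  forall q : R, 2 <= q -> exists C : R, forall N k, (0 < N)%N ->
    step N <= h0 -> (k <= N)%N ->
    (Lq_norm P q (fun w => coupled_x N k w - X (grid (step N) k) w)%R +
     Lq_norm P q (fun w => coupled_y s N k w - Z (grid (step N) k) w)%R
     <= (C * Num.sqrt (step N))%:E)%E.

Context {dE : measure_display} {OmE : measurableType dE}.
Variable (PE : probability OmE R).
Variables (x0 : nat -> OmE -> 'rV[R]_d) (eps zeta : nat -> nat -> OmE -> 'rV[R]_d).

Definition scheme_moments (z : nat -> nat -> OmE -> 'rV[R]_d) (h0 : R) : Prop :=
  forall q : R, 2 <= q -> exists C : R, forall N k, (0 < N)%N ->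
    step N <= h0 -> (k <= N)%N -> (Lq_norm PE q (z N k) <= C%:E)%E.

Definition diffusion_moments (Z : R -> Om -> 'rV[R]_d) : Prop :=
  forall q : R, 2 <= q -> exists C : R, forall t, t \in `[0, T] ->
    (Lq_norm P q (Z t) <= C%:E)%E.

(* C^{1,2} is the regularity of div delta + <s, delta> for delta in C^{1,3}; it
   also covers |delta|^2. *)
Definition weak_order_one (z : nat -> nat -> OmE -> 'rV[R]_d)
    (Z : R -> Om -> 'rV[R]_d) (h0 : R) : Prop :=
  forall phi : R -> 'rV[R]_d -> R, classC 1 2 T phi ->
  exists C : R, forall N k, (0 < N)%N -> step N <= h0 -> (k <= N)%N ->
    let tk := grid (step N) k in
    (`| 'E_PE[(fun w => phi tk (z N k w))] - 'E_P[(fun w => phi tk (Z tk w))] |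
     <= (C * step N)%:E)%E.

Definition assumption_R (h0 : R) : Prop :=
  [/\ C1_time T g /\ (exists m M : R, 0 < m /\
        forall t, t \in `[0, T] -> m <= `|g t| <= M),
      classC_vec 1 3 T f /\ classC 2 4 T logdens,
      [/\ forward_diffusion P T f g (p 0) B X,
          sde_unique T f g (p 0),
          reverse_diffusion P T (reverse_drift score) g X W Y
        & sde_unique T (fun tau => reverse_drift score (T - tau))
            (fun tau => g (T - tau)) (p T)],
      [/\ diffusion_moments X, diffusion_moments Y,
          scheme_moments (scheme_x x0 eps) h0
        & scheme_moments (scheme_y x0 eps zeta score) h0]
    & strong_error score Y h0].

Definition assumption_S (h0 : R) : Prop :=
  [/\ classC_vec 1 3 T score_error,
      reverse_diffusion P T (reverse_drift shat) g X W Yhat /\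
        sde_unique T (fun tau => reverse_drift shat (T - tau))
          (fun tau => g (T - tau)) (p T),
      scheme_moments (scheme_y x0 eps zeta shat) h0,
      strong_error shat Yhat h0
    & weak_order_one (scheme_x x0 eps) X h0 /\
      weak_order_one (scheme_y x0 eps zeta shat) Yhat h0].

Definition score_energy : \bar R :=
  ((2^-1)%:E * \int[lebesgue_measure]_(t in `[0%R, T])
     ((g t ^+ 2)%:E * (mean_sqnorm P (fun w => score_error t (X t w)) +
                       mean_sqnorm P (fun w => score_error t (Yhat t w)))))%E.

End assumptions.

(* Main.v *)
Require Import Defs.
From HB Require Import structures.
From mathcomp Require Import all_boot all_order all_algebra.
From mathcomp Require Import all_classical all_reals all_analysis.
From mathcomp Require Import measurable_realfun gauss_integral ring lra.

Set Implicit Arguments.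
Unset Strict Implicit.
Unset Printing Implicit Defensive.
Import Order.TTheory GRing.Theory Num.Theory.
Import numFieldNormedType.Exports.
Local Open Scope classical_set_scope.
Local Open Scope ring_scope.

(* Since the log ratio of the normal densities of a step and of its reversal is
   explicit, telescoping log p_t along both chains writes Delta_h, up to sign, as
   a sum of one-step losses, forward ones along (x_k) and backward ones along
   (y_k).  Taylor expansion of a loss in its Gaussian noise leaves no mean at
   orders h^{1/2} and h^{3/2}, by symmetry, and by the Fokker-Planck equation for
   log p_t the mean at order h is that of
     g^2 (div delta + <s, delta> + |delta|^2 / 2)   for a forward step,
     g^2 |delta|^2 / 2                              for a backward step.
   As (div delta + <s, delta>) p_t = div (p_t delta), the two agree in mean along
   X_t.  Weak order one replaces the chains by the diffusions; it also makes the
   mean energies Lipschitz in time (they increase by O(h) in a step of the chains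
   on arbitrarily fine grids), so that their Riemann sums are O(h)-close to the
   integral.
   For the acceptance probability, integrating the noise out one step at a time
   gives E[e^Delta] = 1, and the Bretagnolle-Huber argument yields
   E[1 /\ e^Delta] >= exp(E[Delta]) / 2. *)

(** * Lebesgue integration on R^d *)

(** With about T / h steps, each mean loss must be known up to O(h^2), with a constant that is
    uniform over times and steps and depends on the starting point only through a power of its
    weight; uniform moments of the chains then make the sum O(h). This fixes the orders of
    expansion: four space derivatives for log p_t, whose remainder is the fourth power of the noise
    scale, but three for the drift of the reversed step, which meets a noise with a factor h^(1/2).
    Expansions are made for a frozen starting point and integrated afterwards, the fresh noise being
    independent of the past. Regularity in time along the diffusions is read off the chains, and
    this shapes the limit. Forward losses are traded for g^2 |delta|^2 / 2 at the grid times of X,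
    before the sum is compared with the integral, so that one nonnegative function is followed in
    time, as Fatou's lemma requires. The moments of the approximate reverse diffusion also come from
    its chain, by weak order one at grid times and Fatou's lemma in between. *)

Section measurable_rV.
Context {R : realType}.

Lemma measurable_coord n (i : 'I_n) :
  measurable_fun setT (fun x : 'rV[R]_n => x 0 i).
Proof.
move=> _ A mA; rewrite setTI; apply: sub_sigma_algebra.
by exists 0, i, A.
Qed.

Lemma measurable_to_rV d (Om : measurableType d) n (f : Om -> 'rV[R]_n) :
  (forall i, measurable_fun setT (fun w => f w 0 i)) -> measurable_fun setT f.
Proof.
move=> mf; apply: (@measurability _ _ _ _ _ _ (@mx_cylinder _ R 1 n)) => //.
move=> _ [_ [i [j [A [mA ->]]]] <-].
have := mf j measurableT A mA; congr (measurable _).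
by apply/seteqP; split => w /=; rewrite (ord1 i).
Qed.

Lemma measurable_rVD d (Om : measurableType d) n (f g : Om -> 'rV[R]_n) :
  measurable_fun setT f -> measurable_fun setT g ->
  measurable_fun setT (fun w => f w + g w).
Proof.
move=> mf mg; apply: measurable_to_rV => i.
apply: (eq_measurable_fun (fun w => f w 0 i + g w 0 i)).
  by move=> w _; rewrite mxE.
by apply: measurable_funD; apply: (measurableT_comp (measurable_coord i)).
Qed.

Lemma coord_le_norm n (x : 'rV[R]_n) i : `|x 0 i| <= `|x|.
Proof.
rewrite [leRHS]/Num.norm /= mx_normrE.
exact: (le_bigmax _ (fun ij : 'I_1 * 'I_n => `|x ij.1 ij.2|) (0, i)).
Qed.

Lemma norm_rV_le n (x : 'rV[R]_n) (M : R) :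
  0 <= M -> (forall i, `|x 0 i| <= M) -> `|x| <= M.
Proof.
move=> M0 xM; rewrite [leLHS]/Num.norm /= mx_normrE.
by apply/bigmax_leP; split => // -[i j] _ /=; rewrite (ord1 i).
Qed.

Lemma measurable_rVZ d (Om : measurableType d) n (f : Om -> 'rV[R]_n) (k : R) :
  measurable_fun setT f -> measurable_fun setT (fun w => k *: f w).
Proof.
move=> mf; apply: measurable_to_rV => i.
apply: (eq_measurable_fun (fun w => k * f w 0 i)).
  by move=> w _; rewrite mxE.
by apply: measurable_funM => //; apply: (measurableT_comp (measurable_coord i)).
Qed.

(** Sup-norm balls with rational data: a countable base of the topology. *)
Definition rat_box n (q : 'rV[rat]_n * rat) : set 'rV[R]_n :=
  [set x | forall i, `|ratr (q.1 0 i) - x 0 i| < ratr q.2].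

Lemma measurable_rat_box n (q : 'rV[rat]_n * rat) : measurable (rat_box q).
Proof.
have -> : rat_box q = \bigcap_(i in [set: 'I_n])
    ((fun x : 'rV[R]_n => x 0 i) @^-1` (ball (ratr (q.1 0 i) : R) (ratr q.2))).
  by apply/seteqP; split => x /= xq i; [move=> _; exact: xq|exact: xq].
apply: fin_bigcap_measurable; first exact: finite_finset.
move=> i _; rewrite -[X in measurable X]setTI.
apply: measurable_coord => //; exact: measurable_ball.
Qed.

(** Measurable sets are generated by the coordinates while open sets come from the sup norm; the
    countable base of rational boxes links the two. *)
Lemma open_measurable_rV n (O : set 'rV[R]_n) : open O -> measurable O.
Proof.
move=> oO.
have -> : O = \bigcup_q (if `[< rat_box q `<=` O >] then rat_box q else set0).
  apply/seteqP; split => [x Ox|x [q _]]; last by case: asboolP => // qO /qO.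
  (* With a radius r < e / 2 and a centre within r of x, the box contains x and stays inside the
     ball of radius e. *)
  have /nbhs_ballP[e /= e0 eO] : nbhs x O by apply: open_nbhs_nbhs.
  have e20 : 0 < e / 2 by rewrite divr_gt0.
  have [r /andP[r0 re]] : exists r : rat, 0 < (ratr r : R) < e / 2.
    have [r] := rat_in_itvoo e20; rewrite in_itv/= => rE.
    by exists r.
  have cP i : exists s : rat, `|x 0 i - ratr s| < (ratr r : R).
    have /rat_in_itvoo[s] : x 0 i - ratr r < x 0 i + ratr r by lra.
    by rewrite in_itv/= => sP; exists s; rewrite ltr_norml; lra.
  have [c xc] := choice cP.
  exists (\row_i c i, r) => //; case: asboolP => [_|[]]; last first.
    move=> z /= zc; apply: eO; split => // i j; rewrite (ord1 i) /ball /=.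
    have := zc j; have := xc j; rewrite /= !mxE => h1 h2.
    have -> : x 0 j - z 0 j = (x 0 j - ratr (c j)) + (ratr (c j) - z 0 j) by ring.
    apply: le_lt_trans (ler_normD _ _) _; lra.
  by move=> i /=; rewrite mxE distrC.
apply: countable_bigcupT_measurable => // q.
by case: asboolP => // _; exact: measurable_rat_box.
Qed.

Lemma continuous_measurable_rV n (f : 'rV[R]_n -> R) :
  continuous f -> measurable_fun setT f.
Proof.
move=> cf; apply: (measurability _ (RGenOpens.measurableE R)) => //.
move=> _ [_ [a [b ->] <-]]; rewrite setTI.
by apply: open_measurable_rV; apply: open_comp => // x _; exact: cf.
Qed.

End measurable_rV.

(** * Integration against a density *)

Section density.
Local Open Scope ereal_scope.
Context d (T : measurableType d) (R : realType).
Variables (mu nu : {measure set T -> \bar R}) (rho : T -> R).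
Hypotheses (mrho : measurable_fun setT rho) (rho0 : forall x, (0 <= rho x)%R)
  (nuE : forall A, measurable A -> nu A = \int[mu]_(x in A) (rho x)%:E).

Import HBNNSimple.

Lemma integral_density_nnsfun (f : {nnsfun T >-> R}) :
  \int[nu]_x (f x)%:E = \int[mu]_x ((f x)%:E * (rho x)%:E).
Proof.
under [LHS]eq_integral do rewrite fimfunE -fsumEFin//.
rewrite [LHS]ge0_integral_fsum//; last 2 first.
  - by move=> r; exact/measurable_EFinP/measurableT_comp.
  - by move=> n x _; rewrite EFinM nnfun_muleindic_ge0.
under [RHS]eq_integral.
  move=> x xD; rewrite fimfunE -fsumEFin// ge0_mule_fsuml; last first.
    by move=> r; rewrite EFinM nnfun_muleindic_ge0.
  over.
rewrite [RHS]ge0_integral_fsum//; last 2 first.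
  - move=> r; apply: emeasurable_funM; last exact/measurable_EFinP.
    by apply/measurable_EFinP; apply/measurableT_comp.
  - by move=> n x _; rewrite mule_ge0//= ?EFinM ?nnfun_muleindic_ge0// lee_fin.
apply: eq_fsbigr => r rf.
have r0 : (0 <= r)%R by move: rf; rewrite inE => -[x _ <-].
have mfr : measurable (f @^-1` [set r]) by [].
under eq_integral do rewrite EFinM.
rewrite ge0_integralZl//; last exact/measurable_EFinP.
rewrite integral_indic// setIT nuE//.
under [RHS]eq_integral do rewrite EFinM -muleA.
rewrite ge0_integralZl//; last 2 first.
  - by apply: emeasurable_funM; exact/measurable_EFinP.
  - by move=> x _; rewrite mule_ge0// lee_fin.
congr *%E; rewrite integral_mkcond; apply: eq_integral => x _.
rewrite patchE indicE; case: ifPn => _; by rewrite ?mul1e ?mul0e.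
Qed.

(** Simple functions are settled by linearity; since rho is nonnegative, the products increase with
    the approximations and monotone convergence applies on both sides. *)
Lemma ge0_integral_density (f : T -> \bar R) :
  measurable_fun setT f -> (forall x, 0 <= f x) ->
  \int[nu]_x f x = \int[mu]_x (f x * (rho x)%:E).
Proof.
move=> mf f0; pose f_ := nnsfun_approx measurableT mf.
transitivity (limn (fun n => \int[nu]_x (f_ n x)%:E)).
  rewrite -monotone_convergence//=.
  - apply: eq_integral => x _; apply/esym/cvg_lim => //=.
    exact: cvg_nnsfun_approx.
  - by move=> n; exact/measurable_EFinP.
  - by move=> n x _; rewrite lee_fin.
  - by move=> x _ a b ab; rewrite lee_fin; exact/lefP/nd_nnsfun_approx.
transitivity (limn (fun n => \int[mu]_x ((f_ n x)%:E * (rho x)%:E))).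
  by apply: congr_lim; apply/funext => n /=; exact: integral_density_nnsfun.
rewrite -monotone_convergence//=.
- apply: eq_integral => x _; apply/cvg_lim => //.
  have fx : (f_ n x)%:E @[n --> \oo] --> f x by exact: cvg_nnsfun_approx.
  by apply: cvgeZr.
- move=> n; apply: emeasurable_funM; exact/measurable_EFinP.
- by move=> n x _; rewrite mule_ge0// lee_fin.
- by move=> x _ a b ab; rewrite lee_wpmul2r ?lee_fin//; exact/lefP/nd_nnsfun_approx.
Qed.

End density.

(** Turns a local measurability proof into the bundled function that distributions and image
    measures are stated for. *)
Definition mfun_of d d' (T : measurableType d) (T' : measurableType d')
    (f : T -> T') (mf : measurable_fun setT f) : {mfun T >-> T'} :=
  MeasurableFun.Pack (MeasurableFun.Class (isMeasurableFun.Build _ _ _ _ f mf)).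

Section density_rV.
Context (R : realType) (n : nat) d (Om : measurableType d)
  (P : probability Om R).
Variables (V : Om -> 'rV[R]_n) (rho : 'rV[R]_n -> R).
Hypothesis Vrho : has_density P V rho.

Lemma ge0_integral_has_density (f : 'rV[R]_n -> \bar R) :
  measurable_fun setT f -> (forall x, 0 <= f x)%E ->
  (\int[P]_w f (V w) = \int[lebesgue_rV R n]_x (f x * (rho x)%:E))%E.
Proof.
case: Vrho => mV mrho rho0 PV mf f0.
transitivity (\int[pushforward P (mfun_of mV)]_x f x)%E.
  by rewrite ge0_integral_pushforward.
by apply: ge0_integral_density => // A mA; rewrite -PV.
Qed.

Lemma integrable_has_density (f : 'rV[R]_n -> R) : measurable_fun setT f ->
  (P.-integrable setT (EFin \o (f \o V)) <->
   (lebesgue_rV R n).-integrable setT (EFin \o (fun x => f x * rho x))).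
Proof.
case: (Vrho) => mV mrho rho0 PV mf.
have E : (\int[P]_w `|(f (V w))%:E| =
    \int[lebesgue_rV R n]_x `|(f x * rho x)%:E|)%E.
  rewrite (ge0_integral_has_density (f := fun x => `|(f x)%:E|%E)) //; last first.
    by apply: measurableT_comp => //; exact/measurable_EFinP.
  apply: eq_integral => x _.
  by rewrite EFinM abseM (gee0_abs (x := (rho x)%:E)) ?lee_fin.
split=> /integrableP[_ H]; apply/integrableP; split.
- by apply/measurable_EFinP; apply: measurable_funM.
- by rewrite -E.
- by apply/measurable_EFinP; apply: measurableT_comp.
- by rewrite E.
Qed.

Lemma Rintegral_has_density (f : 'rV[R]_n -> R) : measurable_fun setT f ->
  P.-integrable setT (EFin \o (f \o V)) ->
  \int[P]_w f (V w) = \int[lebesgue_rV R n]_x (f x * rho x).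
Proof.
case: (Vrho) => mV mrho rho0 PV mf fi.
have mef : measurable_fun setT (EFin \o f) by exact/measurable_EFinP.
have fi' := (integrable_has_density mf).1 fi.
rewrite /Rintegral integralE [in RHS]integralE.
congr (fine (_ - _)).
- transitivity (\int[P]_w ((EFin \o f)^\+ (V w)))%E; first by apply: eq_integral => w _; rewrite !funeposE.
  rewrite (ge0_integral_has_density (f := (EFin \o f)^\+%E)) //; last first.
    exact: measurable_funepos.
  apply: eq_integral => x _; rewrite !funeposE /= -!EFin_max -EFinM.
  by rewrite maxr_pMl// mul0r.
- transitivity (\int[P]_w ((EFin \o f)^\- (V w)))%E; first by apply: eq_integral => w _; rewrite !funenegE.
  rewrite (ge0_integral_has_density (f := (EFin \o f)^\-%E)) //; last first.
    exact: measurable_funeneg.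
  apply: eq_integral => x _; rewrite !funenegE /= -!EFin_max -EFinM.
  by rewrite maxr_pMl// mul0r mulNr.
Qed.

End density_rV.

Section lebesgue_rVS.
Context (R : realType) (n : nat).
Local Notation mu := (@lebesgue_measure R).
Local Notation la := (lebesgue_rV R n).

Lemma ge0_integral_rVS (f : 'rV[R]_n.+1 -> \bar R) :
  measurable_fun setT f -> (forall x, 0 <= f x)%E ->
  (\int[lebesgue_rV R n.+1]_z f z =
   \int[mu]_x \int[la]_y f (rV_cons (x, y)))%E.
Proof.
move=> mf f0.
transitivity (\int[(mu \x la)%E]_z f (rV_cons z))%E.
  by rewrite [LHS](@ge0_integral_pushforward _ _ _ _ _ (@rV_cons R n)).
rewrite (fubini_tonelli1 (fun z => f (rV_cons z)))//.
by apply: measurableT_comp.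
Qed.

Lemma integral_rVS (f : 'rV[R]_n.+1 -> R) :
  (lebesgue_rV R n.+1).-integrable setT (EFin \o f) ->
  (mu \x la)%E.-integrable setT (EFin \o (f \o @rV_cons R n)) /\
  (\int[lebesgue_rV R n.+1]_z (f z)%:E =
   \int[(mu \x la)%E]_z (f (rV_cons z))%:E)%E.
Proof.
move=> fi.
have mf : measurable_fun setT (EFin \o f) by exact: (measurable_int _ fi).
have fi' : (mu \x la)%E.-integrable setT (EFin \o (f \o @rV_cons R n)).
  move/integrableP : fi => [_ fi]; apply/integrableP; split.
    exact: (measurableT_comp mf).
  move: fi.
  rewrite [X in (X < _)%E -> _](@ge0_integral_pushforward _ _ _ _ _ (@rV_cons R n)) //.
  exact: measurableT_comp.
split=> //.
by rewrite [LHS](@integral_pushforward _ _ _ _ _ (@rV_cons R n)).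
Qed.

End lebesgue_rVS.

Definition image_measure d d' (T : measurableType d) (T' : measurableType d')
    (R : realType) (mu : {measure set T -> \bar R}) (f : T -> T')
    (mf : measurable_fun setT f) : {measure set T' -> \bar R}.
Proof. unshelve refine (pushforward mu f). exact: mf. Defined.

Section affine.
Context (R : realType).
Local Notation mu := (@lebesgue_measure R).

Lemma ge0_integral_oppr (f : R -> \bar R) :
  measurable_fun setT f -> (forall x, 0 <= f x)%E ->
  (\int[mu]_x f (- x)%R = \int[mu]_x f x)%E.
Proof.
move=> mf f0.
have mN : measurable_fun setT (-%R : R -> measurableTypeR R) by [].
transitivity (\int[image_measure mu mN]_x f x)%E.
  by rewrite ge0_integral_pushforward.
by apply: eq_measure_integral => A mA _; exact: lebesgue_measureN.
Qed.

(** The image of Lebesgue measure under the affine map, multiplied by s, gives each []a, b]] its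
    length, and such a measure is unique. *)
Lemma ge0_integral_pos_affine (m s : R) (f : R -> \bar R) : 0 < s ->
  measurable_fun setT f -> (forall x, 0 <= f x)%E ->
  (\int[mu]_x f x = s%:E * \int[mu]_x f (m + s * x)%R)%E.
Proof.
move=> s0 mf f0.
have ms : measurable_fun setT (fun x : measurableTypeR R =>
    (m + s * x : measurableTypeR R)).
  by apply: measurable_funD => //; apply: measurable_funM.
pose nu := mscale (NngNum (ltW s0)) (image_measure mu ms).
transitivity (\int[nu]_x f x)%E.
  apply: eq_measure_integral => A mA _; apply: lebesgue_measure_unique => //.
  move=> _ [[a b]] _ <-.
  change (mu `]a, b] = s%:E * mu [set x | (m + s * x)%R \in `]a, b]])%E.
  have -> : [set x | (m + s * x)%R \in `]a, b]] =
      `](a - m) / s, (b - m) / s]%classic.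
    apply/seteqP; split => x /=; rewrite !in_itv /= => /andP[h1 h2].
      by rewrite ltr_pdivrMr// ler_pdivlMr//; lra.
    by move: h1 h2; rewrite ltr_pdivrMr// ler_pdivlMr//; lra.
  rewrite lebesgue_measure_itv /= lebesgue_measure_itv /= !lte_fin.
  rewrite ltr_pM2r ?invr_gt0// ltrD2r; case: ifPn => _; last by rewrite mule0.
  by rewrite -!EFinB -EFinM; congr EFin; field; rewrite gt_eqF.
rewrite /nu  ge0_integral_mscale//=; congr (_ * _)%E.
by rewrite ge0_integral_pushforward.
Qed.

(** Negative slopes have to be covered because the noise scale carries the sign of [g]; they reduce
    to positive ones by reflection. *)
Lemma ge0_integral_affine (m s : R) (f : R -> \bar R) : s != 0 ->
  measurable_fun setT f -> (forall x, 0 <= f x)%E ->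
  (\int[mu]_x f x = `|s|%:E * \int[mu]_x f (m + s * x)%R)%E.
Proof.
move=> s0 mf f0; have [s_gt0|s_lt0|sE] := ltgtP 0 s.
- by rewrite gtr0_norm// -ge0_integral_pos_affine.
- rewrite ltr0_norm// (@ge0_integral_pos_affine m (- s))//; last by rewrite oppr_gt0.
  congr (_ * _)%E; rewrite -[RHS]ge0_integral_oppr//.
    by apply: eq_integral => x _; rewrite mulNr mulrN.
  apply: measurableT_comp => //.
  by apply: measurable_funD => //; apply: measurable_funM.
- by rewrite -sE eqxx in s0.
Qed.

Lemma rV_cons_lift n (x : R) (y : 'rV[R]_n) (j : 'I_n) :
  rV_cons (x, y) 0 (lift ord0 j) = y 0 j.
Proof.
have -> : lift ord0 j = rshift 1 j by apply/val_inj.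
by rewrite (@row_mxEr _ 1 1 n (const_mx x) y 0 j).
Qed.

Lemma rV_cons_affine n (m : 'rV[R]_n.+1) (s x : R) (y : 'rV[R]_n) :
  m + s *: rV_cons (x, y) =
  rV_cons (m 0 0 + s * x, \row_j m 0 (lift ord0 j) + s *: y).
Proof.
apply/rowP => j; have [i ->|->] := unliftP ord0 j.
  by rewrite rV_cons_lift mxE [X in _ + X]mxE rV_cons_lift !mxE.
by rewrite rV_cons_head mxE [X in _ + X]mxE rV_cons_head.
Qed.

Lemma measurable_rV_affine n (m : 'rV[R]_n) (s : R) :
  measurable_fun setT (fun x : 'rV[R]_n => m + s *: x).
Proof.
by apply: measurable_rVD => //; apply: measurable_rVZ.
Qed.

Lemma measurable_fun_rV_cons n (f : 'rV[R]_n.+1 -> \bar R) :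
  measurable_fun setT f -> measurable_fun setT (f \o @rV_cons R n).
Proof. by move=> mf; apply: measurableT_comp. Qed.

Lemma measurable_integral_rV_cons n (f : 'rV[R]_n.+1 -> \bar R) :
  measurable_fun setT f -> (forall x, 0 <= f x)%E ->
  measurable_fun setT
    (fun x : R => (\int[lebesgue_rV R n]_y f (rV_cons (x, y)))%E).
Proof.
move=> mf f0.
by apply: (measurable_fun_fubini_tonelli_F (f \o @rV_cons R n)) => //=;
  exact: measurable_fun_rV_cons.
Qed.

(** Each coordinate integrated by Tonelli contributes one factor |s|. *)
Lemma ge0_integral_rV_affine n (m : 'rV[R]_n) (s : R) (f : 'rV[R]_n -> \bar R) :
  s != 0 -> measurable_fun setT f -> (forall x, 0 <= f x)%E ->
  (\int[lebesgue_rV R n]_x f x =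
   (`|s| ^+ n)%:E * \int[lebesgue_rV R n]_x f (m + s *: x)%R)%E.
Proof.
move=> s0; elim: n m f => [|n IH] m f mf f0.
  rewrite mul1e; apply: eq_integral => x _; congr f.
  by apply/rowP => -[].
have mfa : measurable_fun setT (fun x : 'rV[R]_n.+1 => f (m + s *: x)).
  by apply: measurableT_comp => //; exact: measurable_rV_affine.
rewrite ge0_integral_rVS// [in RHS]ge0_integral_rVS//.
rewrite (ge0_integral_affine (m 0 0) s0); last 2 first.
- exact: measurable_integral_rV_cons.
- by move=> x; apply: integral_ge0.
rewrite exprS EFinM -muleA; congr (_ * _)%E.
rewrite -ge0_integralZl//; last 2 first.
- exact: measurable_integral_rV_cons mfa _.
- by move=> x _; apply: integral_ge0.
apply: eq_integral => x _.
rewrite (IH (\row_j m 0 (lift ord0 j))) //; last first.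
  apply: measurableT_comp => //; apply: measurableT_comp => //.
by congr (_ * _)%E; apply: eq_integral => y _; rewrite rV_cons_affine.
Qed.

End affine.

(** * Gaussian vectors *)

Section gaussian.
Context (R : realType).

Lemma gauss_pdf_prod n (m : 'rV[R]_n) (v : R) x : 0 < v ->
  gauss_pdf m v x = \prod_i normal_pdf (m 0 i) (Num.sqrt v) (x 0 i).
Proof.
move=> v0; have s0 : Num.sqrt v != 0 by rewrite gt_eqF// sqrtr_gt0.
under eq_bigr do rewrite normal_pdfE//.
rewrite big_split /= prodr_const card_ord /gauss_pdf /normal_peak; congr (_ * _).
  rewrite exprVn; congr (_^-1).
  rewrite sqr_sqrtr ?ltW//.
  have -> : v * pi *+ 2 = 2 * pi * v by ring.
  have vpi : 0 <= 2 * pi * v by rewrite !mulr_ge0 ?pi_ge0 ?ltW.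
  by rewrite -powR12_sqrt// -powR_mulrn ?powR_ge0// -powRrM; congr powR; field.
rewrite /normal_fun -expR_sum; congr expR.
rewrite /enorm sqr_sqrtr; last by apply: sumr_ge0 => i _; rewrite sqr_ge0.
rewrite mulr_suml -sumrN; apply: eq_bigr => i _.
by rewrite !mxE sqr_sqrtr ?ltW// mulNr mulr_natl.
Qed.

Lemma gauss_pdf_ge0 n (m : 'rV[R]_n) (v : R) x : 0 <= gauss_pdf m v x.
Proof. by rewrite /gauss_pdf mulr_ge0 ?expR_ge0// invr_ge0 powR_ge0. Qed.

Lemma gauss_pdf_gt0 n (m : 'rV[R]_n) (v : R) x : 0 < v -> 0 < gauss_pdf m v x.
Proof.
move=> v0; rewrite /gauss_pdf mulr_gt0 ?expR_gt0// invr_gt0 powR_gt0//.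
by rewrite !mulr_gt0// pi_gt0.
Qed.

(** Standardization; s^n is the Jacobian of the affine map. *)
Lemma gauss_pdf_affine n (m : 'rV[R]_n) (s : R) x : 0 < s ->
  s ^+ n * gauss_pdf m (s ^+ 2) (m + s *: x) = gauss_pdf 0 1 x.
Proof.
move=> s0; rewrite !gauss_pdf_prod ?exprn_gt0//.
rewrite -[X in s ^+ X](card_ord n) -prodr_const -big_split /=.
apply: eq_bigr => i _; rewrite sqrtr_sqr gtr0_norm// sqrtr1 !normal_pdfE ?gt_eqF//.
rewrite /normal_peak /normal_fun !mxE mulrA expr1n mul1r.
congr (_ * expR _).
  rewrite -mulrnAr sqrtrM ?sqr_ge0// sqrtr_sqr gtr0_norm// invfM.
  by rewrite mulrA divff ?mul1r ?gt_eqF.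
rewrite addrAC subrr add0r subr0 exprMn -mulrnAr.
rewrite !mulNr; congr (- _).
by rewrite -[_ *+ 2]mulr_natr; field; rewrite gt_eqF.
Qed.

End gaussian.

Section real_integrable.
Context d (T : measurableType d) (R : realType).
Variable mu : {measure set T -> \bar R}.
Implicit Types f g : T -> R.

Definition rintegrable f := mu.-integrable setT (EFin \o f).

Lemma rintegrable_measurable f : rintegrable f -> measurable_fun setT f.
Proof. by move=> /measurable_int/measurable_EFinP. Qed.

Lemma rintegrableD f g : rintegrable f -> rintegrable g ->
  rintegrable (fun x => f x + g x).
Proof. by move=> fi gi; apply: eq_integrable (integrableD _ fi gi). Qed.

Lemma rintegrableB f g : rintegrable f -> rintegrable g ->
  rintegrable (fun x => f x - g x).
Proof. by move=> fi gi; apply: eq_integrable (integrableB _ fi gi). Qed.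

Lemma rintegrableZ k f : rintegrable f -> rintegrable (fun x => k * f x).
Proof. by move=> fi; apply: eq_integrable (integrableZl _ k fi). Qed.

Lemma rintegrable_sum I (s : seq I) (P : pred I) (F : I -> T -> R) :
  (forall i, P i -> rintegrable (F i)) ->
  rintegrable (fun x => \sum_(i <- s | P i) F i x).
Proof.
move=> Fi; have /= := integrable_sum measurableT s (h := fun i => EFin \o F i) Fi.
by apply: eq_integrable => // x _; rewrite /= sumEFin.
Qed.

Lemma rintegrable_norm f : rintegrable f -> rintegrable (fun x => `|f x|).
Proof. exact: integrable_norm. Qed.

Lemma rintegrable_le f g : measurable_fun setT f ->
  (forall x, `|f x| <= g x) -> rintegrable g -> rintegrable f.
Proof.
move=> mf fg gi; apply: le_integrable gi => //; first exact/measurable_EFinP.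
by move=> x _ /=; rewrite lee_fin (le_trans (fg x))// ler_norm.
Qed.

Lemma Rintegral_sum I (s : seq I) (P : pred I) (F : I -> T -> R) :
  (forall i, P i -> rintegrable (F i)) ->
  \int[mu]_x (\sum_(i <- s | P i) F i x) =
  \sum_(i <- s | P i) \int[mu]_x F i x.
Proof.
move=> Fi; elim: s => [|i s IH].
  rewrite big_nil -[RHS](mul0r (fine (mu setT))) -Rintegral_cst//.
  by apply: eq_Rintegral => x _; rewrite big_nil.
rewrite big_cons; case: ifPn => Pi.
  rewrite -IH -RintegralD//; last 2 first.
  - exact: Fi.
  - exact: rintegrable_sum.
  by apply: eq_Rintegral => x _; rewrite big_cons Pi.
by rewrite -IH; apply: eq_Rintegral => x _; rewrite big_cons (negbTE Pi).
Qed.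

Lemma Rintegral_norm_le f g : measurable_fun setT f -> rintegrable g ->
  (forall x, `|f x| <= g x) -> `|\int[mu]_x f x| <= \int[mu]_x g x.
Proof.
move=> mf gi fg; have fi := rintegrable_le mf fg gi.
apply: le_trans (le_normr_Rintegral _ fi) _ => //.
by apply: le_Rintegral => //; exact: rintegrable_norm.
Qed.

Lemma RintegralE f : rintegrable f ->
  (\int[mu]_x (f x)%:E)%E = (\int[mu]_x f x)%:E.
Proof. by move=> fi; rewrite /Rintegral fineK//; exact: integrable_fin_num. Qed.

End real_integrable.

(** * Integrals of derivatives vanish *)

Section real_line.
Context (R : realType).
Local Notation mu := (@lebesgue_measure R).
Implicit Types f F G : R -> R.

Lemma ge0_integral_shift (u : R) (f : R -> \bar R) : measurable_fun setT f ->
  (forall x, 0 <= f x)%E ->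
  (\int[mu]_x (f \o shift u) x = \int[mu]_x f x)%E.
Proof.
move=> mf f0; rewrite [RHS](ge0_integral_pos_affine u ltr01)// mul1e.
by apply: eq_integral => x _ /=; rewrite mul1r addrC.
Qed.

Lemma integral_shift (u : R) (f : R -> \bar R) : measurable_fun setT f ->
  (\int[mu]_x (f \o shift u) x = \int[mu]_x f x)%E.
Proof.
move=> mf; rewrite [LHS]integralE [RHS]integralE; congr (_ - _)%E.
  rewrite -(ge0_integral_shift u (f := f^\+%E))//; last exact: measurable_funepos.
  by apply: eq_integral => x _; rewrite /= !funeposE.
rewrite -(ge0_integral_shift u (f := f^\-%E))//; last exact: measurable_funeneg.
by apply: eq_integral => x _; rewrite /= !funenegE.
Qed.

Lemma measurable_shift (u : R) : measurable_fun setT (shift u : R -> R).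
Proof. exact: measurable_funD. Qed.

Lemma rintegrable_shift (u : R) F :
  rintegrable mu F -> rintegrable mu (F \o shift u).
Proof.
move=> iF; have mF := rintegrable_measurable iF.
apply/integrableP; split.
  by apply/measurable_EFinP; apply: measurableT_comp => //; exact: measurable_shift.
rewrite (ge0_integral_shift u (f := fun x => `|(F x)%:E|%E))//.
  by move/integrableP : iF => -[].
by apply: measurableT_comp => //; exact/measurable_EFinP.
Qed.

Lemma is_derive_comp_shift F G (x u : R) :
  (forall x : R, is_derive x 1 F (G x)) ->
  is_derive u 1 (fun v : R => F (x + v)) (G (x + u)).
Proof.
move=> FG; rewrite (_ : (fun v => _) = F \o shift x); last first.
  by apply/funext => v /=; rewrite addrC.
rewrite addrC -[G _]mulr1.
exact: (is_derive1_comp (f := F) (g := shift x) (x := u) (FG (u + x))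
  (is_derive_shift u 1 x)).
Qed.

Lemma integral_derive_shift F G (x : R) :
  (forall x : R, is_derive x 1 F (G x)) -> continuous G ->
  (\int[mu]_(u in `[0%R, 1%R]) (G (x + u)%R)%:E = (F (x + 1)%R)%:E - (F x)%:E)%E.
Proof.
move=> FG cG; have D u := is_derive_comp_shift x u FG.
have C : continuous (fun v : R => F (x + v)).
  by move=> u; apply: differentiable_continuous; apply/derivable1_diffP.
have -> : F x = F (x + 0) by rewrite addr0.
apply: (@continuous_FTC2 _ (fun u : R => G (x + u)) (fun u : R => F (x + u))) => //.
- apply: continuous_subspaceT => u.
  apply: (@continuous_comp _ _ _ (fun u : R => x + u)); last exact: cG.
  by apply: continuousD; [exact: cst_continuous|exact: cvg_id].
- split.
  + by move=> u _; apply: ex_derive.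
  + by apply: cvg_at_right_filter; exact: C.
  + by apply: cvg_at_left_filter; exact: C.
- by move=> u _; rewrite derive1E derive_val.
Qed.

(* By Fubini, \int G = \int_0^1 \int G(x + u) dx du is the integral over x of
   F(x + 1) - F(x), which vanishes by translation invariance. *)
Lemma integral_derive_eq0 F G : (forall x : R, is_derive x 1 F (G x)) ->
  continuous G -> rintegrable mu F -> rintegrable mu G -> \int[mu]_x G x = 0.
Proof.
move=> FG cG iF iG.
have mG := rintegrable_measurable iG.
have mF := rintegrable_measurable iF.
pose I : set R := `[0, 1]%classic.
have mI : measurable I by exact: measurable_itv.
have muI : (\int[mu]_u (\1_I u)%:E = 1)%E.
  rewrite integral_indic// setIT.
  by rewrite [LHS]lebesgue_measure_itv/= lte01 oppr0 adde0.
(* The cutoff in the second variable makes the integrand integrable on the whole plane, so that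
   Fubini applies without restricting the domain. *)
pose H (z : R * R) : R := G (z.1 + z.2) * \1_I z.2.
have mH : measurable_fun setT H.
  apply: measurable_funM; first by apply: measurableT_comp => //; exact: measurable_funD.
  apply: (measurableT_comp (f := \1_I : R -> R)); last exact: measurable_snd.
  exact: measurable_indic.
have Hi : (mu \x mu)%E.-integrable setT (EFin \o H).
  apply/integrable21ltyP; first exact/measurable_EFinP.
  (* For fixed u, translation invariance returns the whole integral of |G|, so the total mass is
     that of |G| times the length of [0, 1]. *)
  have E (u : R) : (\int[mu]_x `|(H (x, u))%:E| =
      (\int[mu]_x `|(G x)%:E|) * (\1_I u)%:E)%E.
    rewrite -(ge0_integral_shift u (f := fun x => `|(G x)%:E|%E))//; last first.
      by apply: measurableT_comp => //; exact/measurable_EFinP.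
    rewrite -ge0_integralZr//; last 2 first.
    - apply: measurableT_comp; last exact: measurable_shift.
      by apply: measurableT_comp => //; exact/measurable_EFinP.
    - by move=> x _ /=.
    by apply: eq_integral => x _; rewrite /H /= normrM EFinM (ger0_norm (x := \1_I u)).
  under eq_integral do rewrite E.
  rewrite ge0_integralZl//; last 2 first.
  - by apply/measurable_EFinP; exact: measurable_indic.
  - by apply: integral_ge0.
  rewrite muI mule1.
  by move/integrableP : iG => -[].
have E3 : (\int[mu]_x \int[mu]_u (H (x, u))%:E =
    \int[mu]_u \int[mu]_x (H (x, u))%:E)%E := Fubini Hi.
have E1 : (\int[mu]_x \int[mu]_u (H (x, u))%:E =
    \int[mu]_x (((F \o shift 1) x)%:E - (F x)%:E))%E.
  apply: eq_integral => x _.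
  transitivity (\int[mu]_(u in I) (G ((x : R) + u)%R)%:E)%E;
    last exact: (@integral_derive_shift F G x FG cG).
  rewrite [RHS]integral_mkcond; apply: eq_integral => u _.
  by rewrite patchE /H /= indicE; case: ifPn => _; rewrite ?mulr1 ?mulr0.
have E2 : (\int[mu]_u \int[mu]_x (H (x, u))%:E =
    \int[mu]_u ((\int[mu]_x (G x)%:E) * (\1_I u)%:E))%E.
  apply: eq_integral => u _.
  rewrite -(integral_shift u (f := EFin \o G)); last exact/measurable_EFinP.
  by rewrite -integralZr//; exact: rintegrable_shift iG.
have iI : mu.-integrable setT (EFin \o \1_I).
  by apply: integrable_indic_itv.
move: E3; rewrite E1 E2 integralB//; last exact: rintegrable_shift iF.
rewrite (integral_shift 1 (f := EFin \o F)); last exact/measurable_EFinP.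
rewrite subee; last exact: integrable_fin_num.
rewrite RintegralE// integralZl// muI mule1.
by case.
Qed.

End real_line.

(** A directional derivative only sees the function along one line. Agreement along two lines
    therefore transfers it, even between different spaces, which is how partial derivatives become
    ordinary ones. *)
Lemma is_derive_eq_along (R : numFieldType) (V V' W : normedModType R)
    (f : V -> W) (f' : V' -> W) (a v : V) (a' v' : V') df :
  (forall r : R, f (r *: v + a) = f' (r *: v' + a')) ->
  is_derive a v f df -> is_derive a' v' f' df.
Proof.
move=> ff' [D1 D2].
have E : (fun h => h^-1 *: ((f' \o shift a') (h *: v') - f' a')) =
         (fun h => h^-1 *: ((f \o shift a) (h *: v) - f a)).
  apply/funext => h /=; rewrite -ff'.
  by have := ff' 0; rewrite !scale0r !add0r => ->.
by split; [rewrite /derivable E|rewrite /derive E].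
Qed.

Section continuity_rV.
Context (R : realType).

Lemma continuous_to_rV (T : topologicalType) n (f : T -> 'rV[R]_n) (x : T) :
  (forall i, {for x, continuous (fun t => f t 0 i)}) -> {for x, continuous f}.
Proof.
move=> cf; apply/cvg_ballP => e e0.
have H : \forall t \near x, forall i, ball (f x 0 i) e (f t 0 i).
  by apply: filter_forall => i; move/cvg_ballP : (cf i); apply.
by apply: filterS H => t Ht; split => // i j; rewrite (ord1 i); exact: Ht.
Qed.

Lemma continuous_rV_cons_r n (x : R) :
  continuous (fun y : 'rV[R]_n => rV_cons (x, y)).
Proof.
move=> y; apply: continuous_to_rV => i.
have [j ->|->] := unliftP ord0 i.
  rewrite (_ : (fun y => _) = (fun y : 'rV[R]_n => y 0 j)).
    exact: coord_continuous.
  by apply/funext => z; rewrite rV_cons_lift.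
rewrite (_ : (fun y => _) = fun=> x); first exact: cst_continuous.
by apply/funext => z; rewrite rV_cons_head.
Qed.

Lemma continuous_rV_cons_l n (y : 'rV[R]_n) :
  continuous (fun x : R => rV_cons (x, y)).
Proof.
move=> x; apply: continuous_to_rV => i.
have [j ->|->] := unliftP ord0 i.
  rewrite (_ : (fun z => _) = fun=> y 0 j); first exact: cst_continuous.
  by apply/funext => z; rewrite rV_cons_lift.
rewrite (_ : (fun y => _) = id); first exact: cvg_id.
by apply/funext => z; rewrite rV_cons_head.
Qed.

End continuity_rV.

Section integration_by_parts_rV.
Context (R : realType).

Lemma basis_vec_lift n (j : 'I_n) :
  basis_vec (lift ord0 j) = rV_cons (0, basis_vec j) :> 'rV[R]_n.+1.
Proof.
apply/rowP => k; have [i ->|->] := unliftP ord0 k.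
  by rewrite rV_cons_lift !mxE /= (inj_eq lift_inj).
by rewrite rV_cons_head !mxE.
Qed.

Lemma basis_vec0 n : basis_vec ord0 = rV_cons (1, 0) :> 'rV[R]_n.+1.
Proof.
apply/rowP => k; have [i ->|->] := unliftP ord0 k.
  by rewrite rV_cons_lift !mxE.
by rewrite rV_cons_head !mxE /=.
Qed.

Lemma rV_cons_linear n (r x x' : R) (y y' : 'rV[R]_n) :
  r *: rV_cons (x, y) + rV_cons (x', y') =
  rV_cons (r * x + x', r *: y + y').
Proof.
apply/rowP => k; rewrite [LHS]mxE [X in X + _]mxE.
have [i ->|->] := unliftP ord0 k; first by rewrite !rV_cons_lift !mxE.
by rewrite !rV_cons_head.
Qed.

(** Fubini isolates the first coordinate. A derivative along it integrates to zero on almost every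
    line by the one-dimensional case, a derivative along another one on almost every slice by
    induction; integrability is only available for almost every slice. *)
Lemma integral_partial_eq0 n (i : 'I_n) (F G : 'rV[R]_n -> R) :
  (forall x, is_derive x (basis_vec i) F (G x)) -> continuous G ->
  rintegrable (lebesgue_rV R n) F -> rintegrable (lebesgue_rV R n) G ->
  \int[lebesgue_rV R n]_x G x = 0.
Proof.
elim: n i F G => [[]//|n IH] i F G FG cG iF iG.
have [iFc _] := integral_rVS iF; have [iGc iGE] := integral_rVS iG.
rewrite /Rintegral iGE.
have Gm := measurable_int _ iGc.
have [j iE|iE] := unliftP ord0 i; rewrite {}iE {i} in FG *.
  rewrite -(integral12_prod_meas1 iGc).
  rewrite (ae_eq_integral (cst 0%E)) ?integral0//.
    exact: (measurable_fubini_F iGc).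
  have := ae_integrable1 iGc; apply: filterS2 (ae_integrable1 iFc) => x iFx iGx _.
  rewrite /fubini_F RintegralE//; congr EFin.
  apply: (IH j (fun y => F (rV_cons (x, y)))) => //.
    move=> y; apply: is_derive_eq_along (FG (rV_cons (x, y))) => r.
    by rewrite basis_vec_lift rV_cons_linear mulr0 add0r.
  move=> y; apply: (@continuous_comp _ _ _ (fun y => rV_cons (x, y))); last exact: cG.
  exact: continuous_rV_cons_r.
rewrite -(integral21_prod_meas1 iGc).
rewrite (ae_eq_integral (cst 0%E)) ?integral0//.
  exact: (measurable_fubini_G iGc).
have := ae_integrable2 iGc; apply: filterS2 (ae_integrable2 iFc) => y iFy iGy _.
rewrite /fubini_G RintegralE//; congr EFin.
apply: (@integral_derive_eq0 _ (fun x => F (rV_cons (x, y)))) => //.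
  move=> x; apply: is_derive_eq_along (FG (rV_cons (x, y))) => r.
  by rewrite basis_vec0 rV_cons_linear scaler0 add0r.
move=> x; apply: (@continuous_comp _ _ _ (fun x => rV_cons (x, y))); last exact: cG.
exact: continuous_rV_cons_l.
Qed.

End integration_by_parts_rV.

(** * Moments of the normal law *)

Section gaussian_moments_line.
Context (R : realType).
Local Notation mu := (@lebesgue_measure R).
Local Notation phi := (normal_pdf 0 1 : R -> R).

Lemma normal_pdf01E x : phi x = normal_peak 1 * expR (- (x ^+ 2) / 2).
Proof.
by rewrite normal_pdfE ?oner_eq0// /normal_fun subr0 expr1n mulNr.
Qed.

(** This is y / m <= 1 + y / m <= exp (y / m) raised to the power m, with m = 0 apart. *)
Lemma exprn_le_expR (m : nat) (y : R) : 0 <= y ->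
  y ^+ m <= m%:R ^+ m * expR y.
Proof.
case: m => [|m] y0; first by rewrite !expr0 mul1r -expR0 ler_expR.
have -> : expR y = expR (y / m.+1%:R) ^+ m.+1.
  by rewrite -expRM_natl mulrC divfK// pnatr_eq0.
rewrite -exprMn lerXn2r ?nnegrE// ?mulr_ge0 ?expR_ge0//.
rewrite mulrC -ler_pdivrMr ?ltr0n//.
by apply: le_trans (expR_ge1Dx _); rewrite lerDr.
Qed.

(** Since x^2 / 2 = 3 x^2 / 8 + x^2 / 8, the first part of the exponent absorbs the polynomial and
    the second is that of a normal density of standard deviation 2. *)
Lemma moment_le_normal_pdf (m : nat) :
  exists C, forall x : R, (1 + `|x|) ^+ m * phi x <= C * normal_pdf 0 2 x.
Proof.
(* 2^m comes from 1 + |x| <= 2 max (1, x^2), m^m from the exponential bound at 3 x^2 / 8, and 8^m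
   majorizes (8 / 3)^m. *)
pose K : R := 2 ^+ m * (1 + m%:R ^+ m * 8 ^+ m).
exists (K * normal_peak 1 / normal_peak 2) => x.
rewrite normal_pdf01E normal_pdfE// [leRHS]mulrA divfK ?gt_eqF ?normal_peak_gt0//.
rewrite mulrCA [K * _]mulrC -[leRHS]mulrA ler_wpM2l ?normal_peak_ge0//.
rewrite /normal_fun subr0.
have -> : expR (- (x ^+ 2) / 2) = expR (- (3 / 8 * x ^+ 2)) * expR (- x ^+ 2 / (2 ^+ 2 *+ 2)).
  by rewrite -expRD; congr expR; field.
rewrite mulrA ler_wpM2r ?expR_ge0//.
rewrite expRN ler_pdivrMr ?expR_gt0//.
have y0 : 0 <= 3 / 8 * x ^+ 2 by rewrite mulr_ge0 ?sqr_ge0.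
have e1 : 1 <= expR (3 / 8 * x ^+ 2) by rewrite -[leLHS]expR0 ler_expR.
have H : (1 + `|x|) ^+ m <= 2 ^+ m * (1 + (x ^+ 2) ^+ m).
  have [x1|x1] := lerP `|x| 1.
    apply: (@le_trans _ _ (2 ^+ m)).
      by rewrite lerXn2r ?nnegrE// ?addr_ge0//; lra.
    by rewrite ler_peMr ?exprn_ge0// lerDl exprn_ge0 ?sqr_ge0.
  apply: (@le_trans _ _ ((2 * x ^+ 2) ^+ m)).
    have x20 : 0 <= 2 * x ^+ 2 by apply: mulr_ge0 => //; exact: sqr_ge0.
    rewrite lerXn2r ?nnegrE ?addr_ge0//.
    have := real_normK (num_real x); nra.
  by rewrite exprMn ler_wpM2l ?exprn_ge0// lerDr.
apply: (le_trans H); rewrite /K -[leRHS]mulrA; apply: ler_wpM2l; first exact: exprn_ge0.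
rewrite mulrDl mul1r lerD//.
have := exprn_le_expR m y0; rewrite exprMn => {}H.
have : (8 / 3) ^+ m * ((3 / 8) ^+ m * (x ^+ 2) ^+ m) <= (8/3) ^+ m * (m%:R ^+ m * expR (3 / 8 * x ^+ 2)).
  by rewrite ler_wpM2l ?exprn_ge0.
rewrite mulrA -exprMn (_ : 8 / 3 * (3 / 8) = 1 :> R); last by field.
rewrite expr1n mul1r => /le_trans; apply.
rewrite mulrA ler_wpM2r ?expR_ge0// mulrC ler_wpM2l ?exprn_ge0//.
by rewrite lerXn2r ?nnegrE//; lra.
Qed.

Lemma rintegrable_weight_normal (m : nat) :
  rintegrable mu (fun x => (1 + `|x|) ^+ m * phi x).
Proof.
have [C HC] := moment_le_normal_pdf m.
apply: (@rintegrable_le _ _ _ mu _ (fun x : R => C * normal_pdf 0 2 x)).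
- apply: measurable_funM; last exact: measurable_normal_pdf.
  by apply: measurable_funX; apply: measurable_funD.
- by move=> x; rewrite ger0_norm// mulr_ge0 ?normal_pdf_ge0// exprn_ge0// addr_ge0.
- by apply: rintegrableZ; exact: integrable_normal_pdf.
Qed.

Lemma rintegrable_moment (m : nat) : rintegrable mu (fun x => x ^+ m * phi x).
Proof.
apply: (@rintegrable_le _ _ _ mu _ (fun x : R => (1 + `|x|) ^+ m * phi x)).
- apply: measurable_funM; last exact: measurable_normal_pdf.
  exact: measurable_funX.
- move=> x; rewrite normrM (ger0_norm (normal_pdf_ge0 _ _ _)).
  rewrite ler_wpM2r ?normal_pdf_ge0// normrX lerXn2r ?nnegrE ?addr_ge0//.
  by rewrite lerDr.
- exact: rintegrable_weight_normal.
Qed.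

Definition normal_moment (m : nat) := \int[mu]_x (x ^+ m * phi x).

Lemma normal_moment0 : normal_moment 0 = 1.
Proof.
rewrite /normal_moment /Rintegral; under eq_integral do rewrite mul1r.
by rewrite integral_normal_pdf.
Qed.

Lemma is_derive_normal_pdf (x : R) : is_derive x 1 phi (- x * phi x).
Proof.
rewrite (_ : phi = fun x => normal_peak 1 * expR (- (x ^+ 2) / 2)).
  by apply: is_derive_eq; rewrite /GRing.scale /=; field.
by apply/funext => y; rewrite normal_pdf01E.
Qed.

Lemma continuous_moment (m : nat) : continuous (fun x : R => x ^+ m * phi x).
Proof.
move=> x; apply: (@continuousM R _ (fun x : R => x ^+ m) phi).
  exact: exprn_continuous.
by apply: continuous_normal_pdf; rewrite oner_eq0.
Qed.

Lemma normal_moment1 : normal_moment 1 = 0.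
Proof.
have H : \int[mu]_x (-1 * (x ^+ 1 * phi x)) = 0.
  apply: (@integral_derive_eq0 _ (fun x : R => x ^+ 0 * phi x)
    (fun x : R => -1 * (x ^+ 1 * phi x))).
  - move=> x; have dphi := is_derive_normal_pdf x.
    rewrite (_ : (fun x : R => x ^+ 0 * phi x) = phi); last first.
      by apply/funext => y; rewrite mul1r.
    by apply: is_derive_eq; rewrite mulN1r mulNr.
  - move=> x; apply: (@continuousM R _ (fun=> _) (fun x : R => x ^+ _ * phi x));
      first exact: cst_continuous.
    exact: continuous_moment.
  - exact: rintegrable_moment.
  - exact: rintegrableZ (rintegrable_moment 1).
move: H; rewrite RintegralZl//; last exact: rintegrable_moment 1.
by rewrite mulN1r => /eqP; rewrite oppr_eq0 => /eqP.
Qed.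

(** The derivative of x^(m+1) phi is (m+1) x^m phi - x^(m+2) phi, and its integral vanishes. *)
Lemma normal_momentSS (m : nat) :
  normal_moment m.+2 = m.+1%:R * normal_moment m.
Proof.
have H : \int[mu]_x (m.+1%:R * (x ^+ m * phi x) - x ^+ m.+2 * phi x) = 0.
  apply: (@integral_derive_eq0 _ (fun x : R => x ^+ m.+1 * phi x)
    (fun x : R => m.+1%:R * (x ^+ m * phi x) - x ^+ m.+2 * phi x)).
  - move=> x; have dphi := is_derive_normal_pdf x.
    have dX := DeriveDef (@exprn_derivable R m.+1 x 1) (@exp_derive R m.+1 x 1).
    apply: (is_derive_eq (is_deriveM dX dphi)); rewrite /GRing.scale /= !exprS.
    ring.
  - move=> x; apply: (@continuousB _ _ _ (fun x : R => _ * (x ^+ _ * phi x))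
      (fun x : R => x ^+ _ * phi x)); last exact: continuous_moment.
    apply: (@continuousM R _ (fun=> _) (fun x : R => x ^+ _ * phi x));
      first exact: cst_continuous.
    exact: continuous_moment.
  - exact: rintegrable_moment.
  - apply: rintegrableB; last exact: rintegrable_moment.
    exact: rintegrableZ (rintegrable_moment m).
move: H; rewrite RintegralB//; last 2 first.
- exact: rintegrableZ (rintegrable_moment m).
- exact: rintegrable_moment m.+2.
rewrite RintegralZl//; last exact: rintegrable_moment m.
by move/eqP; rewrite subr_eq0 => /eqP.
Qed.

Lemma normal_moment2 : normal_moment 2 = 1.
Proof. by rewrite normal_momentSS normal_moment0 mulr1. Qed.

Lemma normal_moment3 : normal_moment 3 = 0.
Proof. by rewrite normal_momentSS normal_moment1 mulr0. Qed.

End gaussian_moments_line.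

Section product_integral_rV.
Context (R : realType).
Local Notation mu := (@lebesgue_measure R).

(** Integrability is obtained first, by Tonelli on absolute values; it then licenses Fubini to
    separate the factors. *)
Lemma rintegrable_rV_prod n (F : 'I_n -> R -> R) :
  (forall i, rintegrable mu (F i)) ->
  rintegrable (lebesgue_rV R n) (fun x => \prod_i F i (x 0 i)) /\
  \int[lebesgue_rV R n]_x (\prod_i F i (x 0 i)) = \prod_i \int[mu]_x F i x.
Proof.
elim: n F => [|n IH] F iF.
  have E : (fun x : 'rV[R]_0 => \prod_i F i (x 0 i)) = cst 1.
    by apply/funext => x; rewrite big_ord0.
  have E1 : (\int[lebesgue_rV R 0]_x (1 : R)%:E = 1)%E.
    by rewrite integral_cst// mul1e /= diracT.
  rewrite E big_ord0 /Rintegral E1; split => //.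
  apply/integrableP; split; first exact/measurable_EFinP.
  by under eq_integral do rewrite /= normr1; rewrite E1 ltry.
have [iP PE] := IH (fun i => F (lift ord0 i)) (fun i => iF _).
set p := (fun x : 'rV[R]_n => \prod_i F (lift ord0 i) (x 0 i)) in iP PE.
have consE (x : R) (y : 'rV[R]_n) :
    \prod_i F i (rV_cons (x, y) 0 i) = F ord0 x * p y.
  rewrite big_ord_recl rV_cons_head; congr (_ * _).
  by apply: eq_bigr => i _; rewrite rV_cons_lift.
have mf : measurable_fun setT (fun z : 'rV[R]_n.+1 => \prod_i F i (z 0 i)).
  apply: measurable_prod => i _; apply: (measurableT_comp (f := F i)).
    exact: rintegrable_measurable (iF i).
  exact: measurable_coord.
have fi : rintegrable (lebesgue_rV R n.+1) (fun z => \prod_i F i (z 0 i)).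
  apply/integrableP; split; first exact/measurable_EFinP.
  rewrite ge0_integral_rVS//; last by apply: measurableT_comp => //; exact/measurable_EFinP.
  under eq_integral => x _.
    under eq_integral do rewrite /= consE normrM EFinM.
    rewrite ge0_integralZl//; last first.
      exact/measurable_EFinP/rintegrable_measurable/(rintegrable_norm iP).
    over.
  rewrite ge0_integralZr//; last 2 first.
  - exact/measurable_EFinP/rintegrable_measurable/(rintegrable_norm (iF ord0)).
  - exact: integral_ge0.
  rewrite lte_mul_pinfty//.
  - exact: integral_ge0.
  - rewrite ge0_fin_numE; last exact: integral_ge0.
    by move/integrableP : (iF ord0) => [].
  - by move/integrableP : iP => [].
split => //; have [fic fiE] := integral_rVS fi.
rewrite big_ord_recl -PE /Rintegral fiE -(integral12_prod_meas1 fic) /fubini_F /=.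
under eq_integral => x _.
  under eq_integral do rewrite /= consE EFinM.
  rewrite integralZl//.
  over.
rewrite RintegralE// integralZr//; last exact: (iF ord0).
by rewrite (RintegralE (iF ord0)).
Qed.

End product_integral_rV.

Section gaussian_vector.
Context (R : realType) (n : nat) d (Om : measurableType d)
  (P : probability Om R) (e : Om -> 'rV[R]_n).
Hypothesis he : has_density P e (gauss_pdf 0 1).
Local Notation la := (lebesgue_rV R n).

Lemma std_gauss_pdfE (x : 'rV[R]_n) :
  gauss_pdf 0 1 x = \prod_i normal_pdf 0 1 (x 0 i).
Proof.
by rewrite gauss_pdf_prod// sqrtr1; apply: eq_bigr => i _; rewrite mxE.
Qed.

(** A monomial is given by its exponents, so that moments with possibly coinciding indices are all
    instances, with exponents such as [(l == i) + (l == j)]. *)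
Lemma gauss_moment (m : 'I_n -> nat) :
  rintegrable P (fun w => \prod_i e w 0 i ^+ m i) /\
  \int[P]_w (\prod_i e w 0 i ^+ m i) = \prod_i normal_moment R (m i).
Proof.
have [iF FE] := rintegrable_rV_prod (fun i => rintegrable_moment R (m i)).
have mf : measurable_fun setT (fun x : 'rV[R]_n => \prod_i x 0 i ^+ m i).
  apply: measurable_prod => i _; apply: measurable_funX.
  exact: measurable_coord.
have fE : (fun x : 'rV[R]_n => \prod_i (x 0 i ^+ m i * normal_pdf 0 1 (x 0 i))) =
    (fun x => (\prod_i x 0 i ^+ m i) * gauss_pdf 0 1 x).
  by apply/funext => x; rewrite std_gauss_pdfE big_split.
rewrite fE in iF FE.
have iP := (integrable_has_density he mf).2 iF.
by split => //; rewrite -FE; exact: (Rintegral_has_density he mf).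
Qed.

Lemma prod_exp_eq (x : 'rV[R]_n) (i : 'I_n) :
  \prod_(l < n) x 0 l ^+ (l == i) = x 0 i.
Proof.
by rewrite (bigD1 i)//= eqxx expr1 big1 ?mulr1// => l /negbTE ->.
Qed.

Lemma gauss_moment1 i :
  rintegrable P (fun w => e w 0 i) /\ \int[P]_w e w 0 i = 0.
Proof.
have [h1 h2] := gauss_moment (fun l => (l == i) : nat).
have E : (fun w => \prod_(l < n) e w 0 l ^+ (l == i)) = (fun w => e w 0 i).
  by apply/funext => w; rewrite prod_exp_eq.
rewrite E in h1 h2; split => //.
by rewrite h2 (bigD1 i)//= eqxx normal_moment1 mul0r.
Qed.

Lemma gauss_moment2 i j : rintegrable P (fun w => e w 0 i * e w 0 j) /\
  \int[P]_w (e w 0 i * e w 0 j) = (i == j)%:R.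
Proof.
have [h1 h2] := gauss_moment (fun l => (l == i) + (l == j))%N.
have E : (fun w => \prod_(l < n) e w 0 l ^+ ((l == i) + (l == j))) =
    (fun w => e w 0 i * e w 0 j).
  apply/funext => w; under eq_bigr do rewrite exprD.
  by rewrite big_split /= !prod_exp_eq.
rewrite E in h1 h2; split => //.
rewrite h2 (bigD1 i)//= eqxx; have [ij|ij] := eqVneq i j.
  rewrite normal_moment2 mul1r big1// => l; rewrite -ij => /negbTE ->.
  exact: normal_moment0.
by rewrite normal_moment1 mul0r.
Qed.

(** The total degree is odd, so some coordinate has exponent 1 or 3, whose moment is zero. *)
Lemma gauss_moment3 i j k :
  rintegrable P (fun w => e w 0 i * e w 0 j * e w 0 k) /\
  \int[P]_w (e w 0 i * e w 0 j * e w 0 k) = 0.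
Proof.
have [h1 h2] := gauss_moment (fun l => (l == i) + (l == j) + (l == k))%N.
have E : (fun w => \prod_(l < n) e w 0 l ^+ ((l == i) + (l == j) + (l == k))) =
    (fun w => e w 0 i * e w 0 j * e w 0 k).
  apply/funext => w; under eq_bigr do rewrite !exprD.
  by rewrite !big_split /= !prod_exp_eq.
rewrite E in h1 h2; split => //; rewrite h2.
have [ij|ij] := eqVneq i j.
  subst j; have [ik|ik] := eqVneq i k.
    by subst k; rewrite (bigD1 i)//= eqxx normal_moment3 mul0r.
  by rewrite (bigD1 k)//= eqxx eq_sym (negbTE ik) normal_moment1 mul0r.
have [ik|ik] := eqVneq i k.
  subst k; rewrite (bigD1 j)//= eqxx eq_sym (negbTE ij).
  by rewrite normal_moment1 mul0r.
by rewrite (bigD1 i)//= eqxx (negbTE ij) (negbTE ik) normal_moment1 mul0r.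
Qed.

(** The sup norm satisfies 1 + |x| <= prod (1 + |x_i|), which reduces the weight to a product of
    one-dimensional integrable functions. *)
Lemma rintegrable_gauss_weight (m : nat) :
  rintegrable P (fun w => (1 + `|e w|) ^+ m) /\
  \int[P]_w ((1 + `|e w|) ^+ m) =
  \int[la]_x ((1 + `|x|) ^+ m * gauss_pdf 0 1 x).
Proof.
have mf : measurable_fun setT (fun x : 'rV[R]_n => (1 + `|x|) ^+ m).
  apply: measurable_funX; apply: measurable_funD => //.
  apply: continuous_measurable_rV; exact: norm_continuous.
have iP : rintegrable P ((fun x => (1 + `|x|) ^+ m) \o e).
  apply/(integrable_has_density he mf).
  have [iF _] := rintegrable_rV_prod (fun i : 'I_n => rintegrable_weight_normal R m).
  apply: rintegrable_le iF.
    apply: measurable_funM => //; by case: he.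
  move=> x; rewrite big_split /= -std_gauss_pdfE normrM.
  rewrite (ger0_norm (gauss_pdf_ge0 _ _ _)) ler_wpM2r ?gauss_pdf_ge0//.
  rewrite ger0_norm ?exprn_ge0 ?addr_ge0// prodrXl.
  rewrite lerXn2r ?nnegrE ?addr_ge0 ?prodr_ge0//.
  have H1 (s : seq 'I_n) : 1 <= \prod_(i <- s) (1 + `|x 0 i|).
    elim: s => [|i s IH]; first by rewrite big_nil.
    by rewrite big_cons mulr_ege1// lerDl.
  rewrite -lerBrDl; apply: norm_rV_le => [|i]; first by rewrite subr_ge0.
  rewrite lerBrDl (bigD1 i)//= ler_peMr ?addr_ge0//.
  by rewrite -big_filter.
split => //; exact: Rintegral_has_density.
Qed.

End gaussian_vector.

Section independence.
Context d (Om : measurableType d) (R : realType) (P : probability Om R).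

Definition independent2 d1 d2 (T1 : measurableType d1) (T2 : measurableType d2)
    (U : Om -> T1) (V : Om -> T2) :=
  forall A B, measurable A -> measurable B ->
    P (U @^-1` A `&` V @^-1` B) = (P (U @^-1` A) * P (V @^-1` B))%E.

(** * Independence *)

Section joint_law.
Context d1 d2 (T1 : measurableType d1) (T2 : measurableType d2).
Variables (U : Om -> T1) (V : Om -> T2).
Hypotheses (mU : measurable_fun setT U) (mV : measurable_fun setT V)
  (UV : independent2 U V).

(** The joint law agrees with the product law on rectangles, hence everywhere, and Tonelli
    applies. *)
Lemma ge0_integral_independent2 (F : T1 * T2 -> \bar R) :
  measurable_fun setT F -> (forall z, 0 <= F z)%E ->
  (\int[P]_w F (U w, V w) = \int[P]_w \int[P]_w' F (U w, V w'))%E.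
Proof.
move=> mF F0.
have mUV : measurable_fun setT (fun w => (U w, V w)) by exact: measurable_fun_pair.
pose dU := distribution P (mfun_of mU); pose dV := distribution P (mfun_of mV).
pose dUV := distribution P (mfun_of mUV).
transitivity (\int[dUV]_z F z)%E.
  by rewrite ge0_integral_distribution.
transitivity (\int[(dU \x dV)%E]_z F z)%E.
  apply: eq_measure_integral => A mA _; apply/esym.
  by apply: product_measure_unique => // B C mB mC; exact: UV.
rewrite fubini_tonelli1// ge0_integral_distribution//; last 2 first.
- exact: measurable_fun_fubini_tonelli_F.
- by move=> x; apply: integral_ge0.
apply: eq_integral => w _ /=; rewrite /fubini_F.
rewrite (ge0_integral_distribution (mfun_of mV))//.
by apply: measurableT_comp => //; exact: measurable_pair1.
Qed.

Lemma rintegrable_independentM (A : T1 -> R) (B : T2 -> R) :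
  measurable_fun setT A -> measurable_fun setT B ->
  (forall u, 0 <= A u) -> (forall v, 0 <= B v) ->
  rintegrable P (A \o U) -> rintegrable P (B \o V) ->
  rintegrable P (fun w => A (U w) * B (V w)).
Proof.
move=> mA mB A0 B0 iA iB.
apply/integrableP; split.
  apply/measurable_EFinP; apply: measurable_funM.
    exact: (measurableT_comp (f := A)).
  exact: (measurableT_comp (f := B)).
under eq_integral do rewrite /= ger0_norm ?mulr_ge0//.
rewrite (ge0_integral_independent2 (F := fun z => (A z.1 * B z.2)%:E))//; last 2 first.
- apply/measurable_EFinP; apply: measurable_funM.
    exact: (measurableT_comp (f := A)).
  exact: (measurableT_comp (f := B)).
- by move=> z; rewrite lee_fin mulr_ge0.
rewrite (eq_integral (fun w => ((\int[P]_x B (V x)) * A (U w))%:E)).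
  by rewrite (RintegralE (rintegrableZ _ iA)) ltry.
move=> w _; under eq_integral do rewrite /= EFinM.
by rewrite integralZl// (RintegralE iB) -EFinM mulrC.
Qed.

(** An estimate valid for every frozen value of U is integrated over U. The separated bound A B
    makes F integrable, as Fubini requires. *)
Lemma Rintegral_independent2_le (F : T1 * T2 -> R) (A : T1 -> R) (B : T2 -> R)
    (G : T1 -> R) (c : R) :
  measurable_fun setT F -> measurable_fun setT A -> measurable_fun setT B ->
  (forall u, 0 <= A u) -> (forall v, 0 <= B v) ->
  (forall u v, `|F (u, v)| <= A u * B v) ->
  rintegrable P (A \o U) -> rintegrable P (B \o V) ->
  rintegrable P (G \o U) ->
  (forall u, `|\int[P]_w F (u, V w) - G u| <= c * A u) ->
  rintegrable P (fun w => F (U w, V w)) /\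
  `|\int[P]_w F (U w, V w) - \int[P]_w G (U w)| <= c * \int[P]_w A (U w).
Proof.
move=> mF mA mB A0 B0 FAB iA iB iG FG.
have mUV : measurable_fun setT (fun w => (U w, V w)) by exact: measurable_fun_pair.
pose dU := distribution P (mfun_of mU); pose dV := distribution P (mfun_of mV).
pose dUV := distribution P (mfun_of mUV).
have iF : rintegrable P (fun w => F (U w, V w)).
  apply: rintegrable_le (rintegrable_independentM mA mB A0 B0 iA iB) => //.
  exact: measurableT_comp.
split => //.
have mEF : measurable_fun setT (EFin \o F) by exact/measurable_EFinP.
have prodE X : measurable X -> dUV X = (dU \x dV)%E X.
  by move=> mX; apply/esym; apply: product_measure_unique => // B' C mB' mC; exact: UV.
have iF1 : (dU \x dV)%E.-integrable setT (EFin \o F).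
  have iF2 : dUV.-integrable setT (EFin \o F).
    exact: (@integrable_pushforward _ _ _ _ _ (mfun_of mUV)).
  move/integrableP : iF2 => [_ h]; apply/integrableP; split => //.
  rewrite (eq_measure_integral dUV)// => X mX _; exact/esym/prodE.
have iFV u : rintegrable P (fun w => F (u, V w)).
  apply: (@rintegrable_le _ _ _ _ _ (fun w => A u * B (V w))) => //.
    by apply: measurableT_comp => //; exact: measurable_fun_pair.
  exact: rintegrableZ.
have inner u : (\int[dV]_v (F (u, v))%:E = (\int[P]_w F (u, V w))%:E)%E.
  rewrite -RintegralE//.
  rewrite (integral_distribution (X := mfun_of mV) (f := fun v => (F (u, v))%:E))//; last first.
    exact: iFV.
  by apply: (measurableT_comp mEF); exact: measurable_fun_pair.
pose H u := \int[P]_w F (u, V w).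
have iH : rintegrable P (H \o U).
  have iHd : dU.-integrable setT (EFin \o H).
    apply: eq_integrable (integrable_fubini_F iF1) => // u _.
    by rewrite /fubini_F [LHS]inner.
  have mH := measurable_int _ iHd.
  move/integrableP : iHd => [_ h]; apply/integrableP; split.
    exact: (measurableT_comp mH).
  move: h; rewrite (ge0_integral_distribution (mfun_of mU))//.
  exact: measurableT_comp.
have -> : \int[P]_w F (U w, V w) = \int[P]_w H (U w).
  apply: EFin_inj; rewrite -!RintegralE//.
  transitivity (\int[dUV]_z (F z)%:E)%E.
    by rewrite (integral_distribution (X := mfun_of mUV) (f := EFin \o F)).
  transitivity (\int[(dU \x dV)%E]_z (F z)%:E)%E.
    by apply: eq_measure_integral => X mX _; exact: prodE.
  rewrite -(integral12_prod_meas1 iF1).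
  transitivity (\int[dU]_u (H u)%:E)%E.
    by apply: eq_integral => u _; exact: inner.
  rewrite (integral_distribution (X := mfun_of mU) (f := EFin \o H))//.
  have := measurable_int _ (integrable_fubini_F iF1).
  by apply: eq_measurable_fun => u _; rewrite /fubini_F [LHS]inner.
rewrite -RintegralB// -RintegralZl//.
apply: Rintegral_norm_le => //.
- apply: measurable_funB; first exact: rintegrable_measurable iH.
  exact: rintegrable_measurable iG.
- exact: rintegrableZ.
- by move=> w; exact: FG.
Qed.

End joint_law.

Section families.
Context (I : finType) (n : nat) (V : I -> Om -> 'rV[R]_n).
Hypotheses (mV : forall i, measurable_fun setT (V i))
  (iV : mutually_independent P V).

(* The pi-system generating the sigma-algebra of the variables indexed by J. *)
Definition family_events (J : pred I) : set (set Om) :=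
  [set E | exists A : I -> set 'rV[R]_n, [/\ forall i, measurable (A i),
     forall i, ~~ J i -> A i = setT & E = \bigcap_i (V i @^-1` A i)]].

Lemma family_events_measurable J : family_events J `<=` measurable.
Proof.
move=> E [A [mA _ ->]]; apply: fin_bigcap_measurable; first exact: finite_finset.
by move=> i _; rewrite -[X in measurable X]setTI; exact: mV.
Qed.

Lemma family_eventsT J : family_events J setT.
Proof.
exists (fun=> setT); split => //; apply/seteqP; split => //.
Qed.

Lemma family_eventsI J : setI_closed (family_events J).
Proof.
move=> E F [A [mA AT ->]] [B [mB BT ->]].
exists (fun i => A i `&` B i); split.
- by move=> i; exact: measurableI.
- by move=> i Ji; rewrite AT// BT// setTI.
- rewrite -bigcapI; apply: eq_bigcapr => i _; by rewrite preimage_setI.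
Qed.

Lemma family_events_var (J : pred I) i : J i ->
  @measurable_fun _ _ (g_sigma_algebraType (family_events J)) _ setT (V i).
Proof.
move=> Ji _ B mB; rewrite setTI; apply: sub_sigma_algebra.
exists (fun l => if l == i then B else setT); split.
- by move=> l; case: ifP.
- by move=> l Jl; case: eqP => // li; rewrite -li in Ji; rewrite Ji in Jl.
- apply/seteqP; split => [w /= Bw l _|w /(_ i Logic.I)]; last by rewrite /= eqxx.
  by rewrite /preimage /=; case: eqP => // ->.
Qed.

(** P restricted to the event of [V k], and P multiplied by the probability of that event, are
    finite measures that agree on the generating pi-system, hence on its sigma-algebra. *)
Lemma independent_family_events (J : pred I) k E B : ~~ J k ->
  <<s family_events J >> E -> measurable B ->
  P (E `&` V k @^-1` B) = (P E * P (V k @^-1` B))%E.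
Proof.
move=> Jk sE mB.
have mD : measurable (V k @^-1` B).
  by rewrite -[X in measurable X]setTI; exact: mV.
pose D := V k @^-1` B.
have fD : P D \is a fin_num by exact: fin_num_measure.
have nD : (0 <= fine (P D))%R by rewrite fine_ge0.
have H A : family_events J A -> mrestr P mD A = mscale (NngNum nD) P A.
  move=> [C [mC CT ->]]; rewrite /mrestr /mscale /= fineK//.
  (* As k lies outside J, [C k] is the whole space and B can be inserted there. *)
  pose C' i := if i == k then B else C i.
  have -> : \bigcap_i (V i @^-1` C i) `&` V k @^-1` B =
      \bigcap_i (V i @^-1` C' i).
    apply/seteqP; split => [w [/= Cw Bw] i _|w Cw].
      by rewrite /C' /preimage /=; case: eqP => [->//|_]; exact: Cw.
    split; last by have := Cw k Logic.I; rewrite /C' /preimage /= eqxx.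
    move=> i _; have := Cw i Logic.I; rewrite /C' /preimage /=.
    by case: eqP => // -> _; rewrite CT.
  rewrite !iV//; last by move=> i; rewrite /C'; case: ifP.
  rewrite (bigD1 k)//= [in RHS](bigD1 k)//= CT// preimage_setT probability_setT.
  rewrite mul1e /C' eqxx; congr (_ * _)%E.
  by apply: eq_bigr => i /negbTE ->.
have := @g_sigma_algebra_measure_unique _ R Om (family_events J)
  (@family_events_measurable J) (fun=> setT) (fun=> family_eventsT J) _
  (mrestr P mD) (mscale (NngNum nD) P) (@family_eventsI J) H.
have cT : \bigcup_(_ in [set: nat]) [set: Om] = setT.
  by apply/seteqP; split => // w _; exists 0%N.
have fT : (mrestr P mD setT < +oo)%E by rewrite /mrestr setTI ltey_eq fD.
move=> /(_ cT (fun=> fT) E sE) H2.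
transitivity (mrestr P mD E) => //.
rewrite H2; change ((fine (P D))%:E * P E = P E * P D)%E.
by rewrite fineK// muleC.
Qed.

Lemma independent2_family (J : pred I) k d1 (T1 : measurableType d1)
    (U : Om -> T1) : ~~ J k ->
  @measurable_fun _ _ (g_sigma_algebraType (family_events J)) _ setT U ->
  independent2 U (V k).
Proof.
move=> Jk mU A B mA mB; apply: independent_family_events Jk _ mB.
by have := mU measurableT A mA; rewrite setTI.
Qed.

Lemma measurable_family d1 (T1 : measurableType d1) (J : pred I) (U : Om -> T1) :
  @measurable_fun _ _ (g_sigma_algebraType (family_events J)) _ setT U ->
  measurable_fun setT U.
Proof.
move=> mU _ B mB; have := mU measurableT B mB; rewrite !setTI => sB.
apply: (smallest_sub (@sigma_algebra_measurable _ Om)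
  (@family_events_measurable J)); exact: sB.
Qed.

End families.
End independence.

(** * The classes C^{r,s} *)

Section weight.
Context {R : realType} {d : nat}.
Implicit Types x y : 'rV[R]_d.

(** At least 1 and submultiplicative: exponents can be raised freely, and moving the argument costs
    only a factor. *)
Definition weight x : R := 1 + `|x|.

Lemma weight_ge1 x : 1 <= weight x. Proof. by rewrite lerDl. Qed.

Lemma weight_gt0 x : 0 < weight x.
Proof. exact: lt_le_trans ltr01 (weight_ge1 x). Qed.

Lemma weight_ge0 x : 0 <= weight x. Proof. exact/ltW/weight_gt0. Qed.

Lemma weightX_ge1 x m : 1 <= weight x ^+ m.
Proof. exact: exprn_ege1 (weight_ge1 x). Qed.

Lemma weightX_ge0 x m : 0 <= weight x ^+ m.
Proof. exact: le_trans ler01 (weightX_ge1 x m). Qed.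

Lemma weight_leX x m n : (m <= n)%N -> weight x ^+ m <= weight x ^+ n.
Proof. by move=> mn; rewrite ler_weXn2l// weight_ge1. Qed.

Lemma weightD x y : weight (x + y) <= weight x * weight y.
Proof.
rewrite /weight mulrDl mul1r mulrDr mulr1.
have := ler_normD x y; have := normr_ge0 x; have := normr_ge0 y; nra.
Qed.

Lemma enorm_le x : enorm x <= d%:R * `|x|.
Proof.
rewrite /enorm -[leRHS]ger0_norm ?mulr_ge0// -sqrtr_sqr ler_wsqrtr//.
rewrite exprMn; apply: (@le_trans _ _ (\sum_(i < d) `|x| ^+ 2)).
  apply: ler_sum => i _; rewrite -[leLHS]real_normK ?num_real//.
  by rewrite lerXn2r ?nnegrE// coord_le_norm.
rewrite sumr_const card_ord -[leLHS]mulr_natl ler_wpM2r ?sqr_ge0//.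
by rewrite -natrX ler_nat; case: (d) => // k; rewrite leq_pmulr.
Qed.

Lemma le_enorm x : `|x| <= enorm x.
Proof.
apply: norm_rV_le; first exact: sqrtr_ge0.
move=> i; rewrite -sqrtr_sqr ler_wsqrtr// (bigD1 i)//= lerDl.
by apply: sumr_ge0 => j _; exact: sqr_ge0.
Qed.

Lemma enorm_weight x m : (1 + enorm x) ^+ m <= (d.+1%:R) ^+ m * weight x ^+ m.
Proof.
rewrite -exprMn lerXn2r ?nnegrE ?addr_ge0 ?sqrtr_ge0 ?mulr_ge0 ?weight_ge0//.
have := enorm_le x; rewrite -natr1 /weight; have := normr_ge0 x.
have : 0 <= d%:R :> R by []. nra.
Qed.

End weight.

Section regular.
Context {R : realType} {d : nat} (T : R).
Implicit Types F G : R -> 'rV[R]_d -> R.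

Definition poly_growth F := exists (C : R) (m : nat), 0 <= C /\
  forall t x, t \in `[0, T] -> `|F t x| <= C * weight x ^+ m.

Definition cont_strip F :=
  {within `[0, T] `*` [set: 'rV[R]_d],
    continuous (fun tx : R * 'rV[R]_d => F tx.1 tx.2)}.

Definition regular F := cont_strip F /\ poly_growth F.

Lemma poly_growthD F G : poly_growth F -> poly_growth G ->
  poly_growth (fun t x => F t x + G t x).
Proof.
move=> [C [m [C0 FC]]] [C' [m' [C0' GC]]]; exists (C + C'), (maxn m m').
split=> [|t x tT]; first by rewrite addr_ge0.
apply: le_trans (ler_normD _ _) _; rewrite mulrDl lerD//.
  by apply: le_trans (FC _ _ tT) _; rewrite ler_wpM2l// weight_leX// leq_maxl.
by apply: le_trans (GC _ _ tT) _; rewrite ler_wpM2l// weight_leX// leq_maxr.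
Qed.

Lemma poly_growthM F G : poly_growth F -> poly_growth G ->
  poly_growth (fun t x => F t x * G t x).
Proof.
move=> [C [m [C0 FC]]] [C' [m' [C0' GC]]]; exists (C * C'), (m + m')%N.
split=> [|t x tT]; first by rewrite mulr_ge0.
by rewrite normrM exprD mulrACA ler_pM// ?FC// GC.
Qed.

Lemma regularD F G : regular F -> regular G ->
  regular (fun t x => F t x + G t x).
Proof.
move=> [cF gF] [cG gG]; split; last exact: poly_growthD.
by move=> z; apply: (@continuousD _ _ _ (fun tx : subspace _ => F tx.1 tx.2)); [exact: cF|exact: cG].
Qed.

Lemma regularM F G : regular F -> regular G ->
  regular (fun t x => F t x * G t x).
Proof.
move=> [cF gF] [cG gG]; split; last exact: poly_growthM.
by move=> z; apply: (@continuousM _ _ (fun tx : subspace _ => F tx.1 tx.2)); [exact: cF|exact: cG].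
Qed.

Lemma regular_cst (c : R) : regular (fun _ _ => c).
Proof.
split; first by move=> z; exact: cst_continuous.
by exists `|c|, 0%N; split => // t x _; rewrite mulr1.
Qed.

Lemma regular_sum (I : eqType) (s : seq I) (F : I -> R -> 'rV[R]_d -> R) :
  {in s, forall i, regular (F i)} ->
  regular (fun t x => \sum_(i <- s) F i t x).
Proof.
elim: s => [|i s IH] H.
  rewrite (_ : (fun _ _ => _) = fun _ _ => 0); first exact: regular_cst.
  by apply/funext => t; apply/funext => x; rewrite big_nil.
rewrite (_ : (fun _ _ => _) = fun t x => F i t x + \sum_(i <- s) F i t x); last first.
  by apply/funext => t; apply/funext => x; rewrite big_cons.
apply: regularD; first by apply: H; rewrite inE eqxx.
by apply: IH => j js; apply: H; rewrite inE js orbT.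
Qed.

Lemma is_derive_sum_seq (V : normedModType R) (I : eqType) (s : seq I)
    (F : I -> V -> R) (dF : I -> R) (x v : V) :
  {in s, forall i, is_derive x v (F i) (dF i)} ->
  is_derive x v (fun y => \sum_(i <- s) F i y) (\sum_(i <- s) dF i).
Proof.
elim: s => [|i s IH] H.
  rewrite big_nil (_ : (fun _ => _) = cst 0); first exact: is_derive_cst.
  by apply/funext => y; rewrite big_nil.
rewrite big_cons (_ : (fun y => _) = F i \+ (fun y => \sum_(i <- s) F i y)); last first.
  by apply/funext => y; rewrite big_cons.
apply: is_deriveD; first by apply: H; rewrite inE eqxx.
by apply: IH => j js; apply: H; rewrite inE js orbT.
Qed.

End regular.

Section jets.
Context {R : realType} {d : nat} (T : R).
Implicit Types (D E : nat -> seq 'I_d -> R -> 'rV[R]_d -> R)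
  (u v : R -> 'rV[R]_d -> R).

(** The family of derivatives behind [classC] as an object of its own, on which sums, products and
    derivatives operate. *)
Definition jet (r s : nat) D : Prop :=
  [/\ forall a al, (a <= r)%N -> (size al <= s)%N -> regular T (D a al),
      forall a al t x, (a < r)%N -> (size al <= s)%N -> t \in `]0, T[ ->
        is_derive t 1 (fun t' => D a al t' x) (D a.+1 al t x)
    & forall a al i t x, (a <= r)%N -> (size al < s)%N -> t \in `[0, T] ->
        is_derive x (basis_vec i) (D a al t) (D a (i :: al) t x)].

Lemma classC_jet r s u : classC r s T u ->
  exists2 D, (forall t x, t \in `[0, T] -> D 0%N [::] t x = u t x) & jet r s D.
Proof.
move=> [D [D0 Dreg Dt Dx]]; exists D => //; split => // a al ar als.
have [cD [C [m DC]]] := Dreg _ _ ar als; split => //.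
exists (`|C| * d.+1%:R ^+ m), m; split => [|t x tT]; first by rewrite mulr_ge0.
apply: le_trans (DC _ _ tT) _; rewrite -mulrA.
apply: (@le_trans _ _ (`|C| * (1 + enorm x) ^+ m)).
  by rewrite ler_wpM2r ?ler_norm// exprn_ge0// addr_ge0// sqrtr_ge0.
by rewrite ler_wpM2l// enorm_weight.
Qed.

Lemma jet_classC r s u D :
  (forall t x, t \in `[0, T] -> D 0%N [::] t x = u t x) ->
  jet r s D -> classC r s T u.
Proof.
move=> D0 [Dreg Dt Dx]; exists D; split => // a al ar als.
have [cD [C [m [C0 DC]]]] := Dreg _ _ ar als; split => //.
exists C, m => t x tT; apply: le_trans (DC _ _ tT) _.
rewrite ler_wpM2l// lerXn2r ?nnegrE ?weight_ge0 ?addr_ge0 ?sqrtr_ge0//.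
by rewrite lerD2l le_enorm.
Qed.

Lemma jet_le r s r' s' D : (r' <= r)%N -> (s' <= s)%N ->
  jet r s D -> jet r' s' D.
Proof.
move=> rr ss [Dreg Dt Dx]; split.
- by move=> a al ar als; apply: Dreg; [exact: leq_trans rr|exact: leq_trans ss].
- move=> a al t x ar als tT; apply: Dt => //; first exact: leq_trans rr.
  exact: leq_trans ss.
- move=> a al i t x ar als tT; apply: Dx => //; first exact: leq_trans rr.
  exact: leq_trans ss.
Qed.

(** A new direction is put at the head of the list, so the derivative taken first sits at its end,
    whence [rcons]. *)
Lemma jet_space r s D i : jet r s.+1 D -> jet r s (fun a al => D a (rcons al i)).
Proof.
move=> [Dreg Dt Dx]; split.
- by move=> a al ar als; apply: Dreg => //; rewrite size_rcons.
- by move=> a al t x ar als tT; apply: Dt => //; rewrite size_rcons.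
- by move=> a al j t x ar als tT; apply: Dx => //; rewrite size_rcons.
Qed.

Lemma jetD r s D E : jet r s D -> jet r s E ->
  jet r s (fun a al t x => D a al t x + E a al t x).
Proof.
move=> [Dreg Dt Dx] [Ereg Et Ex]; split.
- by move=> a al ar als; apply: regularD; [exact: Dreg|exact: Ereg].
- by move=> a al t x ar als tT; apply: is_deriveD; [exact: Dt|exact: Et].
- by move=> a al j t x ar als tT; apply: is_deriveD; [exact: Dx|exact: Ex].
Qed.

(** Leibniz rule without binomial coefficients: each single derivative goes to one of the two
    factors, and all distributions are listed with repetition. The list for space directions follows
    the same pattern. *)
Fixpoint time_splits (a : nat) : seq (nat * nat) :=
  if a is a'.+1 then
    [seq (q.1.+1, q.2) | q <- time_splits a'] ++
    [seq (q.1, q.2.+1) | q <- time_splits a']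
  else [:: (0, 0)%N].

Fixpoint space_splits (al : seq 'I_d) : seq (seq 'I_d * seq 'I_d) :=
  if al is i :: al' then
    [seq (i :: q.1, q.2) | q <- space_splits al'] ++
    [seq (q.1, i :: q.2) | q <- space_splits al']
  else [:: ([::], [::])].

Lemma time_splitsP a q : q \in time_splits a -> (q.1 <= a)%N && (q.2 <= a)%N.
Proof.
elim: a q => [|a IH] q /=; first by rewrite inE => /eqP ->.
rewrite mem_cat => /orP[] /mapP[p /IH /andP[h1 h2] ->] /=.
  by rewrite ltnS h1 (leq_trans h2).
by rewrite ltnS h2 (leq_trans h1).
Qed.

Lemma space_splitsP al q : q \in space_splits al ->
  (size q.1 <= size al)%N && (size q.2 <= size al)%N.
Proof.
elim: al q => [|i al IH] q /=; first by rewrite inE => /eqP ->.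
rewrite mem_cat => /orP[] /mapP[p /IH /andP[h1 h2] ->] /=.
  by rewrite ltnS h1 (leq_trans h2).
by rewrite ltnS h2 (leq_trans h1).
Qed.

Definition jet_mul D E : nat -> seq 'I_d -> R -> 'rV[R]_d -> R :=
  fun a al t x => \sum_(q <- time_splits a) \sum_(p <- space_splits al)
    D q.1 p.1 t x * E q.2 p.2 t x.

Lemma jetM r s D E : jet r s D -> jet r s E -> jet r s (jet_mul D E).
Proof.
move=> [Dreg Dt Dx] [Ereg Et Ex]; split.
- move=> a al ar als; apply: regular_sum => q /time_splitsP /andP[q1 q2].
  apply: regular_sum => p /space_splitsP /andP[p1 p2].
  by apply: regularM; [apply: Dreg|apply: Ereg]; exact: leq_trans ar || exact: leq_trans als.
- move=> a al t x ar als tT.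
  rewrite (_ : jet_mul D E a.+1 al t x = \sum_(q <- time_splits a)
    \sum_(p <- space_splits al) (D q.1 p.1 t x * E q.2.+1 p.2 t x +
                                 E q.2 p.2 t x * D q.1.+1 p.1 t x)); last first.
    rewrite /jet_mul /= big_cat !big_map /= -big_split /=.
    apply: eq_bigr => q _; rewrite -big_split /=; apply: eq_bigr => p _.
    by rewrite addrC; congr (_ + _); rewrite mulrC.
  apply: is_derive_sum_seq => q /time_splitsP /andP[q1 q2].
  apply: is_derive_sum_seq => p /space_splitsP /andP[p1 p2].
  apply: is_deriveM.
    apply: Dt => //; first exact: leq_ltn_trans ar.
    exact: leq_trans als.
  apply: Et => //; first exact: leq_ltn_trans ar.
  exact: leq_trans als.
- move=> a al i t x ar als tT.
  rewrite (_ : jet_mul D E a (i :: al) t x = \sum_(q <- time_splits a)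
    \sum_(p <- space_splits al) (D q.1 p.1 t x * E q.2 (i :: p.2) t x +
                                 E q.2 p.2 t x * D q.1 (i :: p.1) t x)); last first.
    rewrite /jet_mul /=; apply: eq_bigr => q _.
    rewrite big_cat !big_map /= -big_split /=; apply: eq_bigr => p _.
    by rewrite addrC; congr (_ + _); rewrite mulrC.
  apply: is_derive_sum_seq => q /time_splitsP /andP[q1 q2].
  apply: is_derive_sum_seq => p /space_splitsP /andP[p1 p2].
  apply: is_deriveM.
    apply: Dx => //; first exact: leq_trans ar.
    exact: leq_ltn_trans als.
  apply: Ex => //; first exact: leq_trans ar.
  exact: leq_ltn_trans als.
Qed.

Definition jet_cst (c : R) : nat -> seq 'I_d -> R -> 'rV[R]_d -> R :=
  fun a al t x => if (a == 0%N) && (al == [::]) then c else 0.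

Lemma jet_cstP r s c : jet r s (jet_cst c).
Proof.
split.
- by move=> a al _ _; exact: regular_cst.
- by move=> a al t x _ _ _; exact: is_derive_cst.
- move=> a al i t x _ _ _; rewrite /jet_cst /= andbF.
  exact: is_derive_cst.
Qed.

Lemma classC_le r s r' s' u : (r' <= r)%N -> (s' <= s)%N ->
  classC r s T u -> classC r' s' T u.
Proof.
move=> rr ss /classC_jet[D D0 Dj]; apply: jet_classC D0 _.
exact: jet_le rr ss Dj.
Qed.

Lemma classC_eq r s u v : (forall t x, t \in `[0, T] -> u t x = v t x) ->
  classC r s T u -> classC r s T v.
Proof.
move=> uv /classC_jet[D D0 Dj]; apply: jet_classC Dj => t x tT.
by rewrite D0// uv.
Qed.

Lemma classC_cst r s c : classC r s T (fun (_ : R) (_ : 'rV[R]_d) => c).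
Proof. by apply: jet_classC (jet_cstP r s c). Qed.

Lemma classCD r s u v : classC r s T u -> classC r s T v ->
  classC r s T (fun t x => u t x + v t x).
Proof.
move=> /classC_jet[D D0 Dj] /classC_jet[E E0 Ej].
by apply: jet_classC (jetD Dj Ej) => t x tT; rewrite D0// E0.
Qed.

Lemma classCM r s u v : classC r s T u -> classC r s T v ->
  classC r s T (fun t x => u t x * v t x).
Proof.
move=> /classC_jet[D D0 Dj] /classC_jet[E E0 Ej].
apply: jet_classC (jetM Dj Ej) => t x tT.
by rewrite /jet_mul /= !big_seq1 D0// E0.
Qed.

Lemma classCZ r s c u : classC r s T u -> classC r s T (fun t x => c * u t x).
Proof. by move=> Cu; apply: classCM => //; exact: classC_cst. Qed.

Lemma classCN r s u : classC r s T u -> classC r s T (fun t x => - u t x).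
Proof.
move=> /(classCZ (-1)); apply: classC_eq => t x _; exact: mulN1r.
Qed.

Lemma classCB r s u v : classC r s T u -> classC r s T v ->
  classC r s T (fun t x => u t x - v t x).
Proof. by move=> Cu Cv; apply: classCD => //; exact: classCN. Qed.

Lemma classC_sum r s (I : Type) (l : seq I) (F : I -> R -> 'rV[R]_d -> R) :
  (forall i, classC r s T (F i)) ->
  classC r s T (fun t x => \sum_(i <- l) F i t x).
Proof.
move=> CF; elim: l => [|i l IH].
  by apply: classC_eq (classC_cst r s 0) => t x _; rewrite big_nil.
by apply: classC_eq (classCD (CF i) IH) => t x _; rewrite big_cons.
Qed.

Lemma is_derive_partial r s u D i t x :
  (forall t x, t \in `[0, T] -> D 0%N [::] t x = u t x) -> jet r s.+1 D ->
  t \in `[0, T] -> is_derive x (basis_vec i) (u t) (D 0%N [:: i] t x).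
Proof.
move=> D0 [_ _ Dx] tT; rewrite (_ : u t = D 0%N [::] t); first exact: Dx.
by apply/funext => y; rewrite D0.
Qed.

Lemma classC_partial r s u i : classC r s.+1 T u ->
  classC r s T (fun t x => 'D_(basis_vec i) (u t) x).
Proof.
move=> /classC_jet[D D0 Dj]; apply: jet_classC (jet_space i Dj) => t x tT.
by have H := is_derive_partial i x D0 Dj tT; rewrite derive_val.
Qed.

Lemma classC_time r s (g : R -> R) : C1_time T g -> (r <= 1)%N ->
  classC r s T (fun t (_ : 'rV[R]_d) => g t).
Proof.
move=> [dg [cg cdg gd]] r1.
pose D (a : nat) (al : seq 'I_d) (t : R) (x : 'rV[R]_d) : R :=
  if al is [::] then (if a is 0%N then g t else dg t) else 0.
have creg (k : R -> R) : {within `[0, T], continuous k} ->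
    regular T (fun t (_ : 'rV[R]_d) => k t).
  move=> ck; split.
    apply/subspace_continuousP => -[t x] [/= tT _].
    have /subspace_continuousP /(_ t tT) := ck.
    move=> h A nA; have H : nbhs t (fun y => `[0, T]%classic y -> A (k y)).
      exact: h A nA.
    have H2 : nbhs (t, x) (fst @^-1` (fun y => `[0, T]%classic y -> A (k y))).
      exact: (@cvg_fst _ _ _ _ (nbhs_filter _) _ H).
    by apply: filterS H2 => z Hz [/= zT _]; exact: Hz.
  have /compact_bounded [M [_ HM]] : compact (k @` `[0, T]).
    by apply: continuous_compact => //; exact: segment_compact.
  exists (`|M| + 1), 0%N; split => [|t x tT]; first by rewrite addr_ge0.
  rewrite mulr1; apply: HM; last by exists t.
  by rewrite (le_lt_trans (ler_norm _))// ltrDl.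
apply: (@jet_classC _ _ _ D) => //; split.
- move=> a [|i al] ar als; last exact: regular_cst.
  by case: a ar => [|a] ar; exact: creg.
- move=> a [|i al] t x ar als tT; last exact: is_derive_cst.
  by case: a ar => [|a] ar; [exact: gd|move: (leq_trans ar r1)].
- by move=> a [|j al] i t x ar als tT; exact: is_derive_cst.
Qed.

End jets.

(** * Gaussian Taylor expansions *)

Section line_calculus.
Context (R : realType).

Lemma scale_one (h : R) : h *: (1 : R) = h.
Proof. exact: mulr1. Qed.

Lemma is_derive_continuous (f df : R -> R) :
  (forall x : R, is_derive x 1 f (df x)) -> continuous f.
Proof.
move=> fd x; apply: differentiable_continuous; apply/derivable1_diffP.
exact: ex_derive.
Qed.

Lemma mean_value_signed (f df : R -> R) (h : R) :
  (forall x : R, is_derive x 1 f (df x)) ->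
  exists2 c, `|c| <= `|h| & f h - f 0 = h * df c.
Proof.
move=> fd; have cf := is_derive_continuous fd.
have [h0|h0] := leP 0 h.
  have [|c] := @MVT_segment _ f df 0 h h0 (fun x _ => fd x).
    exact: continuous_subspaceT.
  rewrite in_itv/= subr0 => /andP[c0 ch] ->; exists c; last by rewrite mulrC.
  by rewrite !ger0_norm.
have [|c] := @MVT_segment _ f df h 0 (ltW h0) (fun x _ => fd x).
  exact: continuous_subspaceT.
rewrite in_itv/= sub0r => /andP[c0 ch] E; exists c.
  by rewrite !ler0_norm ?lerN2// ltW.
by rewrite -opprB E mulrN opprK mulrC.
Qed.

(** The derivative of the remainder is the remainder, one order lower, of the derivative; the mean
    value theorem then gains one factor x per order. *)
Lemma taylor_bound (n : nat) (g : nat -> R -> R) (M : R) :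
  (forall k (x : R), (k < n)%N -> is_derive x 1 (g k) (g k.+1 x)) ->
  (forall x, 0 <= x <= 1 -> `|g n x| <= M) ->
  forall x, 0 <= x <= 1 ->
  `|g 0%N x - \sum_(k < n) g k 0 * x ^+ k / k`!%:R| <= M * x ^+ n.
Proof.
elim: n g => [|n IH] g gd gM x x01.
  by rewrite big_ord0 subr0 mulr1 gM.
pose H y := g 0%N y - \sum_(k < n.+1) g k 0 * y ^+ k / k`!%:R.
pose dH y := g 1%N y - \sum_(k < n) g k.+1 0 * y ^+ k / k`!%:R.
have dHM y : 0 <= y <= 1 -> `|dH y| <= M * y ^+ n.
  move=> y01; apply: (IH (fun k => g k.+1)) => // k z kn.
  exact: gd.
have HE y : H y = g 0%N y - (g 0%N 0 + \sum_(k < n) g k.+1 0 * y ^+ k.+1 / k.+1`!%:R).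
  by rewrite /H big_ord_recl /= expr0 mulr1 divr1.
have Hd (y : R) : is_derive y 1 H (dH y).
  rewrite (_ : H = (fun y => g 0%N y - (g 0%N 0 + \sum_(k < n) g k.+1 0 * y ^+ k.+1 / k.+1`!%:R))); last by apply/funext.
  apply: is_deriveB; first exact: gd.
  rewrite -[X in is_derive _ _ _ X]add0r; apply: is_deriveD.
  apply: is_derive_sum_seq => k _.
  have dX := DeriveDef (@exprn_derivable R k.+1 y 1) (@exp_derive R k.+1 y 1).
  have := is_deriveZ (g k.+1 0 / k.+1`!%:R) dX.
  rewrite /GRing.scale /= mulr1 => K.
  rewrite (_ : (fun _ => _) = (g k.+1 0 / k.+1`!%:R) \*: (fun y : R => y ^+ k.+1)); last first.
    by apply/funext => z /=; rewrite /GRing.scale /= mulrAC.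
  apply: (is_derive_eq K).
  rewrite factS natrM; have : (k.+1)%:R != 0 :> R by rewrite pnatr_eq0.
  have : (k`!)%:R != 0 :> R by rewrite pnatr_eq0 -lt0n fact_gt0.
  by move: (k.+1%:R : R) (k`!%:R : R) => a b h1 h2; field; rewrite h1 h2.
have H0 : H 0 = 0.
  by rewrite HE big1 ?addr0 ?subrr// => k _; rewrite expr0n mulr0 mul0r.
move: x01 => /andP[x0 x1].
have [|c] := @MVT_segment _ H dH 0 x x0 (fun y _ => Hd y).
  exact: continuous_subspaceT (is_derive_continuous Hd).
rewrite in_itv/= H0 !subr0 => /andP[c0 cx] HxE.
change (`|H x| <= M * x ^+ n.+1); rewrite HxE normrM (ger0_norm x0) exprSr mulrA.
rewrite ler_wpM2r//; apply: (le_trans (dHM _ _)); first by rewrite c0 (le_trans cx).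
have M0 : 0 <= M by apply: le_trans (gM 0 _); rewrite ?lexx ?ler01.
by rewrite ler_wpM2l// lerXn2r ?nnegrE.
Qed.

End line_calculus.

Section directional.
Context (R : realType) (d : nat).
Implicit Types (F : 'rV[R]_d -> R) (G : 'rV[R]_d -> R).

Lemma is_derive_line F G (x v : 'rV[R]_d) (r : R) :
  (forall y, is_derive y v F (G y)) ->
  is_derive r 1 (fun r : R => F (x + r *: v)) (G (x + r *: v)).
Proof.
move=> FG; apply: is_derive_eq_along (FG (x + r *: v)) => h.
by rewrite scale_one scalerDl addrCA.
Qed.

Lemma is_deriveZdir F (x v : 'rV[R]_d) (c df : R) :
  is_derive x v F df -> is_derive x (c *: v) F (c * df).
Proof.
move=> [D1 D2].
have [->|c0] := eqVneq c 0; first by rewrite scale0r mul0r; exact: is_derive0.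
have H : is_derive (0 : R) 1 (fun r : R => F (r *: v + x)) df.
  apply: is_derive_eq_along (DeriveDef D1 D2) => h.
  by rewrite addr0 scale_one.
have H2 : is_derive (0:R) 1 (fun r : R => r * c) c.
  by apply: is_derive_eq; rewrite /GRing.scale /= mulr0 add0r mulr1.
have H' : is_derive (0 * c : R) 1 (fun r : R => F (r *: v + x)) df.
  by rewrite mul0r.
have K := is_derive1_comp (f := fun r : R => F (r *: v + x))
  (g := fun r : R => r * c) H' H2.
rewrite mulrC; apply: is_derive_eq_along K => h /=.
by rewrite addr0 scale_one scalerA.
Qed.

(** Moving along v first and then along w, the second increment is, by the mean value theorem, h
    times a value of G2 near x, and G2 is continuous. *)
Lemma is_deriveDdir F G1 G2 (v w : 'rV[R]_d) :
  (forall y, is_derive y v F (G1 y)) -> (forall y, is_derive y w F (G2 y)) ->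
  continuous G2 ->
  forall x, is_derive x (v + w) F (G1 x + G2 x).
Proof.
move=> FG1 FG2 cG2 x.
have C : h^-1 *: ((F \o shift x) (h *: (v + w)) - F x) @[h --> 0^'] --> G1 x + G2 x.
  have C1 : h^-1 *: ((F \o shift x) (h *: v) - F x) @[h --> 0^'] --> G1 x.
    have [D1 D2] := FG1 x; rewrite -D2; exact: D1.
  rewrite (_ : (fun h => _) = (fun h => h^-1 *: ((F \o shift x) (h *: v) - F x)) \+
    (fun h => h^-1 *: (F (x + h *: v + h *: w) - F (x + h *: v)))); last first.
    apply/funext => h /=; rewrite -scalerDr; congr (_ *: _).
    rewrite scalerDr -addrA [_ + x]addrC addrA [h *: v + x]addrC.
    by rewrite [RHS]addrC addrA subrK.
  apply: cvgD => //.
  apply/cvgrPdist_le => e e0.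
  have /cvgrPdist_le /(_ e e0) := cG2 x.
  move=> /nbhs_ballP[r /= r0 rG].
  pose M := `|v| + `|w| + 1.
  have M0 : 0 < M by rewrite ltr_wpDl// addr_ge0.
  near=> h.
  have hM : `|h| * M < r.
    rewrite -ltr_pdivlMr//; near: h; apply: dnbhs0_lt; exact: divr_gt0.
  have h0 : h != 0 by near: h; exact: nbhs_dnbhs_neq.
  have [c ch E] := mean_value_signed h (fun s => is_derive_line (x + h *: v) s FG2).
  rewrite scale0r addr0 in E.
  rewrite E /GRing.scale /= mulKf//.
  apply: rG; rewrite -ball_normE /=.
  rewrite -!addrA opprD addrA subrr sub0r normrN.
  apply: le_lt_trans hM; apply: le_trans (ler_normD _ _) _.
  rewrite !normrZ /M !mulrDr mulr1 -addrA lerD//.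
  by rewrite -[leLHS]addr0 lerD// ler_wpM2r.
split; first by apply/cvg_ex; exists (G1 x + G2 x).
exact/cvg_lim.
Unshelve. all: by end_near. Qed.

(** Basis vectors are added one at a time, the continuity of each partial derivative making
    directional derivatives additive. *)
Lemma is_derive_dir F (G : 'I_d -> 'rV[R]_d -> R) (v : 'rV[R]_d) :
  (forall i y, is_derive y (basis_vec i) F (G i y)) ->
  (forall i, continuous (G i)) ->
  forall x, is_derive x v F (\sum_i v 0 i * G i x).
Proof.
move=> FG cG x; rewrite {1}(row_sum_delta v).
move: x; elim: (index_enum _) => [|i s IH] x.
  by rewrite !big_nil; exact: is_derive0.
rewrite !big_cons addrC [X in is_derive _ _ _ X]addrC.
apply: (is_deriveDdir (G1 := fun x => \sum_(j <- s) v 0 j * G j x)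
  (G2 := fun x => v 0 i * G i x)) => // y.
  exact: is_deriveZdir.
apply: continuousM; first exact: cst_continuous.
exact: cG.
Qed.

End directional.

Section space_jet.
Context (R : realType) (d : nat).
Implicit Types (E : seq 'I_d -> 'rV[R]_d -> R) (v x : 'rV[R]_d).

Definition space_jet (s : nat) E :=
  (forall al, (size al <= s)%N -> continuous (E al)) /\
  (forall al i x, (size al < s)%N -> is_derive x (basis_vec i) (E al) (E (i :: al) x)).

(** The k-th derivative along v, that is, the k-linear derivative evaluated at (v, ..., v), expanded
    over all lists of k directions. *)
Fixpoint dir_deriv E v (k : nat) (al : seq 'I_d) x : R :=
  if k is k'.+1 then \sum_i v 0 i * dir_deriv E v k' (i :: al) x else E al x.

Lemma dir_derivZ E c v k al x :
  dir_deriv E (c *: v) k al x = c ^+ k * dir_deriv E v k al x.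
Proof.
elim: k al => [|k IH] al /=; first by rewrite expr0 mul1r.
rewrite mulr_sumr; apply: eq_bigr => i _.
by rewrite IH mxE exprS mulrACA.
Qed.

Lemma is_derive_dir_deriv s E v k al x : space_jet s E ->
  (size al + k < s)%N ->
  is_derive x v (dir_deriv E v k al) (dir_deriv E v k.+1 al x).
Proof.
move=> [cE dE]; elim: k al x => [|k IH] al x als.
  apply: (@is_derive_dir _ _ _ (fun i => E (i :: al))) => [i y|i].
    by apply: dE; rewrite addn0 in als.
  by apply: cE; rewrite addn0 in als.
rewrite [dir_deriv E v k.+1 al](_ : _ =
  fun x => \sum_i v 0 i * dir_deriv E v k (i :: al) x) //.
rewrite [dir_deriv E v k.+2 al x](_ : _ =
  \sum_i v 0 i * dir_deriv E v k.+1 (i :: al) x) //.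
apply: is_derive_sum_seq => i _.
apply: (is_deriveZ (v 0 i)).
by apply: IH; rewrite /= addSnnS.
Qed.

(** One-variable Taylor formula for r -> E (c + r v) on [0, 1], read at r = 1. *)
Lemma space_taylor n E c v (M : R) : space_jet n E ->
  (forall r, 0 <= r <= 1 -> `|dir_deriv E v n [::] (c + r *: v)| <= M) ->
  `|E [::] (c + v) - \sum_(k < n) dir_deriv E v k [::] c / k`!%:R| <= M.
Proof.
move=> sE EM.
have gd k (r : R) : (k < n)%N ->
    is_derive r 1 (fun r : R => dir_deriv E v k [::] (c + r *: v))
      (dir_deriv E v k.+1 [::] (c + r *: v)).
  move=> kn; apply: is_derive_line => y.
  exact: is_derive_dir_deriv sE _.
have := @taylor_bound R n (fun k r => dir_deriv E v k [::] (c + r *: v)) M gd EM 1.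
rewrite ler01 lexx expr1n mulr1 /= scale1r => /(_ isT).
by under eq_bigr do rewrite scale0r addr0 expr1n mulr1.
Qed.

Lemma measurable_dir_deriv E k al x :
  measurable_fun setT (fun v : 'rV[R]_d => dir_deriv E v k al x).
Proof.
elim: k al => [|k IH] al /=; first exact: measurable_cst.
apply: measurable_sum => i; apply: measurable_funM; last exact: IH.
exact: measurable_coord.
Qed.

End space_jet.

Section gaussian_taylor.
Context (R : realType) (d : nat) d0 (Om : measurableType d0)
  (P : probability Om R).

(** Written as a Lebesgue integral so that constants built from it depend neither on the probability
    space nor on the noise variable. *)
Definition gauss_weight (m : nat) : R :=
  \int[lebesgue_rV R d]_x (weight x ^+ m * gauss_pdf 0 1 x).

Lemma gauss_weightE (e : Om -> 'rV[R]_d) m : has_density P e (gauss_pdf 0 1) ->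
  rintegrable P (fun w => weight (e w) ^+ m) /\
  \int[P]_w (weight (e w) ^+ m) = gauss_weight m.
Proof. by move=> he; exact: rintegrable_gauss_weight. Qed.

Lemma gauss_weight_ge0 m : 0 <= gauss_weight m.
Proof.
apply: Rintegral_ge0 => x _; rewrite mulr_ge0 ?gauss_pdf_ge0//.
exact: weightX_ge0.
Qed.

Lemma measurable_weight m : measurable_fun setT (fun x : 'rV[R]_d => weight x ^+ m).
Proof.
apply: measurable_funX; apply: measurable_funD => //.
by apply: continuous_measurable_rV; exact: norm_continuous.
Qed.

Lemma weight_scale (x : 'rV[R]_d) (s S : R) : `|s| <= S ->
  weight (s *: x) <= (1 + S) * weight x.
Proof.
move=> sS; rewrite /weight normrZ; have := normr_ge0 x; have := normr_ge0 s; nra.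
Qed.

Variables (e : Om -> 'rV[R]_d) (n : nat) (E : seq 'I_d -> 'rV[R]_d -> R)
  (C : R) (m : nat) (q : 'rV[R]_d -> R) (sigma S : R) (c : 'rV[R]_d).
Hypotheses (he : has_density P e (gauss_pdf 0 1)) (sE : space_jet n E)
  (C0 : 0 <= C)
  (EC : forall k v x, (k <= n)%N ->
    `|dir_deriv E v k [::] x| <= C * `|v| ^+ k * weight x ^+ m)
  (mq : measurable_fun setT q) (qw : forall x, `|q x| <= weight x)
  (sS : `|sigma| <= S).

Let me_ : measurable_fun setT e. Proof. by case: he. Qed.

Lemma rintegrable_gauss_dir_deriv k : (k <= n)%N ->
  rintegrable P (fun w => q (e w) * dir_deriv E (e w) k [::] c).
Proof.
move=> kn; have [iw _] := gauss_weightE k.+1 he.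
apply: rintegrable_le (rintegrableZ (C * weight c ^+ m) iw).
  apply: measurable_funM; first exact: measurableT_comp.
  by apply: (measurableT_comp (@measurable_dir_deriv _ _ E k [::] c)).
move=> w; rewrite normrM exprS [leRHS]mulrCA ler_pM//.
apply: le_trans (EC _ _ kn) _; rewrite -!mulrA ler_wpM2l// mulrC.
by rewrite ler_wpM2l ?weightX_ge0// lerXn2r ?nnegrE ?weight_ge0// /weight lerDr.
Qed.

(** [q] stands for 1 or for a coordinate of the noise. It brings one power of the weight of the
    noise, the n-th derivative brings n and its growth m, which makes [(m + n).+1]; bounding sigma
    by S keeps the constant uniform. *)
Lemma gauss_taylor :
  rintegrable P (fun w => q (e w) * E [::] (c + sigma *: e w)) /\
  `|\int[P]_w (q (e w) * E [::] (c + sigma *: e w)) -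
    \sum_(k < n) (sigma ^+ k / k`!%:R *
       \int[P]_w (q (e w) * dir_deriv E (e w) k [::] c))|
  <= C * (1 + S) ^+ m * gauss_weight (m + n).+1 * `|sigma| ^+ n * weight c ^+ m.
Proof.
have S0 : 0 <= S by exact: le_trans sS.
pose rem w := q (e w) * E [::] (c + sigma *: e w) -
  \sum_(k < n) (sigma ^+ k / k`!%:R * (q (e w) * dir_deriv E (e w) k [::] c)).
have [iw iwE] := gauss_weightE (m + n).+1 he.
pose K := C * (1 + S) ^+ m * `|sigma| ^+ n * weight c ^+ m.
have remK w : `|rem w| <= K * weight (e w) ^+ (m + n).+1.
  have -> : rem w = q (e w) * (E [::] (c + sigma *: e w) -
      \sum_(k < n) dir_deriv E (sigma *: e w) k [::] c / k`!%:R).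
    rewrite mulrBr mulr_sumr; congr (_ - _); apply: eq_bigr => k _.
    by rewrite dir_derivZ; ring.
  rewrite normrM exprS [leRHS]mulrCA ler_pM//.
  apply: space_taylor sE _ => r /andP[r0 r1].
  apply: le_trans (EC _ _ (leqnn n)) _.
  rewrite /K normrZ exprMn exprD.
  have h1 : weight (c + r *: (sigma *: e w)) ^+ m <=
      weight c ^+ m * ((1 + S) ^+ m * weight (e w) ^+ m).
    rewrite -!exprMn lerXn2r ?nnegrE ?mulr_ge0 ?weight_ge0 ?addr_ge0//.
    apply: le_trans (weightD _ _) _; rewrite ler_wpM2l ?weight_ge0//.
    rewrite scalerA; apply: weight_scale.
    by rewrite normrM (ger0_norm r0) -[leRHS]mul1r ler_pM.
  have h2 : `|e w| ^+ n <= weight (e w) ^+ n.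
    by rewrite lerXn2r ?nnegrE ?weight_ge0// /weight lerDr.
  rewrite (_ : C * (1 + S) ^+ m * `|sigma| ^+ n * weight c ^+ m * (weight (e w) ^+ m * weight (e w) ^+ n) =
    (C * (`|sigma| ^+ n * weight (e w) ^+ n)) * (weight c ^+ m * ((1 + S) ^+ m * weight (e w) ^+ m))); last by ring.
  apply: ler_pM => //.
  - by rewrite !mulr_ge0// exprn_ge0.
  - exact: weightX_ge0.
  - by rewrite ler_wpM2l// ler_wpM2l// exprn_ge0.
have mrem : measurable_fun setT rem.
  apply: measurable_funB.
    apply: measurable_funM; first exact: measurableT_comp.
    apply: (measurableT_comp (f := E [::])).
      by apply: continuous_measurable_rV; apply: sE.1.
    by apply: measurable_rVD => //; exact: measurable_rVZ.
  apply: measurable_sum => k; apply: measurable_funM => //.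
  apply: measurable_funM; first exact: measurableT_comp.
  by apply: (measurableT_comp (@measurable_dir_deriv _ _ E k [::] c)).
have irem : rintegrable P rem.
  exact: rintegrable_le mrem remK (rintegrableZ _ iw).
have isum : rintegrable P (fun w => \sum_(k < n)
    (sigma ^+ k / k`!%:R * (q (e w) * dir_deriv E (e w) k [::] c))).
  apply: rintegrable_sum => k _; apply: rintegrableZ.
  by apply: rintegrable_gauss_dir_deriv; exact: ltnW.
have iqE : rintegrable P (fun w => q (e w) * E [::] (c + sigma *: e w)).
  apply: eq_integrable (rintegrableD irem isum) => // w _ /=.
  by rewrite /rem subrK.
split => //.
rewrite (_ : \int[P]_w _ - _ = \int[P]_w rem w); last first.
  rewrite RintegralB//; congr (_ - _).
  rewrite Rintegral_sum; last first.
    move=> k _; apply: rintegrableZ.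
    by apply: rintegrable_gauss_dir_deriv; exact: ltnW.
  apply: eq_bigr => k _; rewrite RintegralZl//.
  by apply: rintegrable_gauss_dir_deriv; exact: ltnW.
apply: le_trans (Rintegral_norm_le mrem (rintegrableZ _ iw) remK) _.
by rewrite RintegralZl// iwE /K le_eqVlt; apply/orP; left; apply/eqP; ring.
Qed.

End gaussian_taylor.

Section gaussian_means.
Context (R : realType) (d : nat) d0 (Om : measurableType d0)
  (P : probability Om R) (e : Om -> 'rV[R]_d).
Hypothesis he : has_density P e (gauss_pdf 0 1).
Implicit Type E : seq 'I_d -> 'rV[R]_d -> R.

Lemma gauss_mean0 (c : R) : \int[P]_w c = c.
Proof. by rewrite /Rintegral integral_cst//= probability_setT mule1. Qed.

Lemma gauss_mean_dir1 E c :
  \int[P]_w dir_deriv E (e w) 1 [::] c = 0.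
Proof.
rewrite /= Rintegral_sum => [|i _]; last first.
  apply: eq_integrable (rintegrableZ (E [:: i] c) (gauss_moment1 he i).1) => // w _.
  by rewrite /= mulrC.
apply: big1 => i _; under eq_Rintegral do rewrite mulrC.
by rewrite RintegralZl ?(gauss_moment1 he i).2 ?mulr0//; exact: (gauss_moment1 he i).1.
Qed.

Lemma gauss_mean_coord_dir1 E c a :
  \int[P]_w (e w 0 a * dir_deriv E (e w) 1 [::] c) = E [:: a] c.
Proof.
transitivity (\int[P]_w \sum_i (E [:: i] c * (e w 0 a * e w 0 i))).
  apply: eq_Rintegral => w _; rewrite /= mulr_sumr; apply: eq_bigr => i _.
  by rewrite mulrA mulrC.
rewrite Rintegral_sum => [|i _]; last by apply: rintegrableZ; exact: (gauss_moment2 he a i).1.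
rewrite (bigD1 a)//= big1 => [|i ia].
  rewrite RintegralZl ?(gauss_moment2 he a a).2 ?eqxx ?mulr1 ?addr0//.
  exact: (gauss_moment2 he a a).1.
rewrite RintegralZl ?(gauss_moment2 he a i).2//; last exact: (gauss_moment2 he a i).1.
by rewrite eq_sym (negbTE ia) mulr0.
Qed.

(** Off-diagonal second moments vanish, which leaves the trace of the Hessian. *)
Lemma gauss_mean_dir2 E c :
  \int[P]_w dir_deriv E (e w) 2 [::] c = \sum_i E [:: i; i] c.
Proof.
transitivity (\int[P]_w \sum_i \sum_j (E [:: j; i] c * (e w 0 i * e w 0 j))).
  apply: eq_Rintegral => w _; rewrite /=; apply: eq_bigr => i _.
  by rewrite mulr_sumr; apply: eq_bigr => j _; rewrite mulrA mulrC.
have I2 i j : rintegrable P (fun w => E [:: j; i] c * (e w 0 i * e w 0 j)).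
  by apply: rintegrableZ; exact: (gauss_moment2 he i j).1.
rewrite Rintegral_sum => [|i _]; last exact: rintegrable_sum.
apply: eq_bigr => i _; rewrite Rintegral_sum// (bigD1 i)//= big1 => [|j ji].
  rewrite RintegralZl ?(gauss_moment2 he i i).2 ?eqxx ?mulr1 ?addr0//.
  exact: (gauss_moment2 he i i).1.
rewrite RintegralZl ?(gauss_moment2 he i j).2//; last exact: (gauss_moment2 he i j).1.
by rewrite eq_sym (negbTE ji) mulr0.
Qed.

Lemma gauss_mean_coord_dir2 E c a :
  \int[P]_w (e w 0 a * dir_deriv E (e w) 2 [::] c) = 0.
Proof.
transitivity (\int[P]_w \sum_i \sum_j (E [:: j; i] c * (e w 0 a * e w 0 i * e w 0 j))).
  apply: eq_Rintegral => w _; rewrite /= mulr_sumr; apply: eq_bigr => i _.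
  rewrite mulrA mulr_sumr; apply: eq_bigr => j _.
  by rewrite mulrA mulrC.
have I3 i j : rintegrable P (fun w => E [:: j; i] c * (e w 0 a * e w 0 i * e w 0 j)).
  by apply: rintegrableZ; exact: (gauss_moment3 he a i j).1.
rewrite Rintegral_sum => [|i _]; last exact: rintegrable_sum.
apply: big1 => i _; rewrite Rintegral_sum//; apply: big1 => j _.
rewrite RintegralZl ?(gauss_moment3 he a i j).2 ?mulr0//.
exact: (gauss_moment3 he a i j).1.
Qed.

Lemma gauss_mean_dir3 E c :
  \int[P]_w dir_deriv E (e w) 3 [::] c = 0.
Proof.
transitivity (\int[P]_w \sum_i \sum_j \sum_k
    (E [:: k; j; i] c * (e w 0 i * e w 0 j * e w 0 k))).
  apply: eq_Rintegral => w _; rewrite /=; apply: eq_bigr => i _.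
  rewrite mulr_sumr; apply: eq_bigr => j _.
  by rewrite mulrA mulr_sumr; apply: eq_bigr => k _; rewrite mulrA mulrC.
have I3 i j k : rintegrable P (fun w => E [:: k; j; i] c * (e w 0 i * e w 0 j * e w 0 k)).
  by apply: rintegrableZ; exact: (gauss_moment3 he i j k).1.
rewrite Rintegral_sum => [|i _]; last by apply: rintegrable_sum => j _; exact: rintegrable_sum.
apply: big1 => i _; rewrite Rintegral_sum => [|j _]; last exact: rintegrable_sum.
apply: big1 => j _; rewrite Rintegral_sum//; apply: big1 => k _.
rewrite RintegralZl ?(gauss_moment3 he i j k).2 ?mulr0//.
exact: (gauss_moment3 he i j k).1.
Qed.

End gaussian_means.

(** * Expansions uniform in time *)

Section uniform_jets.
Context (R : realType) (d : nat) (T : R).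
Implicit Types (u : R -> 'rV[R]_d -> R) (x v : 'rV[R]_d).

Lemma cont_strip_space u t : cont_strip T u -> t \in `[0, T] -> continuous (u t).
Proof.
move=> /subspace_continuousP cu tT x A nA.
have := cu (t, x) (conj tT Logic.I) A nA => H.
have {}H : nbhs (t, x) (fun z => (`[0, T] `*` [set: 'rV[R]_d]) z -> A (u z.1 z.2)).
  exact: H.
case: H => -[A1 A2] /= [nA1 nA2] sA.
apply: filterS nA2 => y A2y; apply: (sA (t, y)) => //.
by split => //; exact: nbhs_singleton.
Qed.

Lemma space_jet_jet r s D a t : jet T r s D -> (a <= r)%N -> t \in `[0, T] ->
  space_jet s (fun al => @D a al t : 'rV[R]_d -> R).
Proof.
move=> [Dreg Dt Dx] ar tT; split => [al als|al i x als]; last exact: Dx.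
by apply: cont_strip_space tT; have [] := Dreg _ _ ar als.
Qed.

Lemma dir_deriv_growth_at r s D a k al : jet T r s D -> (a <= r)%N ->
  (size al + k <= s)%N -> exists (C : R) (m : nat), 0 <= C /\
  forall t v x, t \in `[0, T] ->
    `|dir_deriv (fun al => @D a al t) v k al x| <= C * `|v| ^+ k * weight x ^+ m.
Proof.
move=> [Dreg _ _] ar; elim: k al => [|k IH] al als.
  have [|_ [C [m [C0 DC]]]] := Dreg a al ar; first by rewrite -(addn0 (size al)).
  by exists C, m; split => // t v x tT; rewrite expr0 mulr1; exact: DC.
have {}IH i : exists Cm : R * nat, 0 <= Cm.1 /\ forall t v x, t \in `[0, T] ->
    `|dir_deriv (fun al => @D a al t) v k (i :: al) x| <=
      Cm.1 * `|v| ^+ k * weight x ^+ Cm.2.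
  have [|C [m H]] := IH (i :: al); first by rewrite /= addSnnS.
  by exists (C, m).
have [Cm HCm] := choice IH.
(* Sums over the finite index set bound all constants and all exponents at once. *)
exists (\sum_i (Cm i).1), (\sum_i (Cm i).2)%N.
split => [|t v x tT]; first by apply: sumr_ge0 => i _; case: (HCm i).
rewrite /=; apply: le_trans (ler_norm_sum _ _ _) _.
rewrite !mulr_suml; apply: ler_sum => i _.
have [C0 /(_ t v x tT) H] := HCm i.
rewrite normrM exprS [_.1 * _]mulrCA -mulrA; apply: ler_pM => //.
  exact: coord_le_norm.
apply: le_trans H _; rewrite -!mulrA ler_wpM2l// ler_wpM2l ?exprn_ge0//.
by rewrite weight_leX// (bigD1 i)//= leq_addr.
Qed.

Lemma dir_deriv_growth r s D a : jet T r s D -> (a <= r)%N ->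
  exists (C : R) (m : nat), 0 <= C /\
  forall t k v x, (k <= s)%N -> t \in `[0, T] ->
    `|dir_deriv (fun al => @D a al t) v k [::] x| <= C * `|v| ^+ k * weight x ^+ m.
Proof.
move=> Dj ar.
have H (k : 'I_s.+1) : exists Cm : R * nat, 0 <= Cm.1 /\
    forall t v x, t \in `[0, T] ->
    `|dir_deriv (fun al => @D a al t) v k [::] x| <=
      Cm.1 * `|v| ^+ k * weight x ^+ Cm.2.
  have [|C [m Hm]] := @dir_deriv_growth_at r s D a k [::] Dj ar.
    by rewrite add0n -ltnS.
  by exists (C, m).
have [Cm HCm] := choice H.
exists (\sum_i (Cm i).1), (\sum_i (Cm i).2)%N.
split => [|t k v x ks tT]; first by apply: sumr_ge0 => i _; case: (HCm i).
pose k' : 'I_s.+1 := Ordinal (ks : (k < s.+1)%N).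
have [C0 /(_ t v x tT) Hk] := HCm k'.
apply: le_trans Hk _; rewrite -!mulrA; apply: ler_pM => //.
- by rewrite mulr_ge0// exprn_ge0// weight_ge0.
- rewrite (bigD1 k')//= lerDl; apply: sumr_ge0 => i _; by case: (HCm i).
- by rewrite ler_wpM2l// weight_leX// (bigD1 k')//= leq_addr.
Qed.

End uniform_jets.

Section uniform_gauss.
Context (R : realType) (d : nat) (T : R) d0 (Om : measurableType d0)
  (P : probability Om R).
Implicit Types (u : R -> 'rV[R]_d -> R) (x v c : 'rV[R]_d) (e : Om -> 'rV[R]_d).

Lemma jet_laplacian r s u D t c :
  (forall t x, t \in `[0, T] -> D 0%N [::] t x = u t x) -> jet T r s.+2 D ->
  t \in `[0, T] -> laplacian (u t) c = \sum_i D 0%N [:: i; i] t c.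
Proof.
move=> D0 Dj tT; apply: eq_bigr => i _.
rewrite (_ : (fun z => _) = D 0%N [:: i] t).
  by case: Dj => _ _ /(_ 0%N [:: i] i t c isT isT tT) H; rewrite derive_val.
apply/funext => z.
by have H := is_derive_partial i z D0 Dj tT; rewrite derive_val.
Qed.

Lemma jet_partial r s u D i t c :
  (forall t x, t \in `[0, T] -> D 0%N [::] t x = u t x) -> jet T r s.+1 D ->
  t \in `[0, T] -> 'D_(basis_vec i) (u t) c = D 0%N [:: i] t c.
Proof.
by move=> D0 Dj tT; have H := is_derive_partial i c D0 Dj tT; rewrite derive_val.
Qed.

Lemma weight_coord x i : `|x 0 i| <= weight x.
Proof. by rewrite (le_trans (coord_le_norm _ _))// /weight lerDr. Qed.

Lemma cst1_weight x : `|(fun _ : 'rV[R]_d => 1 : R) x| <= weight x.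
Proof. by rewrite normr1 weight_ge1. Qed.

Variable (S : R).

(** The constants are chosen before t, sigma, c and e: the later summation over all steps of all
    grids needs them in common. *)
Lemma classC_gauss (n : nat) u : classC 0 n T u ->
  exists D C m, [/\ (forall t x, t \in `[0, T] -> D 0%N [::] t x = u t x),
    jet T 0 n D, 0 <= C &
    forall (q : 'rV[R]_d -> R) t sigma c e, measurable_fun setT q ->
    (forall x, `|q x| <= weight x) -> t \in `[0, T] -> `|sigma| <= S ->
    has_density P e (gauss_pdf 0 1) ->
    rintegrable P (fun w => q (e w) * u t (c + sigma *: e w)) /\
    `|\int[P]_w (q (e w) * u t (c + sigma *: e w)) -
      \sum_(k < n) (sigma ^+ k / k`!%:R *
       \int[P]_w (q (e w) * dir_deriv (fun al => D 0%N al t) (e w) k [::] c))|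
    <= C * `|sigma| ^+ n * weight c ^+ m].
Proof.
move=> /classC_jet[D D0 Dj].
have [C [m [C0 DC]]] := dir_deriv_growth Dj (leqnn 0).
exists D, (C * (1 + `|S|) ^+ m * gauss_weight R d (m + n).+1), m; split => //.
  by rewrite mulr_ge0 ?gauss_weight_ge0// mulr_ge0// exprn_ge0// addr_ge0.
move=> q t sigma c e mq qw tT sS he.
rewrite (_ : u t = D 0%N [::] t); last by apply/funext => x; rewrite D0.
have sS' : `|sigma| <= `|S| by rewrite (le_trans sS)// ler_norm.
have DC' k v x : (k <= n)%N -> `|dir_deriv (fun al => D 0%N al t) v k [::] x| <=
    C * `|v| ^+ k * weight x ^+ m by move=> kn; exact: DC.
exact: (gauss_taylor c he (space_jet_jet Dj (leqnn 0) tT) C0 DC' mq qw sS').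
Qed.

(** The terms of odd order have mean zero, so nothing stands between the Laplacian and the remainder
    sigma^4, which is of order h^2. *)
Lemma classC_gauss4 u : classC 0 4 T u -> exists C m, 0 <= C /\
  forall t sigma c e, t \in `[0, T] -> `|sigma| <= S ->
  has_density P e (gauss_pdf 0 1) ->
  rintegrable P (fun w => u t (c + sigma *: e w)) /\
  `|\int[P]_w u t (c + sigma *: e w) -
    (u t c + sigma ^+ 2 / 2 * laplacian (u t) c)| <=
  C * `|sigma| ^+ 4 * weight c ^+ m.
Proof.
move=> /classC_gauss [D [C [m [D0 Dj C0 H]]]]; exists C, m; split => //.
move=> t sigma c e tT sS he.
have [] := H (fun=> 1) t sigma c e (measurable_cst _) cst1_weight tT sS he.
under eq_fun do rewrite mul1r; move=> iu; split => //.
rewrite (jet_laplacian c D0 Dj tT).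
suff -> : u t c + sigma ^+ 2 / 2 * \sum_i D 0%N [:: i; i] t c =
   \sum_(k < 4) (sigma ^+ k / k`!%:R *
       \int[P]_w (1 * dir_deriv (fun al => D 0%N al t) (e w) k [::] c)).
  by [].
rewrite !big_ord_recl big_ord0 addr0.
have E (F : Om -> R) : \int[P]_w (1 * F w) = \int[P]_w F w.
  by apply: eq_Rintegral => w _; rewrite mul1r.
rewrite !E (gauss_mean0 P) (gauss_mean_dir1 he) (gauss_mean_dir2 he) (gauss_mean_dir3 he).
by rewrite !mulr0 add0r addr0 expr0 divr1 mul1r D0.
Qed.

Lemma classC_gauss2 u : classC 0 2 T u -> exists C m, 0 <= C /\
  forall t sigma c e, t \in `[0, T] -> `|sigma| <= S ->
  has_density P e (gauss_pdf 0 1) ->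
  rintegrable P (fun w => u t (c + sigma *: e w)) /\
  `|\int[P]_w u t (c + sigma *: e w) - u t c| <=
  C * `|sigma| ^+ 2 * weight c ^+ m.
Proof.
move=> /classC_gauss [D [C [m [D0 Dj C0 H]]]]; exists C, m; split => //.
move=> t sigma c e tT sS he.
have [] := H (fun=> 1) t sigma c e (measurable_cst _) cst1_weight tT sS he.
under eq_fun do rewrite mul1r; move=> iu; split => //.
suff -> : u t c = \sum_(k < 2) (sigma ^+ k / k`!%:R *
       \int[P]_w (1 * dir_deriv (fun al => D 0%N al t) (e w) k [::] c)).
  by [].
rewrite !big_ord_recl big_ord0 addr0.
have E (F : Om -> R) : \int[P]_w (1 * F w) = \int[P]_w F w.
  by apply: eq_Rintegral => w _; rewrite mul1r.
rewrite !E (gauss_mean0 P) (gauss_mean_dir1 he).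
by rewrite !mulr0 addr0 expr0 divr1 mul1r D0.
Qed.

(** Gaussian integration by parts to first order. The error sigma^3 is small enough because this
    mean is later multiplied by h^(1/2). *)
Lemma classC_gauss3 u (a : 'I_d) : classC 0 3 T u -> exists C m, 0 <= C /\
  forall t sigma c e, t \in `[0, T] -> `|sigma| <= S ->
  has_density P e (gauss_pdf 0 1) ->
  rintegrable P (fun w => e w 0 a * u t (c + sigma *: e w)) /\
  `|\int[P]_w (e w 0 a * u t (c + sigma *: e w)) -
    sigma * 'D_(basis_vec a) (u t) c| <=
  C * `|sigma| ^+ 3 * weight c ^+ m.
Proof.
move=> /classC_gauss [D [C [m [D0 Dj C0 H]]]]; exists C, m; split => //.
move=> t sigma c e tT sS he.
have [] := H (fun x => x 0 a) t sigma c e (measurable_coord a)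
  (fun x => weight_coord x a) tT sS he.
move=> iu; split => //.
rewrite (jet_partial a c D0 Dj tT).
suff -> : sigma * D 0%N [:: a] t c = \sum_(k < 3) (sigma ^+ k / k`!%:R *
       \int[P]_w (e w 0 a * dir_deriv (fun al => D 0%N al t) (e w) k [::] c)).
  by [].
rewrite !big_ord_recl big_ord0 addr0.
rewrite (gauss_mean_coord_dir1 he) (gauss_mean_coord_dir2 he) /=.
have [ia a0] := gauss_moment1 he a.
rewrite RintegralZr// a0 mul0r !mulr0 add0r addr0 expr1 divr1.
by [].
Qed.

Lemma classC_taylor n u : classC 0 n T u -> exists D C m,
  [/\ (forall t x, t \in `[0, T] -> D 0%N [::] t x = u t x), jet T 0 n D, 0 <= C &
  forall t c v, t \in `[0, T] ->
  `|u t (c + v) - \sum_(k < n) dir_deriv (fun al => D 0%N al t) v k [::] c / k`!%:R|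
  <= C * `|v| ^+ n * weight v ^+ m * weight c ^+ m].
Proof.
move=> /classC_jet[D D0 Dj].
have [C [m [C0 DC]]] := dir_deriv_growth Dj (leqnn 0).
exists D, C, m; split => // t c v tT.
rewrite -D0//; apply: (space_taylor (E := fun al => D 0%N al t)).
  exact: (space_jet_jet Dj (leqnn 0) tT).
move=> r /andP[r0 r1].
apply: le_trans (DC _ _ _ _ (leqnn n) tT) _.
rewrite -!mulrA ler_wpM2l// ler_wpM2l ?exprn_ge0//.
rewrite -exprMn lerXn2r ?nnegrE ?mulr_ge0 ?weight_ge0//.
apply: le_trans (weightD _ _) _; rewrite mulrC ler_wpM2r ?weight_ge0//.
by rewrite /weight lerD2l normrZ (ger0_norm r0) ler_piMl.
Qed.

Lemma classC_taylor1 u : classC 0 1 T u -> exists C m, 0 <= C /\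
  forall t c v, t \in `[0, T] ->
  `|u t (c + v) - u t c| <= C * `|v| * weight v ^+ m * weight c ^+ m.
Proof.
move=> /classC_taylor [D [C [m [D0 Dj C0 H]]]]; exists C, m; split => //.
move=> t c v tT; have := H t c v tT.
by rewrite big_ord_recl big_ord0 addr0 /= divr1 D0// expr1.
Qed.

Lemma classC_taylor2 u : classC 0 2 T u -> exists C m, 0 <= C /\
  forall t c v, t \in `[0, T] ->
  `|u t (c + v) - (u t c + \sum_i v 0 i * 'D_(basis_vec i) (u t) c)|
  <= C * `|v| ^+ 2 * weight v ^+ m * weight c ^+ m.
Proof.
move=> /classC_taylor [D [C [m [D0 Dj C0 H]]]]; exists C, m; split => //.
move=> t c v tT; have := H t c v tT.
rewrite !big_ord_recl big_ord0 addr0 /= !divr1 D0//.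
by under eq_bigr do rewrite -(jet_partial _ _ D0 Dj tT).
Qed.

Lemma classC_poly_growth r s u : classC r s T u -> poly_growth T u.
Proof.
move=> /classC_jet[D D0 [Dreg _ _]].
have [_ [C [m [C0 H]]]] := Dreg 0%N [::] (leq0n _) (leq0n _).
by exists C, m; split => // t x tT; rewrite -D0//; exact: H.
Qed.

Lemma classC_continuous r s u t : classC r s T u -> t \in `[0, T] ->
  continuous (u t).
Proof.
move=> /classC_jet[D D0 [Dreg _ _]] tT.
have [cD _] := Dreg 0%N [::] (leq0n _) (leq0n _).
rewrite (_ : u t = D 0%N [::] t); first exact: cont_strip_space tT.
by apply/funext => x; rewrite D0.
Qed.

End uniform_gauss.

(** * The one-step expansion *)

Section errO.
Context (R : realType) (d : nat) (I : Type).
Variables (D : I -> Prop) (h : I -> R) (x : I -> 'rV[R]_d) (H : R).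
Hypothesis hH : forall i, D i -> 0 <= h i <= H.

(* F = O(h^n), with a constant growing at most polynomially in x. *)
Definition errO (n : nat) (F : I -> R) := exists (C : R) (m : nat), 0 <= C /\
  forall i, D i -> `|F i| <= C * h i ^+ n * weight (x i) ^+ m.

Lemma errO_le n (F G : I -> R) : (forall i, D i -> `|F i| <= `|G i|) ->
  errO n G -> errO n F.
Proof.
move=> FG [C [m [C0 GC]]]; exists C, m; split => // i Di.
exact: le_trans (FG i Di) (GC i Di).
Qed.

Lemma errO_eq n (F G : I -> R) : (forall i, D i -> F i = G i) ->
  errO n G -> errO n F.
Proof. by move=> FG; apply: errO_le => i Di; rewrite FG. Qed.

Lemma errO_weaken n (F : I -> R) m (C : R) m' : 0 <= C -> (m <= m')%N ->
  (forall i, D i -> `|F i| <= C * h i ^+ n * weight (x i) ^+ m) ->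
  forall i, D i -> `|F i| <= C * h i ^+ n * weight (x i) ^+ m'.
Proof.
move=> C0 mm' FC i Di; apply: (le_trans (FC i Di)).
rewrite ler_wpM2l ?weight_leX// mulr_ge0// exprn_ge0//.
by have /andP[] := hH Di.
Qed.

Lemma errOD n (F G : I -> R) : errO n F -> errO n G ->
  errO n (fun i => F i + G i).
Proof.
move=> [C [m [C0 FC]]] [C' [m' [C'0 GC]]].
exists (C + C'), (maxn m m'); split; first exact: addr_ge0.
move=> i Di; rewrite mulrDl mulrDl (le_trans (ler_normD _ _))// lerD//.
  exact: (errO_weaken C0 (leq_maxl m m') FC).
exact: (errO_weaken C'0 (leq_maxr m m') GC).
Qed.

Lemma errOM n n' (F G : I -> R) : errO n F -> errO n' G ->
  errO (n + n') (fun i => F i * G i).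
Proof.
move=> [C [m [C0 FC]]] [C' [m' [C'0 GC]]].
exists (C * C'), (m + m')%N; split; first exact: mulr_ge0.
move=> i Di; rewrite normrM !exprD.
apply: (le_trans (ler_pM _ _ (FC i Di) (GC i Di))) => //.
by rewrite le_eqVlt; apply/orP; left; apply/eqP; ring.
Qed.

Lemma errO_cst (c : R) : errO 0 (fun=> c).
Proof. by exists `|c|, 0%N; split => // i Di; rewrite !expr0 !mulr1. Qed.

Lemma errO_h : errO 1 h.
Proof.
exists 1, 0%N; split => // i Di; rewrite expr0 mulr1 expr1 mul1r ger0_norm//.
by have /andP[] := hH Di.
Qed.

Lemma errOZ n c (F : I -> R) : errO n F -> errO n (fun i => c * F i).
Proof. exact: (@errOM 0 n _ _ (errO_cst c)). Qed.

Lemma errON n (F : I -> R) : errO n F -> errO n (fun i => - F i).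
Proof. by apply: errO_le => i _; rewrite normrN. Qed.

Lemma errOB n (F G : I -> R) : errO n F -> errO n G ->
  errO n (fun i => F i - G i).
Proof. by move=> FO GO; apply: errOD => //; exact: errON. Qed.

Lemma errO0 n : errO n (fun=> 0).
Proof. by exists 0, 0%N; split => // i _; rewrite normr0 !mul0r. Qed.

Lemma errO_sum n (J : Type) (l : seq J) (F : J -> I -> R) :
  (forall j, errO n (F j)) -> errO n (fun i => \sum_(j <- l) F j i).
Proof.
move=> FO; elim: l => [|j l IH].
  by apply: errO_eq (errO0 n) => i _; rewrite big_nil.
by apply: errO_eq (errOD (FO j) IH) => i _; rewrite big_cons.
Qed.

(** Spare powers of h are bounded because h <= H. *)
Lemma errO_leq n n' (F : I -> R) : (n' <= n)%N -> errO n F -> errO n' F.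
Proof.
move=> nn' [C [m [C0 FC]]]; exists (C * (1 + `|H|) ^+ (n - n')), m; split.
  by rewrite mulr_ge0// exprn_ge0.
move=> i Di; apply: (le_trans (FC i Di)); rewrite ler_wpM2r ?weightX_ge0//.
have /andP[hi hiH] := hH Di.
rewrite -{1}(subnKC nn') exprD mulrCA (mulrC (h i ^+ n')) -?mulrA ler_wpM2l//.
apply: ler_pM => //; rewrite ?exprn_ge0//.
rewrite lerXn2r// ?nnegrE ?addr_ge0//.
by rewrite (le_trans hiH)// (le_trans (ler_norm _))// lerDr.
Qed.

Lemma errO_weight m : errO 0 (fun i => weight (x i) ^+ m).
Proof.
by exists 1, m; split => // i Di; rewrite expr0 !mul1r ger0_norm ?weightX_ge0.
Qed.

Lemma errO_growth T u (t : I -> R) : (forall i, D i -> t i \in `[0, T]) ->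
  poly_growth T u -> errO 0 (fun i => u (t i) (x i)).
Proof.
move=> tT [C [m [C0 uC]]]; exists C, m; split => // i Di.
by rewrite expr0 mulr1 uC// tT.
Qed.

End errO.

(** For functions of the start or of the endpoint of a step, to be bounded by the joint weight of
    start and noise. *)
Lemma errO_move (R : realType) (d d' : nat) (I : Type) (D : I -> Prop)
    (h : I -> R) (x : I -> 'rV[R]_d) (y : I -> 'rV[R]_d') (H : R) n (F : I -> R) :
  (forall i, D i -> 0 <= h i <= H) ->
  errO D h x 0 (fun i => weight (y i)) -> errO D h y n F -> errO D h x n F.
Proof.
move=> hH [C [m [C0 yC]]] [C' [m' [C'0 FC]]].
exists (C' * C ^+ m'), (m * m')%N; split; first by rewrite mulr_ge0// exprn_ge0.
move=> i Di; apply: (le_trans (FC i Di)); rewrite exprM.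
have /andP[hi _] := hH _ Di.
have := yC i Di; rewrite ger0_norm ?weight_ge0// expr0 mulr1 => wy.
have -> : C' * C ^+ m' * h i ^+ n * weight (x i) ^+ m ^+ m' =
    C' * h i ^+ n * (C * weight (x i) ^+ m) ^+ m' by rewrite exprMn; ring.
apply: ler_wpM2l; first by rewrite mulr_ge0 ?exprn_ge0.
by rewrite lerXn2r// nnegrE ?weight_ge0 ?mulr_ge0 ?weightX_ge0.
Qed.

Section one_step.
Context (R : realType) (d : nat) (T : R) d0 (Om : measurableType d0)
  (P : probability Om R).
Implicit Types (u : R -> 'rV[R]_d -> R).

(** A step with its noise as a single index, so that the constants hidden in [bigO] are uniform over
    times, step sizes, starting points and noises. *)
Record step_data := StepData { sd_t : R; sd_h : R; sd_x : 'rV[R]_d;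
  sd_e : Om -> 'rV[R]_d }.

Definition step_ok (i : step_data) := [/\ sd_t i \in `[0, T],
  0 <= sd_h i <= T & has_density P (sd_e i) (gauss_pdf 0 1)].

Local Notation bigO := (errO step_ok sd_h sd_x).

Lemma step_ok_h i : step_ok i -> 0 <= sd_h i <= T. Proof. by case. Qed.

Lemma step_ok_t i : step_ok i -> sd_t i \in `[0, T]. Proof. by case. Qed.

Local Hint Resolve step_ok_h step_ok_t : core.

Lemma bigO_classC r s u : classC r s T u -> bigO 0 (fun i => u (sd_t i) (sd_x i)).
Proof. by move=> /classC_poly_growth; apply: errO_growth => i; case. Qed.

Variables (a : R -> 'rV[R]_d -> 'rV[R]_d) (g : R -> R) (gm gM : R).
Hypotheses (ca : classC_vec 0 3 T a) (gm0 : 0 < gm)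
  (hg : forall t, t \in `[0, T] -> gm <= `|g t| <= gM).

Definition euler_base i := sd_x i + sd_h i *: a (sd_t i) (sd_x i).
Definition euler_sd i := Num.sqrt (sd_h i) * g (sd_t i).
Definition euler_step i w := euler_base i + euler_sd i *: sd_e i w.

Lemma norm_rV_sum (x : 'rV[R]_d) : `|x| <= \sum_i `|x 0 i|.
Proof.
apply: norm_rV_le => [|i]; first exact: sumr_ge0.
by rewrite (bigD1 i)//= lerDl sumr_ge0.
Qed.

Lemma bigO_drift : bigO 0 (fun i => `|a (sd_t i) (sd_x i)|).
Proof.
apply: (@errO_le _ _ _ _ _ _ _ _
    (fun i => \sum_k `|a (sd_t i) (sd_x i) 0 k|)) => [i _|].
  by rewrite normr_id ger0_norm ?norm_rV_sum ?sumr_ge0.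
apply: (errO_sum step_ok_h) => k.
by apply: errO_le (bigO_classC (ca k)) => i _; rewrite normr_id.
Qed.

Lemma bigO_shift : bigO 1 (fun i => `|sd_h i *: a (sd_t i) (sd_x i)|).
Proof.
apply: errO_eq (errOM (errO_h sd_x step_ok_h) bigO_drift) => i Di.
by rewrite normrZ ger0_norm//; have /andP[] := step_ok_h Di.
Qed.

Lemma bigO_weight_shift m :
  bigO 0 (fun i => weight (sd_h i *: a (sd_t i) (sd_x i)) ^+ m).
Proof.
elim: m => [|m IH]; first exact: errO_cst.
have := errOD step_ok_h (errO_cst _ _ _ 1)
  (errO_leq step_ok_h (isT : (0 <= 1)%N) bigO_shift).
move=> /(fun h => errOM h IH) /=; apply: errO_eq => i _.
by rewrite exprS.
Qed.

Lemma bigO_base : bigO 0 (fun i => weight (euler_base i)).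
Proof.
apply: (errO_le _ (errOM (errO_weight _ _ _ 1) (bigO_weight_shift 1))) => i _.
by rewrite !expr1 normrM !ger0_norm ?weight_ge0// weightD.
Qed.

Lemma bigO_base_sub u : classC 0 1 T u ->
  bigO 1 (fun i => u (sd_t i) (euler_base i) - u (sd_t i) (sd_x i)).
Proof.
move=> /classC_taylor1[C [m [C0 H]]].
apply: (errO_le _ (errOM (errOM bigO_shift (bigO_weight_shift m))
   (errOZ C (errO_weight _ _ _ m)))) => i Di.
apply: (le_trans (H _ _ _ (step_ok_t Di))).
rewrite !normrM !(ger0_norm (weightX_ge0 _ _)) normr_id ger0_norm// mulrCA.
by rewrite le_eqVlt; apply/orP; left; apply/eqP; ring.
Qed.

Lemma bigO_base_sub2 u : classC 0 2 T u ->
  bigO 2 (fun i => u (sd_t i) (euler_base i) - (u (sd_t i) (sd_x i) + sd_h i *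
    \sum_k a (sd_t i) (sd_x i) 0 k * 'D_(basis_vec k) (u (sd_t i)) (sd_x i))).
Proof.
move=> /classC_taylor2[C [m [C0 H]]].
apply: (errO_le _ (errOM (errOM (errOM bigO_shift bigO_shift)
   (bigO_weight_shift m)) (errOZ C (errO_weight _ _ _ m)))) => i Di.
have := H (sd_t i) (sd_x i) (sd_h i *: a (sd_t i) (sd_x i)) (step_ok_t Di).
rewrite (_ : \sum_k (sd_h i *: a (sd_t i) (sd_x i)) 0 k *
    'D_(basis_vec k) (u (sd_t i)) (sd_x i) = sd_h i * \sum_k a (sd_t i) (sd_x i) 0 k *
    'D_(basis_vec k) (u (sd_t i)) (sd_x i)); last first.
  by rewrite mulr_sumr; apply: eq_bigr => k _; rewrite mxE mulrA.
move=> /le_trans; apply.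
rewrite !normrM !(ger0_norm (weightX_ge0 _ _)) normr_id (ger0_norm C0).
by rewrite le_eqVlt; apply/orP; left; apply/eqP; ring.
Qed.

Lemma euler_sd_sqr i : step_ok i -> euler_sd i ^+ 2 = sd_h i * g (sd_t i) ^+ 2.
Proof.
by move=> /step_ok_h/andP[h0 _]; rewrite /euler_sd exprMn sqr_sqrtr.
Qed.

Lemma euler_sd_le i : step_ok i -> `|euler_sd i| <= Num.sqrt T * gM.
Proof.
move=> Di; have /andP[h0 hT] := step_ok_h Di.
have /andP[_ gM_] := hg (step_ok_t Di).
by rewrite normrM (ger0_norm (sqrtr_ge0 _)) ler_pM ?sqrtr_ge0// ler_wsqrtr.
Qed.

Lemma bigO_g : bigO 0 (fun i => g (sd_t i)).
Proof.
apply: (errO_le _ (errO_cst _ _ _ gM)) => i Di.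
have /andP[_ gM_] := hg (step_ok_t Di).
by rewrite (le_trans gM_)// ler_norm.
Qed.

Lemma bigO_gV : bigO 0 (fun i => (g (sd_t i))^-1).
Proof.
apply: (errO_le _ (errO_cst _ _ _ gm^-1)) => i Di.
have /andP[gm_ _] := hg (step_ok_t Di).
rewrite normrV ?unitfE ?(gt_eqF (lt_le_trans gm0 gm_))//; last first.
  by rewrite -normr_gt0 (lt_le_trans gm0).
rewrite [leRHS]ger0_norm ?invr_ge0 ?(ltW gm0)// lef_pV2 ?posrE//.
exact: lt_le_trans gm_.
Qed.

Lemma euler_sd_pow k : bigO k (fun i => `|euler_sd i| ^+ (2 * k)).
Proof.
elim: k => [|k IH]; first exact: errO_cst.
have := errOM (errOM (errO_h sd_x step_ok_h) (errOM bigO_g bigO_g)) IH.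
apply: errO_eq => i Di.
by rewrite mulnS exprD -expr2 -euler_sd_sqr// real_normK ?num_real.
Qed.

Lemma laplacian_classC r s u : classC r s.+2 T u ->
  classC r s T (fun t x => laplacian (u t) x).
Proof.
move=> cu; apply: classC_sum => i; do 2 apply: classC_partial.
exact: cu.
Qed.

Lemma bigO_X F m : bigO 0 F -> bigO 0 (fun i => F i ^+ m).
Proof.
move=> FO; elim: m => [|m IH]; first exact: errO_cst.
by apply: errO_eq (errOM FO IH) => i _; rewrite exprS.
Qed.

(** Even powers of the noise scale are powers of h, since its square is h g^2; the weight at the
    shifted base is polynomial in that of the starting point. *)
Lemma bigO_gauss k F (C : R) m :
  (forall i, step_ok i ->
    `|F i| <= C * `|euler_sd i| ^+ (2 * k) * weight (euler_base i) ^+ m) ->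
  bigO k F.
Proof.
move=> FC; have := errOM (euler_sd_pow k) (errOZ C (bigO_X m bigO_base)).
rewrite addn0; apply: errO_le => i Di; apply: (le_trans (FC i Di)).
by rewrite (mulrC C) -mulrA ler_norm.
Qed.

Lemma euler_mean_value2 u : classC 0 2 T u ->
  (forall i, step_ok i -> rintegrable P (fun w => u (sd_t i) (euler_step i w))) /\
  bigO 1 (fun i => \int[P]_w u (sd_t i) (euler_step i w) - u (sd_t i) (sd_x i)).
Proof.
move=> cu; have [C [m [C0 H]]] := classC_gauss2 P (Num.sqrt T * gM) cu.
have H' i : step_ok i -> _ := fun Di => H (sd_t i) (euler_sd i) (euler_base i)
  (sd_e i) (step_ok_t Di) (euler_sd_le Di) (let: And3 _ _ he := Di in he).
split=> [i /H'[]//|].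
have H1 : bigO 1 (fun i => \int[P]_w u (sd_t i) (euler_step i w) -
    u (sd_t i) (euler_base i)).
  by apply: (@bigO_gauss _ _ C m) => i /H'[_].
apply: errO_eq (errOD step_ok_h H1 (bigO_base_sub (classC_le (leqnn _) (leqnSn _) cu))).
by move=> i _; rewrite addrA subrK.
Qed.

(** The bracket is the generator: its drift part comes from expanding at the shifted base, its
    Laplacian from the noise. Moving the Laplacian back to the starting point costs O(h) on a term
    that already carries h. *)
Lemma euler_mean_value4 u : classC 0 4 T u ->
  (forall i, step_ok i -> rintegrable P (fun w => u (sd_t i) (euler_step i w))) /\
  bigO 2 (fun i => \int[P]_w u (sd_t i) (euler_step i w) - (u (sd_t i) (sd_x i) +
    sd_h i * (\sum_k a (sd_t i) (sd_x i) 0 k * 'D_(basis_vec k) (u (sd_t i)) (sd_x i)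
    + g (sd_t i) ^+ 2 / 2 * laplacian (u (sd_t i)) (sd_x i)))).
Proof.
move=> cu; have [C [m [C0 H]]] := classC_gauss4 P (Num.sqrt T * gM) cu.
have H' i : step_ok i -> _ := fun Di => H (sd_t i) (euler_sd i) (euler_base i)
  (sd_e i) (step_ok_t Di) (euler_sd_le Di) (let: And3 _ _ he := Di in he).
split=> [i /H'[]//|].
have H1 : bigO 2 (fun i => \int[P]_w u (sd_t i) (euler_step i w) -
    (u (sd_t i) (euler_base i) + euler_sd i ^+ 2 / 2 *
     laplacian (u (sd_t i)) (euler_base i))).
  by apply: (@bigO_gauss _ _ C m) => i /H'[_].
have H2 := bigO_base_sub2 (classC_le (leqnn 0) (isT : (2 <= 4)%N) cu).
have H3 := bigO_base_sub
  (classC_le (leqnn 0) (isT : (1 <= 2)%N) (laplacian_classC cu)).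
have H4 := errOM (errO_h sd_x step_ok_h) (errOM (bigO_X 2 bigO_g) (errOZ 2^-1 H3)).
apply: errO_eq (errOD step_ok_h H1 (errOD step_ok_h H2 H4)) => i Di.
rewrite euler_sd_sqr//.
move: (\int[P]_w _) (u _ (euler_base i)) (u _ _) (laplacian _ _) (laplacian _ _)
  (\sum_k _) (sd_h i) (g _) => I1 A1 A2 A3 A4 A5 A6 A7.
by field.
Qed.

Lemma euler_mean_coord u k : classC 0 3 T u ->
  (forall i, step_ok i ->
     rintegrable P (fun w => sd_e i w 0 k * u (sd_t i) (euler_step i w))) /\
  bigO 2 (fun i => Num.sqrt (sd_h i) / g (sd_t i) *
    \int[P]_w (sd_e i w 0 k * u (sd_t i) (euler_step i w)) -
    sd_h i * 'D_(basis_vec k) (u (sd_t i)) (sd_x i)).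
Proof.
move=> cu; have [C [m [C0 H]]] := classC_gauss3 P (Num.sqrt T * gM) k cu.
have H' i : step_ok i -> _ := fun Di => H (sd_t i) (euler_sd i) (euler_base i)
  (sd_e i) (step_ok_t Di) (euler_sd_le Di) (let: And3 _ _ he := Di in he).
split=> [i /H'[]//|].
(* The factor g^2 turns h^(1/2) / g into the noise scale, so that the bound is a fourth power of it;
   g^-2 is restored in [H5]. *)
have H1 : bigO 2 (fun i => g (sd_t i) ^+ 2 * (Num.sqrt (sd_h i) / g (sd_t i) *
    (\int[P]_w (sd_e i w 0 k * u (sd_t i) (euler_step i w)) -
     euler_sd i * 'D_(basis_vec k) (u (sd_t i)) (euler_base i)))).
  apply: (@bigO_gauss _ _ C m) => i Di; have [_] := H' i Di.
  have /andP[gi _] := hg (step_ok_t Di).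
  have g0 : g (sd_t i) != 0 by rewrite -normr_gt0 (lt_le_trans gm0).
  rewrite (_ : g (sd_t i) ^+ 2 * _ = euler_sd i *
    (\int[P]_w (sd_e i w 0 k * u (sd_t i) (euler_step i w)) -
     euler_sd i * 'D_(basis_vec k) (u (sd_t i)) (euler_base i))); last first.
    by rewrite /euler_sd; field.
  rewrite [X in _ -> X <= _]normrM => H3.
  apply: (le_trans (ler_wpM2l (normr_ge0 _) H3)).
  by rewrite le_eqVlt; apply/orP; left; apply/eqP; ring.
have H2 := bigO_base_sub
  (classC_le (leqnn 0) (isT : (1 <= 2)%N) (classC_partial k cu)).
have H4 := errOM (errO_h sd_x step_ok_h) H2.
have H5 := errOM (bigO_X 2 bigO_gV) H1.
apply: errO_eq (errOD step_ok_h H5 H4) => i Di.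
have /andP[gi _] := hg (step_ok_t Di).
have g0 : g (sd_t i) != 0 by rewrite -normr_gt0 (lt_le_trans gm0).
have /andP[h0 _] := step_ok_h Di.
rewrite /euler_sd; have := sqr_sqrtr h0.
move: (\int[P]_w _) ('D_(basis_vec k) _ _) ('D_(basis_vec k) _ _) (sd_h i)
  (Num.sqrt _) (g _) g0 => A1 A2 A3 A4 A5 A6 g0 <-.
by field.
Qed.

End one_step.

(** * The mean loss of one step *)

Section step_loss.
Context (R : realType) (d : nat) (T : R) d0 (Om : measurableType d0)
  (P : probability Om R).
Implicit Types (u : R -> 'rV[R]_d -> R).
Local Notation data := (@step_data R d _ Om).
Local Notation ok := (@step_ok R d T _ Om P).
Local Notation bigO := (errO ok (@sd_h R d _ Om) (@sd_x R d _ Om)).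
Local Notation hok := (@step_ok_h R d T _ Om P).

(** Integrability travels with the expansion, so that means can be added and multiplied by known
    factors without side conditions. *)
Definition meanO n (F : data -> Om -> R) (G : data -> R) :=
  (forall i, ok i -> rintegrable P (F i)) /\
  bigO n (fun i => \int[P]_w F i w - G i).

Lemma meanO_eq n F G F' G' : (forall i w, ok i -> F i w = F' i w) ->
  (forall i, ok i -> G i = G' i) -> meanO n F' G' -> meanO n F G.
Proof.
move=> FF GG [iF FO]; split=> [i Di|].
  by have := iF i Di; apply: eq_integrable => // w _ /=; rewrite FF.
apply: errO_eq FO => i Di; rewrite GG//; congr (_ - _).
by apply: eq_Rintegral => w _; rewrite FF.
Qed.

Lemma meanOD n F G F' G' : meanO n F G -> meanO n F' G' ->
  meanO n (fun i w => F i w + F' i w) (fun i => G i + G' i).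
Proof.
move=> [iF FO] [iF' FO']; split=> [i Di|].
  exact: rintegrableD (iF i Di) (iF' i Di).
apply: errO_eq (errOD hok FO FO') => i Di.
rewrite RintegralD//; [|exact: iF|exact: iF'].
by rewrite addrACA opprD.
Qed.

Lemma meanOM k n c F G : bigO k c -> meanO n F G ->
  meanO (k + n) (fun i w => c i * F i w) (fun i => c i * G i).
Proof.
move=> cO [iF FO]; split=> [i Di|]; first exact: rintegrableZ (iF i Di).
apply: errO_eq (errOM cO FO) => i Di.
by rewrite RintegralZl//; [rewrite mulrBr|exact: iF].
Qed.

Lemma meanOZ n c F G : meanO n F G ->
  meanO n (fun i w => c * F i w) (fun i => c * G i).
Proof. exact: (@meanOM 0 n (fun=> c) F G (errO_cst _ _ _ c)). Qed.

Lemma meanOB n F G F' G' : meanO n F G -> meanO n F' G' ->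
  meanO n (fun i w => F i w - F' i w) (fun i => G i - G' i).
Proof.
move=> FG /(@meanOZ _ (-1)) FG'.
by apply: meanO_eq (meanOD FG FG') => [i w|i] _; rewrite mulN1r.
Qed.

Lemma meanO_cst n (c : data -> R) : meanO n (fun i _ => c i) c.
Proof.
split=> [i _|]; first exact: finite_measure_integrable_cst.
by apply: errO_eq (errO0 _ _ _ n) => i _; rewrite gauss_mean0 subrr.
Qed.

Lemma meanO_sum n (J : Type) (l : seq J) F G :
  (forall j, meanO n (F j) (G j)) ->
  meanO n (fun i w => \sum_(j <- l) F j i w) (fun i => \sum_(j <- l) G j i).
Proof.
move=> FG; elim: l => [|j l IH].
  by apply: meanO_eq (@meanO_cst n (fun=> 0)) => [i w|i] _; rewrite big_nil.
by apply: meanO_eq (meanOD (FG j) IH) => [i w|i] _; rewrite big_cons.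
Qed.

Variables (L : R -> 'rV[R]_d -> R) (a a' : R -> 'rV[R]_d -> 'rV[R]_d) (g : R -> R) (gm gM : R).
Hypotheses (cL : classC 0 4 T L) (ca : classC_vec 0 3 T a)
  (ca' : classC_vec 0 3 T a') (gm0 : 0 < gm)
  (hg : forall t, t \in `[0, T] -> gm <= `|g t| <= gM).

Definition step_move t h (x z : 'rV[R]_d) : 'rV[R]_d :=
  x + h *: a t x + (Num.sqrt h * g t) *: z.

(* The log-ratio of the density of the step to that of the reversed step, which
   uses the drift a'. *)
Definition step_log_ratio t h (x z : 'rV[R]_d) : R :=
  Num.sqrt h / g t * \sum_k z 0 k * (a t x 0 k + a' t (step_move t h x z) 0 k) +
  h / (2 * g t ^+ 2) * \sum_k (a t x 0 k + a' t (step_move t h x z) 0 k) ^+ 2.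

(** Both values of L are taken at the same time t; the change of time is treated apart, by the
    Fokker-Planck equation. *)
Definition step_loss t h x z : R :=
  L t (step_move t h x z) - L t x - step_log_ratio t h x z.

(** The coefficient of h in the mean loss: the generator acting on L, minus the means of the linear
    and of the quadratic part of the log-ratio. *)
Definition step_gen t x : R :=
  \sum_k a t x 0 k * 'D_(basis_vec k) (L t) x + g t ^+ 2 / 2 * laplacian (L t) x
  - divergence (a' t) x
  - (2 * g t ^+ 2)^-1 * \sum_k (a t x 0 k + a' t x 0 k) ^+ 2.

Let ca'2 k : classC 0 2 T (fun t x => a' t x 0 k).
Proof. exact: classC_le (leqnn _) (isT : (2 <= 3)%N) (ca' k). Qed.

(** First order suffices here, as the square carries a factor h in the log-ratio. *)
Lemma meanO_drift k : meanO 1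
  (fun i w => (a (sd_t i) (sd_x i) 0 k + a' (sd_t i) (euler_step a g i w) 0 k) ^+ 2)
  (fun i => (a (sd_t i) (sd_x i) 0 k + a' (sd_t i) (sd_x i) 0 k) ^+ 2).
Proof.
have m1 := euler_mean_value2 P ca hg (ca'2 k).
have m2 := euler_mean_value2 P ca hg (classCM (ca'2 k) (ca'2 k)).
have aO := bigO_classC P (ca k).
have := meanOD (meanOD (meanO_cst 1 (fun i => a (sd_t i) (sd_x i) 0 k ^+ 2))
  (meanOM (errOZ 2 aO) m1)) m2.
by apply: meanO_eq => [i w|i] _; ring.
Qed.

(** The drift at the start does not involve the noise and drops out; at the endpoint, Gaussian
    integration by parts leaves a partial derivative, and these add up to the divergence of a'. *)
Lemma meanO_coord_drift k : meanO 2
  (fun i w => Num.sqrt (sd_h i) / g (sd_t i) * (sd_e i w 0 k *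
    (a (sd_t i) (sd_x i) 0 k + a' (sd_t i) (euler_step a g i w) 0 k)))
  (fun i => sd_h i * 'D_(basis_vec k) (fun x => a' (sd_t i) x 0 k) (sd_x i)).
Proof.
have m1 : meanO 2 (fun i w => Num.sqrt (sd_h i) / g (sd_t i) *
    (sd_e i w 0 k * a' (sd_t i) (euler_step a g i w) 0 k))
    (fun i => sd_h i * 'D_(basis_vec k) (fun x => a' (sd_t i) x 0 k) (sd_x i)).
  have [iF FO] := euler_mean_coord P ca gm0 hg k (ca' k).
  split=> [i Di|]; first exact: rintegrableZ (iF i Di).
  by apply: errO_eq FO => i Di; rewrite RintegralZl//; exact: iF.
have m2 : meanO 2 (fun i w => Num.sqrt (sd_h i) / g (sd_t i) *
    a (sd_t i) (sd_x i) 0 k * sd_e i w 0 k) (fun=> 0).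
  split=> [i [_ _ he]|].
    by apply: rintegrableZ; exact: (gauss_moment1 he k).1.
  apply: errO_eq (errO0 _ _ _ 2) => i [_ _ he].
  have [i1 i2] := gauss_moment1 he k.
  by rewrite RintegralZl// i2 mulr0 subrr.
by apply: meanO_eq (meanOD m1 m2) => [i w|i] _; ring.
Qed.

Lemma step_loss_mean : meanO 2
  (fun i w => step_loss (sd_t i) (sd_h i) (sd_x i) (sd_e i w))
  (fun i => sd_h i * step_gen (sd_t i) (sd_x i)).
Proof.
have m1 := euler_mean_value4 P ca hg cL.
have m2 := meanO_sum (index_enum 'I_d) meanO_coord_drift.
have m3 := meanO_sum (index_enum 'I_d) meanO_drift.
have gVO : bigO 0 (fun i => (g (sd_t i))^-1) by exact: bigO_gV hg.
have m4 := meanOM (errOM (errO_h _ hok) (errOM gVO gVO))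
  (meanOZ 2^-1 m3).
have m5 := meanOB (meanOB m1 (meanO_cst 2 (fun i => L (sd_t i) (sd_x i))))
  (meanOD m2 m4).
apply: meanO_eq m5 => [i w|i] Di.
  rewrite /step_loss /step_log_ratio -mulr_sumr.
  rewrite -/(euler_step a g i w) /euler_step /euler_base /euler_sd /step_move.
  congr (_ - _ - (_ + _)); rewrite invfM expr2 invfM.
  by move: (\sum_k _) => A; ring.
rewrite /step_gen /divergence -mulr_sumr invfM expr2 invfM.
move: (\sum_k _) (\sum_k _) (\sum_k _) (laplacian _ _) (L _ _) (sd_h i) (g _)
  => A1 A2 A3 A4 A5 A6 A7.
by ring.
Qed.
End step_loss.

(** * Steps from a random starting point *)

Section pair_growth.
Context (R : realType) (d : nat) (T : R).
Implicit Types (u : R -> 'rV[R]_d -> R) (x z : 'rV[R]_d).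

Record pair_data := PairData { pd_t : R; pd_h : R; pd_x : 'rV[R]_d;
  pd_z : 'rV[R]_d }.

Definition pair_ok (i : pair_data) :=
  pd_t i \in `[0, T] /\ 0 <= pd_h i <= T.

Lemma pair_ok_h i : pair_ok i -> 0 <= pd_h i <= T. Proof. by case. Qed.

(** Joining the starting point and the noise in one vector makes the [errO] calculus available for
    growth in both. *)
Definition pair_row (i : pair_data) : 'rV[R]_(d + d) := row_mx (pd_x i) (pd_z i).

Local Notation pairO := (errO pair_ok pd_h pair_row 0).

Lemma norm_row_mxl i : `|pd_x i| <= `|pair_row i|.
Proof.
apply: norm_rV_le => // k; rewrite -(row_mxEl (pd_x i) (pd_z i)).
exact: coord_le_norm.
Qed.

Lemma norm_row_mxr i : `|pd_z i| <= `|pair_row i|.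
Proof.
apply: norm_rV_le => // k; rewrite -(row_mxEr (pd_x i) (pd_z i)).
exact: coord_le_norm.
Qed.

Lemma weight_row_mx i : weight (pair_row i) <= weight (pd_x i) * weight (pd_z i).
Proof.
have : `|pair_row i| <= `|pd_x i| + `|pd_z i|.
  apply: norm_rV_le => [|k]; first exact: addr_ge0.
  have [j ->|j ->] := split_ordP k; rewrite /pair_row.
    by rewrite row_mxEl (le_trans (coord_le_norm _ _))// lerDl.
  by rewrite row_mxEr (le_trans (coord_le_norm _ _))// lerDr.
rewrite /weight => H; rewrite mulrDl mul1r mulrDr mulr1 -addrA lerD2l.
by rewrite addrCA addrA (le_trans H)// lerDl mulr_ge0.
Qed.

(** A product of weights: the separated form of bound that can be integrated over two independent
    variables. *)
Definition pair_growth (F : R -> R -> 'rV[R]_d -> 'rV[R]_d -> R) :=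
  exists (C : R) (m : nat), 0 <= C /\ forall t h x z, t \in `[0, T] ->
    0 <= h <= T -> `|F t h x z| <= C * (weight x ^+ m * weight z ^+ m).

Lemma pair_growthP F : pairO (fun i => F (pd_t i) (pd_h i) (pd_x i) (pd_z i)) ->
  pair_growth F.
Proof.
move=> [C [m [C0 H]]]; exists C, m; split => // t h x z tT hT.
have := H (PairData t h x z) (conj tT hT); rewrite expr0 mulr1 => /le_trans; apply.
rewrite ler_wpM2l// -exprMn lerXn2r ?nnegrE ?mulr_ge0 ?weight_ge0//.
exact: weight_row_mx (PairData t h x z).
Qed.

Lemma pairO_x : pairO (fun i => weight (pd_x i)).
Proof.
apply: errO_le (errO_weight _ _ _ 1) => i _.
by rewrite expr1 !ger0_norm ?weight_ge0// lerD2l norm_row_mxl.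
Qed.

Lemma pairO_z k : pairO (fun i => pd_z i 0 k).
Proof.
apply: errO_le (errO_weight _ _ _ 1) => i _.
rewrite expr1 [leRHS]ger0_norm ?weight_ge0// (le_trans (coord_le_norm _ _))//.
by rewrite (le_trans (norm_row_mxr _))// lerDr.
Qed.

Lemma pairO_classC r s u : classC r s T u -> pairO (fun i => u (pd_t i) (pd_x i)).
Proof.
move=> /classC_poly_growth cu; apply: (errO_move pair_ok_h pairO_x).
by apply: errO_growth cu => i [].
Qed.

Variables (a a' : R -> 'rV[R]_d -> 'rV[R]_d) (g : R -> R) (gm gM : R).
Hypotheses (ca : classC_vec 0 3 T a) (ca' : classC_vec 0 3 T a') (gm0 : 0 < gm)
  (hg : forall t, t \in `[0, T] -> gm <= `|g t| <= gM).

Definition pair_move (i : pair_data) :=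
  step_move a g (pd_t i) (pd_h i) (pd_x i) (pd_z i).

Lemma pairO_pow F m : pairO F -> pairO (fun i => F i ^+ m).
Proof.
move=> FO; elim: m => [|m IH]; first exact: errO_cst.
by apply: errO_eq (errOM FO IH) => i _; rewrite exprS.
Qed.

Lemma pairO_h : pairO pd_h.
Proof. by have := errO_h pair_row pair_ok_h; apply: (errO_leq pair_ok_h). Qed.

Lemma pairO_sqrt_h : pairO (fun i => Num.sqrt (pd_h i)).
Proof.
apply: errO_le (errO_cst _ _ _ (Num.sqrt T)) => i [_ /andP[h0 hT]].
by rewrite !ger0_norm ?sqrtr_ge0// ler_wsqrtr.
Qed.

Lemma pairO_g : pairO (fun i => g (pd_t i)).
Proof.
apply: errO_le (errO_cst _ _ _ gM) => i [ti _].
by have /andP[_ gM_] := hg ti; rewrite (le_trans gM_)// ler_norm.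
Qed.

Lemma pairO_gV : pairO (fun i => (g (pd_t i))^-1).
Proof.
apply: errO_le (errO_cst _ _ _ gm^-1) => i [ti _].
have /andP[gm_ _] := hg ti.
have g0 : g (pd_t i) != 0 by rewrite -normr_gt0 (lt_le_trans gm0).
rewrite normrV ?unitfE// [leRHS]ger0_norm ?invr_ge0 ?(ltW gm0)//.
by rewrite lef_pV2 ?posrE// (lt_le_trans gm0).
Qed.

Lemma pairO_move : pairO (fun i => weight (pair_move i)).
Proof.
apply: (@errO_le _ _ _ _ _ _ _ _ (fun i => weight (pd_x i) +
   (pd_h i * \sum_k `|a (pd_t i) (pd_x i) 0 k| +
    `|Num.sqrt (pd_h i) * g (pd_t i)| * \sum_k `|pd_z i 0 k|))) => [i Di|].
  rewrite [leLHS]ger0_norm ?weight_ge0// (le_trans _ (ler_norm _))//.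
  rewrite /weight -addrA lerD2l /pair_move /step_move -!addrA.
  rewrite (le_trans (ler_normD _ _))// lerD2l.
  rewrite (le_trans (ler_normD _ _))// lerD// normrZ ler_pM ?norm_rV_sum//.
  by rewrite ger0_norm//; case: Di => _ /andP[].
apply: (errOD pair_ok_h pairO_x); apply: (errOD pair_ok_h).
  apply: (errOM pairO_h); apply: (errO_sum pair_ok_h) => k.
  by apply: errO_le (pairO_classC (ca k)) => i _; rewrite normr_id.
apply: (@errOM _ _ _ _ _ _ 0 0).
  by apply: errO_le (errOM pairO_sqrt_h pairO_g) => i _; rewrite normr_id.
apply: (errO_sum pair_ok_h) => k.
by apply: errO_le (pairO_z k) => i _; rewrite normr_id.
Qed.

Lemma pairO_classC_move r s u : classC r s T u ->
  pairO (fun i => u (pd_t i) (pair_move i)).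
Proof.
move=> /classC_poly_growth cu; apply: (errO_move pair_ok_h pairO_move).
by apply: errO_growth cu => i [].
Qed.

Lemma pair_growth_step_loss L : classC 0 4 T L -> pair_growth (step_loss L a a' g).
Proof.
move=> cL; apply: pair_growthP; rewrite /step_loss /step_log_ratio.
have hq k : pairO (fun i => a (pd_t i) (pd_x i) 0 k + a' (pd_t i) (pair_move i) 0 k).
  have h1 := pairO_classC (ca k); have h2 := pairO_classC_move (ca' k).
  exact: (errOD pair_ok_h h1 h2).
apply: (errOB pair_ok_h).
  have h1 := pairO_classC_move cL; have h2 := pairO_classC cL.
  exact: (errOB pair_ok_h h1 h2).
apply: (errOD pair_ok_h).
  apply: (@errOM _ _ _ _ _ _ 0 0); first exact: errOM pairO_sqrt_h pairO_gV.
  by apply: (errO_sum pair_ok_h) => k; exact: errOM (pairO_z k) (hq k).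
apply: (@errOM _ _ _ _ _ _ 0 0).
  apply: (@errOM _ _ _ _ _ _ 0 0); first exact: pairO_h.
  apply: errO_eq (errOZ 2^-1 (pairO_pow 2 pairO_gV)) => i _.
  by rewrite invfM exprVn.
by apply: (errO_sum pair_ok_h) => k; exact: pairO_pow (hq k).
Qed.

Lemma pair_growth_move u : classC 0 2 T u ->
  pair_growth (fun t h x z => u t (step_move a g t h x z)).
Proof. by move=> cu; apply: pair_growthP; exact: pairO_classC_move cu. Qed.

End pair_growth.

Section meanO_independent.
Context (R : realType) (d : nat) (T : R) d0 (Om : measurableType d0)
  (P : probability Om R).
Local Notation bigO := (errO (@step_ok R d T _ Om P) (@sd_h R d _ Om) (@sd_x R d _ Om)).
Implicit Types (U e : Om -> 'rV[R]_d).

(** The expansion for a deterministic start is applied to each value of U and then integrated, the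
    noise being independent of U; only a moment of the weight of U remains. *)
Lemma meanO_independent n (F : R -> R -> 'rV[R]_d -> 'rV[R]_d -> R)
    (G : R -> R -> 'rV[R]_d -> R) :
  (forall t h, t \in `[0, T] -> 0 <= h <= T ->
    measurable_fun setT (fun z : 'rV[R]_d * 'rV[R]_d => F t h z.1 z.2)) ->
  (forall t h, t \in `[0, T] -> 0 <= h <= T -> measurable_fun setT (G t h)) ->
  pair_growth T F ->
  bigO 0 (fun i => G (sd_t i) (sd_h i) (sd_x i)) ->
  meanO T P n (fun i w => F (sd_t i) (sd_h i) (sd_x i) (sd_e i w))
    (fun i => G (sd_t i) (sd_h i) (sd_x i)) ->
  exists C m, 0 <= C /\ forall t h U e, t \in `[0, T] -> 0 <= h <= T ->
    measurable_fun setT U -> has_density P e (gauss_pdf 0 1) ->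
    independent2 P U e -> rintegrable P (fun w => weight (U w) ^+ m) ->
    [/\ rintegrable P (fun w => F t h (U w) (e w)),
        rintegrable P (fun w => G t h (U w)) &
    `|\int[P]_w F t h (U w) (e w) - \int[P]_w G t h (U w)| <=
      C * h ^+ n * \int[P]_w (weight (U w) ^+ m)].
Proof.
move=> mF mG [K [k [K0 FK]]] [K' [k' [K'0 GK]]] [_ [C [m [C0 FG]]]].
(* One exponent for the bound on F, the bound on G and the error. *)
pose M := maxn (maxn k k') m.
have kM : (k <= M)%N by rewrite !leq_max leqnn.
have k'M : (k' <= M)%N by rewrite !leq_max leqnn orbT.
have mM : (m <= M)%N by rewrite leq_max leqnn orbT.
exists C, M; split=> // t h U e tT hT mU he Ue iU.
have me : measurable_fun setT e by case: he.
have h0 : 0 <= h by case/andP: hT.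
have iG : rintegrable P (fun w => G t h (U w)).
  apply: (@rintegrable_le _ _ _ _ _ (fun w => K' * weight (U w) ^+ M)).
  - by apply: (measurableT_comp (f := G t h)) => //; exact: mG.
  - move=> w; have := GK (StepData t h (U w) e) (And3 tT hT he).
    rewrite /= expr0 mulr1 => /le_trans; apply.
    by rewrite ler_wpM2l// weight_leX.
  - exact: rintegrableZ.
have [iw _] := gauss_weightE M he.
(* K may vanish, and the error constant [C * h ^+ n / (K + 1)] has to be defined. *)
have iK : rintegrable P ((fun u => (K + 1) * weight u ^+ M) \o U).
  exact: rintegrableZ.
have [||||||||||iF H] := @Rintegral_independent2_le _ Om R P _ _ _ _ U e mU me Ue
  (fun z => F t h z.1 z.2) (fun u => (K + 1) * weight u ^+ M)
  (fun z => weight z ^+ M) (G t h) (C * h ^+ n / (K + 1)) => //.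
- exact: mF.
- apply: measurable_funM => //; exact: measurable_weight.
- exact: measurable_weight.
- by move=> u; rewrite mulr_ge0 ?addr_ge0 ?weightX_ge0.
- by move=> v; rewrite weightX_ge0.
- move=> u v /=; apply: (le_trans (FK t h u v tT hT)).
  rewrite -mulrA; apply: ler_pM => //; first by rewrite mulr_ge0 ?weightX_ge0.
    by rewrite lerDl.
  by apply: ler_pM; rewrite ?weightX_ge0 ?weight_leX.
- move=> u /=; have := FG (StepData t h u e) (And3 tT hT he).
  move=> /= /le_trans; apply.
  rewrite mulrA divfK ?gt_eqF ?ltr_wpDl//.
  by rewrite ler_wpM2l ?mulr_ge0 ?exprn_ge0 ?weight_leX.
split => //; apply: (le_trans H).
rewrite RintegralZl// mulrA divfK// gt_eqF// ltr_wpDl//.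
Qed.

End meanO_independent.

Section step_independent.
Context (R : realType) (d : nat) (T : R) d0 (Om : measurableType d0)
  (P : probability Om R).
Local Notation bigO := (errO (@step_ok R d T _ Om P) (@sd_h R d _ Om) (@sd_x R d _ Om)).
Implicit Types (U e : Om -> 'rV[R]_d) (u : R -> 'rV[R]_d -> R).

Lemma measurable_classC r s u t : classC r s T u -> t \in `[0, T] ->
  measurable_fun setT (u t).
Proof.
move=> cu tT; apply: continuous_measurable_rV; exact: classC_continuous cu tT.
Qed.

Lemma measurable_classC_vec r s (a : R -> 'rV[R]_d -> 'rV[R]_d) t :
  classC_vec r s T a -> t \in `[0, T] -> measurable_fun setT (a t).
Proof. by move=> ca tT; apply: measurable_to_rV => k; exact: measurable_classC (ca k) tT. Qed.

Lemma divergence_classC r s (a : R -> 'rV[R]_d -> 'rV[R]_d) :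
  classC_vec r s.+1 T a -> classC r s T (fun t => divergence (a t)).
Proof. by move=> ca; apply: classC_sum => i; exact: classC_partial (ca i). Qed.

Variables (a a' : R -> 'rV[R]_d -> 'rV[R]_d) (g : R -> R) (gm gM : R).
Hypotheses (ca : classC_vec 0 3 T a) (ca' : classC_vec 0 3 T a') (gm0 : 0 < gm)
  (hg : forall t, t \in `[0, T] -> gm <= `|g t| <= gM).

Lemma measurable_step_move t h d1 (Om1 : measurableType d1)
    (U V : Om1 -> 'rV[R]_d) : t \in `[0, T] ->
  measurable_fun setT U -> measurable_fun setT V ->
  measurable_fun setT (fun w => step_move a g t h (U w) (V w)).
Proof.
move=> tT mU mV; apply: measurable_rVD; last exact: measurable_rVZ.
apply: measurable_rVD => //; apply: measurable_rVZ.
by apply: (measurableT_comp (f := a t)) => //; exact: measurable_classC_vec.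
Qed.

Lemma measurable_step_log_ratio t h d1 (Om1 : measurableType d1)
    (U V : Om1 -> 'rV[R]_d) : t \in `[0, T] ->
  measurable_fun setT U -> measurable_fun setT V ->
  measurable_fun setT (fun w => step_log_ratio a a' g t h (U w) (V w)).
Proof.
move=> tT mU mV.
have mq k : measurable_fun setT (fun w => a t (U w) 0 k +
    a' t (step_move a g t h (U w) (V w)) 0 k).
  apply: measurable_funD.
    exact: measurableT_comp (measurable_classC (ca k) tT) mU.
  exact: measurableT_comp (measurable_classC (ca' k) tT)
    (measurable_step_move h tT mU mV).
apply: measurable_funD; apply: measurable_funM => //; apply: measurable_sum => k.
  by apply: measurable_funM => //; exact: measurableT_comp (measurable_coord k) mV.
exact: measurable_funX.
Qed.

Lemma step_value_independent u : classC 0 2 T u ->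
  exists C m, 0 <= C /\ forall t h U e, t \in `[0, T] -> 0 <= h <= T ->
    measurable_fun setT U -> has_density P e (gauss_pdf 0 1) ->
    independent2 P U e -> rintegrable P (fun w => weight (U w) ^+ m) ->
    [/\ rintegrable P (fun w => u t (step_move a g t h (U w) (e w))),
        rintegrable P (fun w => u t (U w)) &
    `|\int[P]_w u t (step_move a g t h (U w) (e w)) - \int[P]_w u t (U w)| <=
      C * h ^+ 1 * \int[P]_w (weight (U w) ^+ m)].
Proof.
move=> cu.
apply: (@meanO_independent R d T _ Om P 1
  (fun t h x z => u t (step_move a g t h x z)) (fun t h x => u t x)).
- move=> t h tT hT; apply: (measurableT_comp (measurable_classC cu tT)).
  exact: measurable_step_move.
- by move=> t h tT hT; exact: measurable_classC cu tT.
- exact: pair_growth_move hg _ cu.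
- exact: bigO_classC cu.
- exact: (euler_mean_value2 P ca hg cu).
Qed.

Variable (L : R -> 'rV[R]_d -> R).
Hypothesis cL : classC 0 4 T L.

Let cpL k : classC 0 3 T (fun t => 'D_(basis_vec k) (L t)).
Proof. exact: classC_partial cL. Qed.

Let clL : classC 0 2 T (fun t => laplacian (L t)).
Proof. exact: laplacian_classC cL. Qed.

Lemma measurable_step_gen t : t \in `[0, T] ->
  measurable_fun setT (step_gen L a a' g t).
Proof.
move=> tT; have ma := measurable_classC (ca _) tT.
have ma' := measurable_classC (ca' _) tT.
apply: measurable_funB.
  apply: measurable_funB.
    apply: measurable_funD.
      apply: measurable_sum => k; apply: measurable_funM; first exact: ma.
      exact: measurable_classC (cpL k) tT.
    by apply: measurable_funM => //; exact: measurable_classC clL tT.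
  exact: measurable_classC (divergence_classC ca') tT.
apply: measurable_funM => //; apply: measurable_sum => k.
by apply: measurable_funX; apply: measurable_funD; [exact: ma|exact: ma'].
Qed.

Lemma bigO_step_gen : bigO 0 (fun i => step_gen L a a' g (sd_t i) (sd_x i)).
Proof.
have hok := @step_ok_h R d T _ Om P.
have gO : bigO 0 (fun i => g (sd_t i)) by exact: bigO_g hg.
have gVO : bigO 0 (fun i => (g (sd_t i))^-1) by exact: bigO_gV hg.
apply: (errOB hok).
  apply: (errOB hok).
    apply: (errOD hok).
      apply: (errO_sum hok) => k.
      exact: (errOM (bigO_classC P (ca k)) (bigO_classC P (cpL k))).
    have := errOM (errOM gO (errOZ 2^-1 gO)) (bigO_classC P clL).
    by apply: errO_eq => i _; congr (_ * _); ring.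
  exact: (bigO_classC P (divergence_classC ca')).
have hS : bigO 0 (fun i =>
    \sum_k (a (sd_t i) (sd_x i) 0 k + a' (sd_t i) (sd_x i) 0 k) ^+ 2).
  apply: (errO_sum hok) => k.
  have h1 : bigO 0 (fun i => a (sd_t i) (sd_x i) 0 k + a' (sd_t i) (sd_x i) 0 k).
    exact: (errOD hok (bigO_classC P (ca k)) (bigO_classC P (ca' k))).
  exact: (errOM h1 h1).
apply: errO_eq (errOM (errOM gVO (errOZ 2^-1 gVO)) hS) => i _.
by rewrite invfM expr2 invfM; congr (_ * _); ring.
Qed.

Lemma step_loss_independent :
  exists C m, 0 <= C /\ forall t h U e, t \in `[0, T] -> 0 <= h <= T ->
    measurable_fun setT U -> has_density P e (gauss_pdf 0 1) ->
    independent2 P U e -> rintegrable P (fun w => weight (U w) ^+ m) ->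
    [/\ rintegrable P (fun w => step_loss L a a' g t h (U w) (e w)),
        rintegrable P (fun w => h * step_gen L a a' g t (U w)) &
    `|\int[P]_w step_loss L a a' g t h (U w) (e w) -
      \int[P]_w (h * step_gen L a a' g t (U w))| <=
      C * h ^+ 2 * \int[P]_w (weight (U w) ^+ m)].
Proof.
apply: (@meanO_independent R d T _ Om P 2 (step_loss L a a' g)
  (fun t h x => h * step_gen L a a' g t x)).
- move=> t h tT hT; apply: measurable_funB; last exact: measurable_step_log_ratio.
  apply: measurable_funB.
    by apply: (measurableT_comp (measurable_classC cL tT)); exact: measurable_step_move.
  by apply: (measurableT_comp (measurable_classC cL tT)).
- by move=> t h tT hT; apply: measurable_funM => //; exact: measurable_step_gen.
- exact: (pair_growth_step_loss ca ca' gm0 hg cL).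
- have hok := @step_ok_h R d T _ Om P.
  have := errOM (errO_h _ hok) bigO_step_gen.
  exact: (errO_leq hok (isT : (0 <= 1)%N)).
- exact: (step_loss_mean P cL ca ca' gm0 hg).
Qed.

End step_independent.

(** * The Fokker-Planck equation *)

Section time_calculus.
Context (R : realType) (d : nat) (T : R).
Implicit Types (u : R -> 'rV[R]_d -> R).

Lemma is_derive_classC r s u k t x : classC r s.+1 T u -> t \in `[0, T] ->
  is_derive x (basis_vec k) (u t) ('D_(basis_vec k) (u t) x).
Proof.
move=> /classC_jet[D D0 Dj] tT; have H := is_derive_partial k x D0 Dj tT.
by rewrite (@derive_val _ _ _ _ _ _ _ H).
Qed.

Lemma cont_strip_time u x : cont_strip T u ->
  {within `[0, T], continuous (fun t => u t x)}.
Proof.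
move=> /subspace_continuousP cu; apply/subspace_continuousP => t /= tT A nA.
have H := cu (t, x) (conj tT Logic.I) A nA.
have {}H : nbhs (t, x) (fun z => (`[0, T] `*` [set: 'rV[R]_d]) z -> A (u z.1 z.2)).
  exact: H.
case: H => -[A1 A2] /= [nA1 nA2] sA.
apply: filterS nA1 => y A1y yT; apply: (sA (y, x)) => //.
by split => //; exact: nbhs_singleton.
Qed.

Lemma classC_time_continuous r s u x : classC r s T u ->
  {within `[0, T], continuous (fun t => u t x)}.
Proof.
move=> /classC_jet[D D0 [Dreg _ _]].
have [cD _] := Dreg 0%N [::] (leq0n _) (leq0n _).
have := @cont_strip_time (D 0%N [::]) x cD.
by apply: subspace_eq_continuous => t /set_mem tT /=; exact: D0.
Qed.

Lemma within_subitv (v : R -> R) (s t : R) : {within `[0, T], continuous v} ->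
  s \in `[0, T] -> t \in `[0, T] -> {within `[s, t], continuous v}.
Proof.
rewrite !in_itv /= => cv /andP[s0 _] /andP[_ tT].
apply: continuous_subspaceW cv => r /=; rewrite !in_itv /= => /andP[sr rt].
by rewrite (le_trans s0 sr) (le_trans rt tT).
Qed.

(** The mean value theorem asks for the derivative in the open interval only, so the times 0 and T
    are included. *)
Lemma classC_time_lip s u : classC 1 s T u -> exists C m, 0 <= C /\
  forall t t' x, t \in `[0, T] -> t' \in `[0, T] -> t <= t' ->
  `|u t' x - u t x| <= C * (t' - t) * weight x ^+ m.
Proof.
move=> cu; have [D D0 [Dreg Dt _]] := classC_jet cu.
have [_ [C [m [C0 DC]]]] := Dreg 1%N [::] (leqnn _) (leq0n _).
exists C, m; split => // t t' x tT t'T tt'.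
have inT r : r \in `]t, t'[ -> r \in `]0, T[.
  move: tT t'T; rewrite !in_itv /= => /andP[t0 _] /andP[_ t'T] /andP[h1 h2].
  by rewrite (le_lt_trans t0 h1) (lt_le_trans h2 t'T).
have [cD _] := Dreg 0%N [::] (leq0n _) (leq0n _).
have [r rtt' E] := @MVT_segment R (fun t => D 0%N [::] t x)
  (fun t => D 1%N [::] t x) t t' tt' (fun r rI => Dt 0%N [::] r x isT (leq0n _)
   (inT r rI)) (within_subitv (cont_strip_time cD) tT t'T).
rewrite -!D0// E normrM (ger0_norm (_ : 0 <= t' - t)) ?subr_ge0//.
rewrite mulrAC; apply: ler_wpM2r; first by rewrite subr_ge0.
apply: DC; move: tT t'T rtt'; rewrite !in_itv /=.
by move=> /andP[t0 _] /andP[_ t'T] /andP[h1 h2]; rewrite (le_trans t0)// (le_trans h2).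
Qed.

(** The mean value theorem gives v at an intermediate time; the Lipschitz bound on v brings it back
    to t at the cost of a second factor t' - t. *)
Lemma classC_time_taylor r s s' u v : classC r s T u -> classC 1 s' T v ->
  (forall t x, t \in `]0, T[ -> is_derive t 1 (fun t => u t x) (v t x)) ->
  exists C m, 0 <= C /\ forall t t' x, t \in `[0, T] -> t' \in `[0, T] -> t <= t' ->
  `|u t' x - u t x - (t' - t) * v t x| <= C * (t' - t) ^+ 2 * weight x ^+ m.
Proof.
move=> cu cv duv; have [C [m [C0 H]]] := classC_time_lip cv.
exists C, m; split => // t t' x tT t'T tt'.
have inT q : q \in `]t, t'[ -> q \in `]0, T[.
  move: tT t'T; rewrite !in_itv /= => /andP[t0 _] /andP[_ t'T] /andP[h1 h2].
  by rewrite (le_lt_trans t0 h1) (lt_le_trans h2 t'T).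
have [q qtt' ->] := @MVT_segment R (fun t => u t x) (fun t => v t x) t t' tt'
  (fun q qI => duv q x (inT q qI)) (within_subitv (@classC_time_continuous _ _ _ x cu) tT t'T).
have d0 : 0 <= t' - t by rewrite subr_ge0.
rewrite mulrC -mulrBr normrM (ger0_norm d0) expr2 mulrCA -!mulrA.
apply: ler_wpM2l => //.
have /andP[tq qt'] : t <= q <= t' by move: qtt'; rewrite in_itv.
have qT : q \in `[0, T].
  move: tT t'T; rewrite !in_itv /= => /andP[t0 _] /andP[_ t'T].
  by rewrite (le_trans t0)// (le_trans qt').
apply: (le_trans (H t q x tT qT tq)).
rewrite -mulrA; apply: ler_wpM2l => //; apply: ler_wpM2r; first exact: weightX_ge0.
by rewrite lerD2r.
Qed.

End time_calculus.

(** Restricted to a line, this is the one-variable chain rule. *)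
Lemma is_derive_dir_comp (R : realType) (V : normedModType R) (F : V -> R) (phi : R -> R)
    (x v : V) dF dphi : is_derive x v F dF -> is_derive (F x) 1 phi dphi ->
  is_derive x v (fun y => phi (F y)) (dphi * dF).
Proof.
move=> HF Hp.
have HF' : is_derive (0 : R) 1 (fun r : R => F (r *: v + x)) dF.
  apply: is_derive_eq_along HF => r.
  by rewrite addr0 scale_one.
have Hp' : is_derive (F (0 *: v + x)) 1 phi dphi by rewrite scale0r add0r.
apply: is_derive_eq_along (is_derive1_comp Hp' HF') => r /=.
by rewrite addr0 scale_one.
Qed.

Section is_derive_real.
Context (R : realType) (V : normedModType R).
Implicit Types (F G : V -> R) (x v : V).

Lemma is_derive_addf F G x v dF dG : is_derive x v F dF -> is_derive x v G dG ->
  is_derive x v (fun y => F y + G y) (dF + dG).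
Proof. by move=> hF hG; exact: is_deriveD. Qed.

Lemma is_derive_mulf F G x v dF dG : is_derive x v F dF -> is_derive x v G dG ->
  is_derive x v (fun y => F y * G y) (F x * dG + G x * dF).
Proof. by move=> hF hG; exact: is_deriveM. Qed.

Lemma is_derive_scalef c F x v dF : is_derive x v F dF ->
  is_derive x v (fun y => c * F y) (c * dF).
Proof.
move=> hF; have := is_derive_mulf (is_derive_cst c x v) hF.
by rewrite mulr0 addr0.
Qed.

Lemma derive_eq F x v dF : is_derive x v F dF -> 'D_v F x = dF.
Proof. by move=> hF; rewrite derive_val. Qed.

End is_derive_real.

Section drifts.
Context (R : realType) (d : nat) (T : R).
Variables (f : R -> 'rV[R]_d -> 'rV[R]_d) (g : R -> R)
  (p : R -> 'rV[R]_d -> R) (shat : R -> 'rV[R]_d -> 'rV[R]_d).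
Hypotheses (p_gt0 : forall t x, t \in `[0, T] -> 0 < p t x)
  (fokker_planck : forall t x, t \in `]0, T[ ->
     is_derive t 1 (fun t' => p t' x)
       (- divergence (fun z => p t z *: f t z) x +
        2^-1 * laplacian (fun z => g t ^+ 2 * p t z) x))
  (g0 : forall t, t \in `[0, T] -> g t != 0)
  (cg : C1_time T g) (cf : classC_vec 1 3 T f) (cL : classC 2 4 T (logdens p))
  (cD : classC_vec 1 3 T (score_error p shat)).
Local Notation L := (logdens p).
Local Notation s := (score p).
Local Notation delta := (score_error p shat).
Local Notation b := (reverse_drift f g shat).

Lemma scoreE t x k : s t x 0 k = 'D_(basis_vec k) (L t) x.
Proof. by rewrite mxE. Qed.

Lemma shatE t x k : shat t x 0 k = s t x 0 k + delta t x 0 k.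
Proof. by rewrite [delta t x 0 k]mxE [in X in _ + (_ + X)]mxE addrCA subrr addr0. Qed.

Lemma score_classC : classC_vec 2 3 T s.
Proof.
move=> k; apply: classC_eq (classC_partial k cL) => t x _.
by rewrite scoreE.
Qed.

Lemma shat_classC : classC_vec 1 3 T shat.
Proof.
move=> k; apply: classC_eq (classCD (classC_le (isT : (1 <= 2)%N) (leqnn 3)
  (score_classC k)) (cD k)) => t x _.
by rewrite shatE.
Qed.

Lemma g2_classC s0 : classC 1 s0 T (fun t (_ : 'rV[R]_d) => g t ^+ 2).
Proof.
apply: classC_eq (classCM (classC_time (d := d) s0 cg (leqnn 1)) (classC_time s0 cg (leqnn 1))).
by [].
Qed.

Lemma reverse_driftE t x k : b t x 0 k = - f t x 0 k + g t ^+ 2 * shat t x 0 k.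
Proof. by rewrite !mxE. Qed.

Lemma reverse_drift_classC : classC_vec 1 3 T b.
Proof.
move=> k; apply: classC_eq (classCD (classCN (cf k))
  (classCM (g2_classC 3) (shat_classC k))) => t x _.
by rewrite reverse_driftE.
Qed.

Lemma divergence_score t x : divergence (s t) x = laplacian (L t) x.
Proof.
apply: eq_bigr => k _; congr ('D_(basis_vec k) _ x); apply/funext => z.
exact: scoreE.
Qed.

Lemma divergence_reverse_drift t x : t \in `[0, T] -> divergence (b t) x =
  - divergence (f t) x + g t ^+ 2 * (laplacian (L t) x + divergence (delta t) x).
Proof.
move=> tT; rewrite -divergence_score /divergence -big_split mulr_sumr -sumrN -big_split.
apply: eq_bigr => k _ /=.
have df := is_derive_classC k x (cf k) tT.
have ds := is_derive_classC k x (score_classC k) tT.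
have dd := is_derive_classC k x (cD k) tT.
rewrite (_ : (fun z => b t z 0 k) = (fun z => -1 * f t z 0 k + g t ^+ 2 *
    (s t z 0 k + delta t z 0 k))); last first.
  by apply/funext => z; rewrite reverse_driftE shatE mulN1r.
rewrite (derive_eq (is_derive_addf (is_derive_scalef (-1) df)
  (is_derive_scalef (g t ^+ 2) (is_derive_addf ds dd)))).
by rewrite mulN1r.
Qed.

(** The right-hand side of the Fokker-Planck equation once divided by p, with grad p = p s. *)
Definition fp_rhs t x : R := - divergence (f t) x -
  \sum_k f t x 0 k * s t x 0 k +
  g t ^+ 2 / 2 * (laplacian (L t) x + \sum_k s t x 0 k ^+ 2).

Definition fwd_loss t x : R := g t ^+ 2 * (divergence (delta t) x +
  \sum_k s t x 0 k * delta t x 0 k + 2^-1 * \sum_k delta t x 0 k ^+ 2).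

Definition bwd_loss t x : R := g t ^+ 2 * (2^-1 * \sum_k delta t x 0 k ^+ 2).

Lemma densityE t x : t \in `[0, T] -> p t x = expR (L t x).
Proof. by move=> tT; rewrite lnK// posrE p_gt0. Qed.

Lemma is_derive_density t x k : t \in `[0, T] ->
  is_derive x (basis_vec k) (p t) (p t x * s t x 0 k).
Proof.
move=> tT; rewrite (_ : p t = (fun z => expR (L t z))); last first.
  by apply/funext => z; rewrite densityE.
rewrite scoreE; apply: is_derive_dir_comp.
exact: is_derive_classC cL tT.
Qed.

Lemma fp_logdens t x : t \in `]0, T[ ->
  is_derive t 1 (fun t => L t x) (fp_rhs t x).
Proof.
move=> tI; have tT : t \in `[0, T] by exact: subset_itv_oo_cc.
have p0 := p_gt0 x tT; have H := fokker_planck x tI.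
have := is_derive_dir_comp H (is_derive1_ln p0).
congr is_derive.
rewrite (_ : divergence _ x = p t x * \sum_k (s t x 0 k * f t x 0 k +
    'D_(basis_vec k) (fun z => f t z 0 k) x)); last first.
  rewrite mulr_sumr; apply: eq_bigr => k _.
  rewrite (_ : (fun z => (p t z *: f t z) 0 k) = fun z => p t z * f t z 0 k);
    last by apply/funext => z; rewrite mxE.
  rewrite (derive_eq (is_derive_mulf (is_derive_density x k tT)
    (is_derive_classC k x (cf k) tT))).
  by ring.
rewrite (_ : laplacian _ x = p t x * (g t ^+ 2 * \sum_k (s t x 0 k ^+ 2 +
    'D_(basis_vec k) (fun z => s t z 0 k) x))); last first.
  rewrite !mulr_sumr; apply: eq_bigr => k _.
  rewrite (_ : (fun z => 'D_(basis_vec k) _ z) = fun z => g t ^+ 2 *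
      (p t z * s t z 0 k)); last first.
    apply/funext => z.
    by rewrite (derive_eq (is_derive_scalef (g t ^+ 2) (is_derive_density z k tT))).
  rewrite (derive_eq (is_derive_scalef (g t ^+ 2) (is_derive_mulf
    (is_derive_density x k tT) (is_derive_classC k x (score_classC k) tT)))).
  by ring.
rewrite /fp_rhs -divergence_score /divergence.
rewrite [in X in - (_ * X)]big_split [in X in (g t ^+ 2 * X)]big_split /=.
under [\sum_k s t x 0 k * f t x 0 k]eq_bigr do rewrite mulrC.
move: (\sum_k _) (\sum_k _) (\sum_k _) (\sum_k _) (g t) (p t x) p0
  => A1 A2 A3 A4 A5 A6 A60.
by field; rewrite gt_eqF.
Qed.

(** Here f + b = g^2 (s + delta), so the square contributes -g^2 |s + delta|^2 / 2, while -div b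
    contributes div f minus g^2 times the Laplacian of L plus div delta. Everything free of delta
    cancels against the Fokker-Planck term. *)
Lemma fwd_drift_identity t x : t \in `[0, T] ->
  step_gen L f b g t x + fp_rhs t x = - fwd_loss t x.
Proof.
move=> tT; rewrite /step_gen /fp_rhs /fwd_loss divergence_reverse_drift//.
have -> : \sum_k (f t x 0 k + b t x 0 k) ^+ 2 = (g t ^+ 2) ^+ 2 *
    (\sum_k s t x 0 k ^+ 2 + 2 * (\sum_k s t x 0 k * delta t x 0 k) +
     \sum_k delta t x 0 k ^+ 2).
  rewrite mulr_sumr -!big_split mulr_sumr; apply: eq_bigr => k _ /=.
  by rewrite reverse_driftE shatE; ring.
under eq_bigr do rewrite -scoreE.
move: (\sum_k _) (\sum_k _) (\sum_k _) (\sum_k _) (divergence (f t) x)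
  (divergence (delta t) x) (laplacian (L t) x) (g t) (g0 tT)
  => A1 A2 A3 A4 A5 A6 A7 A8 A80.
by field.
Qed.

(** The Fokker-Planck term changes sign because time decreases. The drift b now acts on L, and its
    part g^2 <s, delta> cancels the cross term of the square; the reversed drift f brings no div
    delta. *)
Lemma bwd_drift_identity t x : t \in `[0, T] ->
  step_gen L b f g t x - fp_rhs t x = - bwd_loss t x.
Proof.
move=> tT; rewrite /step_gen /fp_rhs /bwd_loss.
have -> : \sum_k (b t x 0 k + f t x 0 k) ^+ 2 = (g t ^+ 2) ^+ 2 *
    (\sum_k s t x 0 k ^+ 2 + 2 * (\sum_k s t x 0 k * delta t x 0 k) +
     \sum_k delta t x 0 k ^+ 2).
  rewrite mulr_sumr -!big_split mulr_sumr; apply: eq_bigr => k _ /=.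
  by rewrite reverse_driftE shatE; ring.
have -> : \sum_k b t x 0 k * 'D_(basis_vec k) (L t) x =
    - (\sum_k f t x 0 k * s t x 0 k) + g t ^+ 2 * (\sum_k s t x 0 k ^+ 2 +
      \sum_k s t x 0 k * delta t x 0 k).
  rewrite -big_split mulr_sumr -sumrN -big_split; apply: eq_bigr => k _ /=.
  by rewrite reverse_driftE shatE -scoreE; ring.
move: (\sum_k _) (\sum_k _) (\sum_k _) (\sum_k _) (divergence (f t) x)
  (laplacian (L t) x) (g t) (g0 tT)
  => A1 A2 A3 A4 A5 A6 A7 A70.
by field.
Qed.

Lemma fp_rhs_classC : classC 1 2 T fp_rhs.
Proof.
have c12 u : classC 1 3 T u -> classC 1 2 T u by apply: classC_le.
have cs k : classC 1 2 T (fun t x => s t x 0 k).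
  by apply: classC_le (score_classC k).
apply: classCD; first apply: classCB.
- exact: classCN (divergence_classC cf).
- by apply: classC_sum => k; apply: classCM; [exact/c12/cf|exact: cs].
apply: classCM.
  apply: classC_eq (classCZ 2^-1 (g2_classC 2)) => t x _.
  by rewrite mulrC.
apply: classCD; first by apply: classC_le (laplacian_classC cL).
by apply: classC_sum => k; apply: classC_eq (classCM (cs k) (cs k)).
Qed.

Lemma bwd_loss_classC : classC 1 2 T bwd_loss.
Proof.
apply: classCM; first exact: g2_classC.
apply: classCZ; apply: classC_sum => k.
have cd : classC 1 2 T (fun t x => delta t x 0 k) by apply: classC_le (cD k).
by apply: classC_eq (classCM cd cd).
Qed.

Lemma fwd_loss_classC : classC 1 2 T fwd_loss.
Proof.
have cd k : classC 1 2 T (fun t x => delta t x 0 k) by apply: classC_le (cD k).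
have cs k : classC 1 2 T (fun t x => s t x 0 k) by apply: classC_le (score_classC k).
apply: classCM; first exact: g2_classC.
apply: classCD; first apply: classCD.
- exact: divergence_classC cD.
- by apply: classC_sum => k; exact: classCM.
apply: classCZ; apply: classC_sum => k.
by apply: classC_eq (classCM (cd k) (cd k)).
Qed.

Lemma logdens_time_taylor : exists C m, 0 <= C /\ forall t t' x,
  t \in `[0, T] -> t' \in `[0, T] -> t <= t' ->
  `|L t' x - L t x - (t' - t) * fp_rhs t x| <= C * (t' - t) ^+ 2 * weight x ^+ m.
Proof.
apply: (classC_time_taylor cL fp_rhs_classC) => t x; exact: fp_logdens.
Qed.

End drifts.

(** * Density ratio of a step and its reversal *)

Section density_ratio.
Context (R : realType) (d : nat).

Lemma enorm_sqr (x : 'rV[R]_d) : enorm x ^+ 2 = \sum_i x 0 i ^+ 2.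
Proof. by rewrite sqr_sqrtr// sumr_ge0// => i _; exact: sqr_ge0. Qed.

(** Both normal densities have the same variance, so their peaks cancel; the exponents compare |h (a
    + a') + sigma z|^2 with |sigma z|^2, where sigma = h^(1/2) g. *)
Lemma step_density_ratio (a a' : R -> 'rV[R]_d -> 'rV[R]_d) (g : R -> R) t h x z :
  0 < h -> g t != 0 -> let y := step_move a g t h x z in
  gauss_pdf (y + h *: a' t y) (g t ^+ 2 * h) x =
  expR (- step_log_ratio a a' g t h x z) *
  gauss_pdf (x + h *: a t x) (g t ^+ 2 * h) y.
Proof.
move=> h0 gt y; rewrite /gauss_pdf [RHS]mulrCA -expRD; congr (_ * expR _).
rewrite /step_log_ratio !enorm_sqr.
rewrite mulr_sumr mulr_sumr !mulr_suml -big_split -!sumrN -big_split /=.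
apply: eq_bigr => k _; rewrite -/y !mxE.
have hE := sqr_sqrtr (ltW h0); have r0 : 0 < Num.sqrt h by rewrite sqrtr_gt0.
move: (a' t y 0 k) => A' {y}; move: hE r0 gt.
move: (a t x 0 k) (x 0 k) (z 0 k) (g t) {h0} h (Num.sqrt h)
  => A x' z' g' h' r <- r0 g'0.
by field; rewrite g'0 gt_eqF.
Qed.

Lemma ln_ratio (p1 p2 A B C D S1 S2 : R) : 0 < p1 -> 0 < p2 -> C != 0 ->
  D != 0 -> A = expR (- S1) * C -> B = expR (- S2) * D ->
  ln (p1 / p2 * ((A * B) / (C * D))) = ln p1 - ln p2 - S1 - S2.
Proof.
move=> p10 p20 C0 D0 -> ->.
rewrite (_ : p1 / p2 * _ = expR (ln p1 + - ln p2 + - S1 + - S2)) ?expRK//.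
rewrite !expRD [expR (- ln p2)]expRN !lnK ?posrE//.
move: (expR _) (expR _) => E1 E2.
by field; rewrite C0 D0 gt_eqF.
Qed.

Lemma log_MH_ratio_sum (f b : R -> 'rV[R]_d -> 'rV[R]_d) (g : R -> R) h N
    (p0 : 'rV[R]_d -> R) (x y : nat -> 'rV[R]_d) (rx ry : nat -> R) :
  (forall x, 0 < p0 x) ->
  (forall k, (k < N)%N -> 0 < g (grid h k) ^+ 2 * h) ->
  (forall k, (k < N)%N -> bwd_kernel b g h k (x k) (x k.+1) =
    expR (- rx k) * fwd_kernel f g h k (x k.+1) (x k)) ->
  (forall k, (k < N)%N -> fwd_kernel f g h k (y k.+1) (y k) =
    expR (- ry k) * bwd_kernel b g h k (y k) (y k.+1)) ->
  log_MH_ratio f b g h N p0 x y =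
  ln (p0 (y 0%N)) - ln (p0 (x 0%N)) - \sum_(k < N) rx k - \sum_(k < N) ry k.
Proof.
move=> p0_gt0 v0 Hx Hy; apply: ln_ratio => //.
- by rewrite gt_eqF// prodr_gt0// => k _; apply: gauss_pdf_gt0; exact: v0.
- by rewrite gt_eqF// prodr_gt0// => k _; apply: gauss_pdf_gt0; exact: v0.
- by rewrite -sumrN expR_sum -big_split; apply: eq_bigr => k _; exact: Hx.
- by rewrite -sumrN expR_sum -big_split; apply: eq_bigr => k _; exact: Hy.
Qed.

End density_ratio.

(** * The Euler schemes *)

Section schemes.
Context (R : realType) (d : nat) (T : R) d0 (Om : measurableType d0)
  (P : probability Om R).
Variables (f : R -> 'rV[R]_d -> 'rV[R]_d) (g : R -> R)
  (p : R -> 'rV[R]_d -> R) (shat : R -> 'rV[R]_d -> 'rV[R]_d)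
  (x0 : nat -> Om -> 'rV[R]_d) (eps zeta : nat -> nat -> Om -> 'rV[R]_d).
Variable N : nat.
Hypotheses (T_gt0 : 0 < T) (N_gt0 : (0 < N)%N)
  (noise : euler_noise P (p 0) N (x0 N) (eps N) (zeta N))
  (p_gt0 : forall t x, t \in `[0, T] -> 0 < p t x)
  (g0 : forall t, t \in `[0, T] -> g t != 0).
Local Notation L := (logdens p).
Local Notation b := (reverse_drift f g shat).
Local Notation h := (step T N).
Local Notation t_ := (grid h).
Local Notation x_ := (scheme_x T f g x0 eps N).
Local Notation y_ := (scheme_y T f g x0 eps zeta shat N).
Hypotheses (cf : classC_vec 0 3 T f) (cb : classC_vec 0 3 T b).

Lemma step_gt0 : 0 < h.
Proof. by rewrite divr_gt0// ltr0n. Qed.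

Lemma grid_in k : (k <= N)%N -> t_ k \in `[0, T].
Proof.
move=> kN; rewrite in_itv /= /grid mulr_ge0 ?ler0n ?(ltW step_gt0)//=.
rewrite /step mulrCA ler_piMr ?(ltW T_gt0)// ler_pdivrMr ?ltr0n// mul1r ler_nat//.
Qed.

Lemma step_in : 0 <= h <= T.
Proof.
rewrite (ltW step_gt0) /= /step ler_pdivrMr ?ltr0n// ler_peMr ?(ltW T_gt0)//.
by rewrite ler1n.
Qed.

Lemma grid_end : t_ N = T.
Proof. by rewrite /grid /step mulrC divfK// pnatr_eq0 -lt0n. Qed.

Lemma scheme_xS k w : x_ k.+1 w = step_move f g (t_ k) h (x_ k w) (eps N k w).
Proof. by []. Qed.

Lemma scheme_yN w : y_ N w = x_ N w.
Proof. by rewrite /scheme_y /euler_bwd subnn. Qed.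

Lemma scheme_yS k w : (k < N)%N ->
  y_ k w = step_move b g (t_ k) h (y_ k.+1 w) (zeta N k w).
Proof.
move=> kN; rewrite /scheme_y /euler_bwd -(subnSK kN) /=.
by rewrite (subnSK kN) subKn// ltnW.
Qed.

Definition noise_var (i : option ('I_N + 'I_N)) : Om -> 'rV[R]_d :=
  match i with
  | None => x0 N
  | Some (inl k) => eps N k
  | Some (inr k) => zeta N k
  end.

Lemma noise_var_measurable i : measurable_fun setT (noise_var i).
Proof.
have [hx he hz _] := noise.
by case: i => [[k|k]|] /=; [case: (he k (ltn_ord k))|case: (hz k (ltn_ord k))|case: hx].
Qed.

Lemma noise_var_independent : mutually_independent P noise_var.
Proof. by have [_ _ _ H] := noise. Qed.

(* Order of use of the noise variables: x_0, eps_0, ..., eps_(N-1),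
   zeta_(N-1), ..., zeta_0. *)
Definition noise_rank (i : option ('I_N + 'I_N)) : nat :=
  match i with
  | None => 0
  | Some (inl k) => k.+1
  | Some (inr k) => (2 * N - k)%N
  end.

Definition used (j : nat) : pred (option ('I_N + 'I_N)) :=
  fun i => (noise_rank i <= j)%N.

(** Measurability with respect to the noise already used: the filtration along which the chains
    run. *)
Definition meas_past j d1 (T1 : measurableType d1) (U : Om -> T1) : Prop :=
  @measurable_fun _ _ (g_sigma_algebraType (family_events noise_var (used j))) _ setT U.

Lemma eps_used j k : (k < N)%N -> (k < j)%N -> meas_past j (eps N k).
Proof.
move=> kN kj; have := @family_events_var _ _ _ _ _ noise_var (used j)
  (Some (inl (Ordinal kN))).
by apply; rewrite /used.
Qed.

Lemma zeta_used j k : (k < N)%N -> (2 * N - k <= j)%N -> meas_past j (zeta N k).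
Proof.
move=> kN kj; have := @family_events_var _ _ _ _ _ noise_var (used j)
  (Some (inr (Ordinal kN))).
by apply; rewrite /used.
Qed.

Lemma scheme_x_used j k : (k <= N)%N -> (k <= j)%N -> meas_past j (x_ k).
Proof.
elim: k => [|k IH] kN kj.
  by have := @family_events_var _ _ _ _ _ noise_var (used j) None; apply.
apply: (@measurable_step_move R d T f g cf (t_ k) h).
- exact: grid_in (ltnW kN).
- by apply: IH; exact: ltnW.
- exact: eps_used.
Qed.

Lemma scheme_y_used j k : (k <= N)%N -> (2 * N - k <= j)%N -> meas_past j (y_ k).
Proof.
(* Induction on the number i = N - k of backward steps already made. *)
move=> kN; rewrite -(subKn kN); move: (N - k)%N (leq_subr k N) => i.
elim: i => [|i IH] iN ij.
  have -> : y_ (N - 0) = x_ N by apply/funext => w; rewrite subn0 scheme_yN.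
  by apply: scheme_x_used => //; rewrite (leq_trans _ ij)// subn0 mul2n -addnn addnK.
have kS : (N - i.+1).+1 = (N - i)%N by rewrite subnSK.
have kN' : (N - i.+1 < N)%N by rewrite ltn_subrL.
have -> : y_ (N - i.+1) = fun w => step_move b g (t_ (N - i.+1)) h
    (y_ (N - i) w) (zeta N (N - i.+1) w).
  by apply/funext => w; rewrite scheme_yS// kS.
apply: (@measurable_step_move R d T b g cb).
- exact: grid_in (ltnW kN').
- apply: IH; first exact: ltnW.
  by rewrite (leq_trans _ ij)// leq_sub2l// leq_sub2l.
- exact: zeta_used.
Qed.

Lemma past_measurable j d1 (T1 : measurableType d1) (U : Om -> T1) :
  meas_past j U -> measurable_fun setT U.
Proof. by move=> mU; exact: (measurable_family noise_var_measurable mU). Qed.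

Lemma past_independent_eps j k d1 (T1 : measurableType d1) (U : Om -> T1) :
  (k < N)%N -> (j <= k)%N -> meas_past j U -> independent2 P U (eps N k).
Proof.
move=> kN jk mU.
have nj : ~~ used j (Some (inl (Ordinal kN))) by rewrite /used /= -ltnNge ltnS.
have H := independent2_family noise_var_measurable noise_var_independent nj mU.
exact: H.
Qed.

Lemma past_independent_zeta j k d1 (T1 : measurableType d1) (U : Om -> T1) :
  (k < N)%N -> (j < 2 * N - k)%N -> meas_past j U -> independent2 P U (zeta N k).
Proof.
move=> kN jk mU.
have nj : ~~ used j (Some (inr (Ordinal kN))) by rewrite /used /= -ltnNge.
have H := independent2_family noise_var_measurable noise_var_independent nj mU.
exact: H.
Qed.

Lemma measurable_x k : (k <= N)%N -> measurable_fun setT (x_ k).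
Proof. by move=> kN; apply: past_measurable (scheme_x_used kN (leqnn k)). Qed.

Lemma measurable_y k : (k <= N)%N -> measurable_fun setT (y_ k).
Proof. by move=> kN; apply: past_measurable (scheme_y_used kN (leqnn _)). Qed.

Lemma independent_x_eps k : (k < N)%N -> independent2 P (x_ k) (eps N k).
Proof.
move=> kN; apply: (@past_independent_eps k) => //.
by apply: scheme_x_used => //; exact: ltnW.
Qed.

Lemma independent_y_zeta k : (k < N)%N -> independent2 P (y_ k.+1) (zeta N k).
Proof.
move=> kN; apply: (@past_independent_zeta (2 * N - k.+1)) => //.
  by rewrite ltn_sub2l// mul2n -addnn ltn_addr.
exact: scheme_y_used.
Qed.

Definition fwd_log_ratio k w := step_log_ratio f b g (t_ k) h (x_ k w) (eps N k w).
Definition bwd_log_ratio k w := step_log_ratio b f g (t_ k) h (y_ k.+1 w) (zeta N k w).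

Lemma fwd_density_ratio k w : (k < N)%N ->
  bwd_kernel b g h k (x_ k w) (x_ k.+1 w) =
  expR (- fwd_log_ratio k w) * fwd_kernel f g h k (x_ k.+1 w) (x_ k w).
Proof.
move=> kN; have gk := g0 (grid_in (ltnW kN)).
by rewrite /bwd_kernel scheme_xS (step_density_ratio _ _ _ _ step_gt0 gk).
Qed.

Lemma bwd_density_ratio k w : (k < N)%N ->
  fwd_kernel f g h k (y_ k.+1 w) (y_ k w) =
  expR (- bwd_log_ratio k w) * bwd_kernel b g h k (y_ k w) (y_ k.+1 w).
Proof.
move=> kN; have gk := g0 (grid_in (ltnW kN)).
by rewrite /fwd_kernel (scheme_yS _ kN) (step_density_ratio _ _ _ _ step_gt0 gk).
Qed.

Lemma grid_variance_gt0 k : (k < N)%N -> 0 < g (t_ k) ^+ 2 * h.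
Proof.
move=> kN; rewrite mulr_gt0 ?step_gt0// exprn_even_gt0//=.
exact: g0 (grid_in (ltnW kN)).
Qed.

Lemma Delta_log_ratios w : Delta T f g p shat x0 eps zeta N w =
  L 0 (y_ 0 w) - L 0 (x_ 0 w) - \sum_(k < N) fwd_log_ratio k w -
  \sum_(k < N) bwd_log_ratio k w.
Proof.
have zT : 0 \in `[0, T] by rewrite in_itv /= lexx ltW.
apply: (@log_MH_ratio_sum _ _ f b g h N (p 0) (fun k => x_ k w) (fun k => y_ k w)
  (fun k => fwd_log_ratio k w) (fun k => bwd_log_ratio k w)) => [|k kN|k kN|k kN].
- by move=> x; exact: p_gt0.
- exact: grid_variance_gt0.
- exact: fwd_density_ratio.
- exact: bwd_density_ratio.
Qed.

End schemes.

(** * Uniform moments *)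

Section moments.
Context (R : realType) (d : nat) d0 (Om : measurableType d0)
  (P : probability Om R).
Implicit Types V : Om -> 'rV[R]_d.

Lemma measurable_enorm V : measurable_fun setT V ->
  measurable_fun setT (fun w => enorm (V w)).
Proof.
move=> mV; apply: (measurableT_comp (f := @Num.sqrt R)).
  apply: continuous_measurable_fun; exact: sqrt_continuous.
apply: measurable_sum => k; apply: measurable_funX.
exact: measurableT_comp (measurable_coord k) mV.
Qed.

(** The exponent is raised to m + 2 because moments are assumed for q >= 2; the factor comes from 1
    + e <= 2 max (1, e). *)
Lemma weight_enorm_bound (x : 'rV[R]_d) m :
  weight x ^+ m <= 2 ^+ m.+2 * (1 + enorm x ^+ m.+2).
Proof.
have e0 : 0 <= enorm x by exact: sqrtr_ge0.
have w1 : weight x <= 1 + enorm x by rewrite lerD2l le_enorm.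
apply: (le_trans (weight_leX x (leq_addr 2 m))); rewrite addn2.
apply: (@le_trans _ _ ((1 + enorm x) ^+ m.+2)).
  by rewrite lerXn2r ?nnegrE ?weight_ge0 ?addr_ge0.
have [e1|e1] := lerP (enorm x) 1.
  apply: (@le_trans _ _ (2 ^+ m.+2)).
    by rewrite lerXn2r ?nnegrE ?addr_ge0// -[2]/(1 + 1) lerD2l.
  by rewrite ler_peMr ?exprn_ge0// lerDl exprn_ge0.
apply: (@le_trans _ _ ((2 * enorm x) ^+ m.+2)).
  rewrite lerXn2r ?nnegrE ?addr_ge0 ?mulr_ge0//.
  by rewrite mulr_natl mulr2n lerD2r ltW.
by rewrite exprMn ler_wpM2l ?exprn_ge0// lerDr.
Qed.

Lemma Lq_norm_weight V m (C : R) : measurable_fun setT V ->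
  (Lq_norm P m.+2%:R V <= C%:E)%E ->
  rintegrable P (fun w => weight (V w) ^+ m) /\
  \int[P]_w (weight (V w) ^+ m) <= 2 ^+ m.+2 * (1 + C ^+ m.+2).
Proof.
move=> mV VC; have mE := measurable_enorm mV.
have e0 w : 0 <= enorm (V w) by exact: sqrtr_ge0.
have C0 : 0 <= C by rewrite -lee_fin (le_trans (Lnorm_ge0 _ _ _) VC).
have mw : measurable_fun setT (fun w => weight (V w) ^+ m).
  exact: measurableT_comp (measurable_weight m) mV.
have mX : measurable_fun setT (fun w => enorm (V w) ^+ m.+2) by exact: measurable_funX.
have HI : (\int[P]_w (enorm (V w) ^+ m.+2)%:E <= (C ^+ m.+2)%:E)%E.
  have q0 : (m.+2%:R : R) != 0 by rewrite pnatr_eq0.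
  have <- : (\int[P]_w `| (enorm (V w))%:E | `^ m.+2%:R = \int[P]_w (enorm (V w) ^+ m.+2)%:E)%E.
    by apply: eq_integral => w _; rewrite abse_EFin ger0_norm// poweR_EFin powR_mulrn.
  rewrite -poweR_Lnorm//.
  have -> : (C ^+ m.+2)%:E = (C%:E `^ m.+2%:R)%E by rewrite poweR_EFin powR_mulrn.
  apply: gt0_ler_poweR => //; rewrite ?ler0n//.
    by rewrite in_itv /= Lnorm_ge0 leey.
  by rewrite in_itv /= lee_fin C0 leey.
have iX : rintegrable P (fun w => enorm (V w) ^+ m.+2).
  apply/integrableP; split; first exact/measurable_EFinP.
  apply: le_lt_trans (ltry (C ^+ m.+2)); apply: le_trans HI.
  rewrite le_eqVlt; apply/orP; left; apply/eqP.
  by apply: eq_integral => w _ /=; rewrite ger0_norm ?exprn_ge0.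
have iB : rintegrable P (fun w => 2 ^+ m.+2 * (1 + enorm (V w) ^+ m.+2)).
  apply: rintegrableZ; apply: rintegrableD => //.
  exact: finite_measure_integrable_cst.
have bw w : `|weight (V w) ^+ m| <= 2 ^+ m.+2 * (1 + enorm (V w) ^+ m.+2).
  by rewrite ger0_norm ?weightX_ge0// weight_enorm_bound.
split; first exact: rintegrable_le mw bw iB.
apply: (le_trans (ler_norm _)); apply: (le_trans (Rintegral_norm_le mw iB bw)).
have i1 : rintegrable P (fun=> 1) by exact: finite_measure_integrable_cst.
rewrite RintegralZl//; last exact: rintegrableD.
rewrite ler_wpM2l ?exprn_ge0// RintegralD// gauss_mean0 lerD2l.
by rewrite -lee_fin -RintegralE.
Qed.

Definition weight_moments (I : Type) (ok : I -> Prop) (Z : I -> Om -> 'rV[R]_d) :=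
  forall m, exists K : R, 0 <= K /\ forall i, ok i ->
    rintegrable P (fun w => weight (Z i w) ^+ m) /\
    \int[P]_w (weight (Z i w) ^+ m) <= K.

Lemma Lq_weight_moments (I : Type) (ok : I -> Prop) (Z : I -> Om -> 'rV[R]_d) :
  (forall i, ok i -> measurable_fun setT (Z i)) ->
  (forall q : R, 2 <= q -> exists C : R, forall i, ok i ->
     (Lq_norm P q (Z i) <= C%:E)%E) ->
  weight_moments ok Z.
Proof.
move=> mZ HZ m; have [|C HC] := HZ m.+2%:R; first by rewrite ler_nat.
exists (2 ^+ m.+2 * (1 + `|C| ^+ m.+2)); split.
  by rewrite mulr_ge0 ?exprn_ge0 ?addr_ge0 ?exprn_ge0.
move=> i ki; apply: Lq_norm_weight; first exact: mZ.
by apply: (le_trans (HC i ki)); rewrite lee_fin ler_norm.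
Qed.

Lemma weight_moments_comp (I J : Type) (ok : I -> Prop) (ok' : J -> Prop)
    (k : J -> I) Z : (forall j, ok' j -> ok (k j)) ->
  weight_moments ok Z -> weight_moments ok' (fun j => Z (k j)).
Proof.
move=> kok HZ m; have [K [K0 H]] := HZ m.
by exists K; split => // j /kok; exact: H.
Qed.

Lemma rintegrable_growth V (F : 'rV[R]_d -> R) (C : R) m :
  measurable_fun setT F -> measurable_fun setT V ->
  (forall x, `|F x| <= C * weight x ^+ m) ->
  rintegrable P (fun w => weight (V w) ^+ m) ->
  rintegrable P (fun w => F (V w)) /\
  `|\int[P]_w F (V w)| <= C * \int[P]_w (weight (V w) ^+ m).
Proof.
move=> mF mV FC iV.
have mFV : measurable_fun setT (fun w => F (V w)) by exact: measurableT_comp.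
have FV w : `|F (V w)| <= C * weight (V w) ^+ m by [].
have iCV := rintegrableZ C iV.
split; first exact: rintegrable_le mFV FV iCV.
by rewrite (le_trans (Rintegral_norm_le mFV iCV FV))// RintegralZl.
Qed.

Lemma rintegrable_growth_moments (I : Type) (ok : I -> Prop) Z T u r s :
  (forall i, ok i -> measurable_fun setT (Z i)) -> weight_moments ok Z ->
  classC r s T u ->
  exists K, 0 <= K /\ forall t i, t \in `[0, T] -> ok i ->
    rintegrable P (fun w => u t (Z i w)) /\ `|\int[P]_w u t (Z i w)| <= K.
Proof.
move=> mZ HZ cu; have [C [m [C0 uC]]] := classC_poly_growth cu.
have [K [K0 HK]] := HZ m; exists (C * K); split; first exact: mulr_ge0.
move=> t i tT ki; have [i1 i2] := HK i ki.
have [j1 j2] := rintegrable_growth (measurable_classC cu tT) (mZ i ki) (fun x => uC t x tT) i1.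
by split => //; apply: (le_trans j2); exact: ler_wpM2l.
Qed.

End moments.

(** * Mean losses along a chain *)

Section loss_steps.
Context (R : realType) (d : nat) (T : R) d0 (Om : measurableType d0)
  (P : probability Om R).
Variables (f : R -> 'rV[R]_d -> 'rV[R]_d) (g : R -> R)
  (p : R -> 'rV[R]_d -> R) (shat : R -> 'rV[R]_d -> 'rV[R]_d) (gm gM : R).
Hypotheses (p_gt0 : forall t x, t \in `[0, T] -> 0 < p t x)
  (fokker_planck : forall t x, t \in `]0, T[ ->
     is_derive t 1 (fun t' => p t' x)
       (- divergence (fun z => p t z *: f t z) x +
        2^-1 * laplacian (fun z => g t ^+ 2 * p t z) x))
  (gm0 : 0 < gm) (hg : forall t, t \in `[0, T] -> gm <= `|g t| <= gM)
  (cg : C1_time T g) (cf : classC_vec 1 3 T f) (cL : classC 2 4 T (logdens p))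
  (cD : classC_vec 1 3 T (score_error p shat)).
Local Notation L := (logdens p).
Local Notation b := (reverse_drift f g shat).

Lemma diffusion_coef_neq0 t : t \in `[0, T] -> g t != 0.
Proof. by move=> /hg/andP[h _]; rewrite -normr_gt0 (lt_le_trans gm0). Qed.

Lemma classC_vec0 (a : R -> 'rV[R]_d -> 'rV[R]_d) : classC_vec 1 3 T a -> classC_vec 0 3 T a.
Proof. by move=> ca k; apply: classC_le (ca k). Qed.

Let cf0 : classC_vec 0 3 T f := classC_vec0 cf.
Let cb0 : classC_vec 0 3 T b := classC_vec0 (reverse_drift_classC cg cf cL cD).
Let cL0 : classC 0 4 T L := classC_le (leq0n 2) (leqnn 4) cL.
Let cfp : classC 1 2 T (fp_rhs f g p) := fp_rhs_classC cg cf cL.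
Let cfp0 : classC 0 2 T (fp_rhs f g p) := classC_le (leq0n 1) (leqnn 2) cfp.

(** An abstract family of steps from U to V with noise e, of which both chains are instances. The
    earlier time is t in either case, so a backward step starts at time t + h. *)
Variables (I : Type) (ok : I -> Prop) (t h : I -> R) (U V e : I -> Om -> 'rV[R]_d).
Hypotheses (tT : forall i, ok i -> t i \in `[0, T])
  (hT : forall i, ok i -> 0 <= h i <= T)
  (t'T : forall i, ok i -> t i + h i \in `[0, T])
  (mU : forall i, ok i -> measurable_fun setT (U i))
  (he : forall i, ok i -> has_density P (e i) (gauss_pdf 0 1))
  (Ue : forall i, ok i -> independent2 P (U i) (e i))
  (wU : weight_moments P ok U) (wV : weight_moments P ok V).

Section moves.
Variable (a : R -> 'rV[R]_d -> 'rV[R]_d).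
Hypotheses (ca : classC_vec 0 3 T a)
  (VE : forall i w, ok i -> V i w = step_move a g (t i) (h i) (U i w) (e i w)).

Lemma measurable_move i : ok i -> measurable_fun setT (V i).
Proof.
move=> ki; rewrite (_ : V i = fun w => step_move a g (t i) (h i) (U i w) (e i w)).
  apply: (measurable_step_move g ca _ (tT ki)); first exact: mU.
  by case: (he ki).
by apply/funext => w; exact: VE.
Qed.

Lemma value_step u : classC 0 2 T u -> exists K, 0 <= K /\ forall i, ok i ->
  [/\ rintegrable P (fun w => u (t i) (V i w)), rintegrable P (fun w => u (t i) (U i w)) &
  `|\int[P]_w u (t i) (V i w) - \int[P]_w u (t i) (U i w)| <= K * h i].
Proof.
move=> cu; have [C [m [C0 H]]] := step_value_independent P ca hg cu.
have [K [K0 HK]] := wU m; exists (C * K); split; first exact: mulr_ge0.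
move=> i ki; have [i1 i2] := HK i ki.
have [h1 h2 h3] := H _ _ _ _ (tT ki) (hT ki) (mU ki) (he ki) (Ue ki) i1.
have -> : (fun w => u (t i) (V i w)) =
    (fun w => u (t i) (step_move a g (t i) (h i) (U i w) (e i w))).
  by apply/funext => w; rewrite VE.
split => //; apply: (le_trans h3); rewrite expr1 mulrAC.
apply: ler_wpM2r; first by have /andP[] := hT ki.
exact: ler_wpM2l.
Qed.

Lemma loss_step a' : classC_vec 0 3 T a' -> exists K, 0 <= K /\ forall i, ok i ->
  [/\ rintegrable P (fun w => step_loss L a a' g (t i) (h i) (U i w) (e i w)),
      rintegrable P (fun w => h i * step_gen L a a' g (t i) (U i w)) &
  `|\int[P]_w step_loss L a a' g (t i) (h i) (U i w) (e i w) -
    \int[P]_w (h i * step_gen L a a' g (t i) (U i w))| <= K * h i ^+ 2].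
Proof.
move=> ca'; have [C [m [C0 H]]] := step_loss_independent P ca ca' gm0 hg cL0.
have [K [K0 HK]] := wU m; exists (C * K); split; first exact: mulr_ge0.
move=> i ki; have [i1 i2] := HK i ki.
have [h1 h2 h3] := H _ _ _ _ (tT ki) (hT ki) (mU ki) (he ki) (Ue ki) i1.
split => //; apply: (le_trans h3); rewrite mulrAC.
have /andP[h0 _] := hT ki.
by apply: ler_wpM2r; [exact: exprn_ge0|exact: ler_wpM2l].
Qed.

End moves.

(** Z will be the endpoint of a forward step and the start of a backward one. *)
Lemma time_step (Z : I -> Om -> 'rV[R]_d) :
  (forall i, ok i -> measurable_fun setT (Z i)) -> weight_moments P ok Z ->
  exists K, 0 <= K /\ forall i, ok i ->
  [/\ rintegrable P (fun w => L (t i + h i) (Z i w) - L (t i) (Z i w)),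
      rintegrable P (fun w => fp_rhs f g p (t i) (Z i w)) &
  `|\int[P]_w (L (t i + h i) (Z i w) - L (t i) (Z i w)) -
    h i * \int[P]_w fp_rhs f g p (t i) (Z i w)| <= K * h i ^+ 2].
Proof.
move=> mZ wZ; have [C [m [C0 H]]] := logdens_time_taylor p_gt0 fokker_planck cg cf cL.
have [K [K0 HK]] := wZ m.
have [KL [_ HL]] := rintegrable_growth_moments mZ wZ cL.
have [Kf [_ Hf]] := rintegrable_growth_moments mZ wZ cfp.
exists (C * K); split; first exact: mulr_ge0.
move=> i ki; have [i1 i2] := HK i ki; have /andP[h0 _] := hT ki.
have [L1 _] := HL _ _ (tT ki) ki; have [L2 _] := HL _ _ (t'T ki) ki.
have [f1 _] := Hf _ _ (tT ki) ki.
have iB := rintegrableB L2 L1; have iZ := rintegrableZ (h i) f1.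
split => //; rewrite -RintegralZl// -RintegralB//.
have bd w : `|L (t i + h i) (Z i w) - L (t i) (Z i w) - h i * fp_rhs f g p (t i) (Z i w)|
    <= C * h i ^+ 2 * weight (Z i w) ^+ m.
  have := H (t i) (t i + h i) (Z i w) (tT ki) (t'T ki).
  by rewrite lerDl [t i + h i - t i]addrAC subrr add0r => /(_ h0).
have mB := rintegrable_measurable (rintegrableB iB iZ).
apply: (le_trans (Rintegral_norm_le mB (rintegrableZ _ i1) bd)).
rewrite RintegralZl// mulrAC; apply: ler_wpM2r; first exact: exprn_ge0.
exact: ler_wpM2l.
Qed.

(** The move is made at time t and the change of time at its endpoint V. The Fokker-Planck term
    found there is brought back to U at the cost O(h), on a term that carries a factor h. *)
Lemma fwd_loss_step :
  (forall i w, ok i -> V i w = step_move f g (t i) (h i) (U i w) (e i w)) ->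
  exists K, 0 <= K /\ forall i, ok i ->
  rintegrable P (fun w => L (t i + h i) (V i w) - L (t i) (U i w) -
    step_log_ratio f b g (t i) (h i) (U i w) (e i w)) /\
  `|\int[P]_w (L (t i + h i) (V i w) - L (t i) (U i w) -
    step_log_ratio f b g (t i) (h i) (U i w) (e i w)) +
    h i * \int[P]_w fwd_loss g p shat (t i) (U i w)| <= K * h i ^+ 2.
Proof.
move=> VE; have mV := measurable_move cf0 VE.
have [K1 [K10 H1]] := loss_step cf0 cb0.
have [K2 [K20 H2]] := time_step mV wV.
have [K3 [K30 H3]] := value_step cf0 VE cfp0.
exists (K1 + K2 + K3); split; first by rewrite !addr_ge0.
move=> i ki; have /andP[h0 _] := hT ki.
have [i1 i1' b1] := H1 i ki; have [i2 i2' b2] := H2 i ki.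
have [_ i3 b3] := H3 i ki.
have E w : L (t i + h i) (V i w) - L (t i) (U i w) -
    step_log_ratio f b g (t i) (h i) (U i w) (e i w) =
    step_loss L f b g (t i) (h i) (U i w) (e i w) +
    (L (t i + h i) (V i w) - L (t i) (V i w)).
  by rewrite /step_loss -VE//; ring.
have -> : (fun w => L (t i + h i) (V i w) - L (t i) (U i w) -
    step_log_ratio f b g (t i) (h i) (U i w) (e i w)) = (fun w =>
    step_loss L f b g (t i) (h i) (U i w) (e i w) +
    (L (t i + h i) (V i w) - L (t i) (V i w))) by exact/funext.
split; first exact: rintegrableD.
have iw : \int[P]_w (h i * step_gen L f b g (t i) (U i w)) +
    h i * \int[P]_w fp_rhs f g p (t i) (U i w) =
    - (h i * \int[P]_w fwd_loss g p shat (t i) (U i w)).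
  rewrite -RintegralZl// -RintegralD//; last exact: rintegrableZ.
  have [Kw [_ Hw]] := rintegrable_growth_moments mU wU (fwd_loss_classC cg cL cD).
  have [iw _] := Hw _ _ (tT ki) ki.
  rewrite -mulNr -RintegralZl//; apply: eq_Rintegral => w _.
  by rewrite -mulrDr (fwd_drift_identity diffusion_coef_neq0 cf cL cD _ (tT ki)) mulrN mulNr.
rewrite RintegralD// -[X in _ + X]opprK -iw.
(* Three errors: expansion of the loss, expansion in time at V, exchange of V for U. *)
have E3 (A1 A2 A3 A4 A5 : R) : A1 + A2 - (A3 + h i * A5) =
    (A1 - A3) + (A2 - h i * A4) + h i * (A4 - A5) by ring.
rewrite (E3 _ _ _ (\int[P]_w fp_rhs f g p (t i) (V i w))).
rewrite !mulrDl; apply: (le_trans (ler_normD _ _)); apply: lerD.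
  by apply: (le_trans (ler_normD _ _)); exact: lerD.
by rewrite normrM (ger0_norm h0) expr2 mulrCA ler_wpM2l.
Qed.

(** The later time is that of the starting point U, so the change of time is made there, before the
    move, and nothing has to be brought back. *)
Lemma bwd_loss_step :
  (forall i w, ok i -> V i w = step_move b g (t i) (h i) (U i w) (e i w)) ->
  exists K, 0 <= K /\ forall i, ok i ->
  rintegrable P (fun w => L (t i) (V i w) - L (t i + h i) (U i w) -
    step_log_ratio b f g (t i) (h i) (U i w) (e i w)) /\
  `|\int[P]_w (L (t i) (V i w) - L (t i + h i) (U i w) -
    step_log_ratio b f g (t i) (h i) (U i w) (e i w)) +
    h i * \int[P]_w bwd_loss g p shat (t i) (U i w)| <= K * h i ^+ 2.
Proof.
move=> VE.
have [K1 [K10 H1]] := loss_step cb0 cf0.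
have [K2 [K20 H2]] := time_step mU wU.
exists (K1 + K2); split; first by rewrite !addr_ge0.
move=> i ki; have /andP[h0 _] := hT ki.
have [i1 i1' b1] := H1 i ki; have [i2 i2' b2] := H2 i ki.
have E w : L (t i) (V i w) - L (t i + h i) (U i w) -
    step_log_ratio b f g (t i) (h i) (U i w) (e i w) =
    step_loss L b f g (t i) (h i) (U i w) (e i w) -
    (L (t i + h i) (U i w) - L (t i) (U i w)).
  by rewrite /step_loss -VE//; ring.
have -> : (fun w => L (t i) (V i w) - L (t i + h i) (U i w) -
    step_log_ratio b f g (t i) (h i) (U i w) (e i w)) = (fun w =>
    step_loss L b f g (t i) (h i) (U i w) (e i w) -
    (L (t i + h i) (U i w) - L (t i) (U i w))) by exact/funext.
split; first exact: rintegrableB.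
have iw : \int[P]_w (h i * step_gen L b f g (t i) (U i w)) -
    h i * \int[P]_w fp_rhs f g p (t i) (U i w) =
    - (h i * \int[P]_w bwd_loss g p shat (t i) (U i w)).
  rewrite -RintegralZl// -RintegralB//; last exact: rintegrableZ.
  have [Kw [_ Hw]] := rintegrable_growth_moments mU wU (bwd_loss_classC cg cD).
  have [iw _] := Hw _ _ (tT ki) ki.
  rewrite -mulNr -RintegralZl//; apply: eq_Rintegral => w _.
  by rewrite -mulrBr (bwd_drift_identity _ _ _ diffusion_coef_neq0 _ (tT ki)) mulrN mulNr.
rewrite RintegralB// -[X in _ + X]opprK -iw.
have E3 (A1 A2 A3 A4 : R) : A1 - A2 - (A3 - h i * A4) =
    (A1 - A3) - (A2 - h i * A4) by ring.
by rewrite E3 mulrDl; apply: (le_trans (ler_normB _ _)); exact: lerD.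
Qed.

End loss_steps.

(** The backward chain starts where the forward chain ends, so going up along one and down along the
    other leaves only the two values at index 0. *)
Lemma telescope_two_way (R : realType) (A B JX JY : nat -> R) N : A N = B N ->
  B 0%N - A 0%N - \sum_(k < N) JX k - \sum_(k < N) JY k =
  \sum_(k < N) ((A k.+1 - A k - JX k) + (B k - B k.+1 - JY k)).
Proof.
move=> E; rewrite big_split /= !sumrB.
have EA : \sum_(k < N) A k.+1 - \sum_(k < N) A k = A N - A 0%N.
  by rewrite -sumrB -(big_mkord xpredT (fun k => A k.+1 - A k)) telescope_sumr.
have EB : \sum_(k < N) B k - \sum_(k < N) B k.+1 = B 0%N - B N.
  rewrite -[LHS]opprB -sumrB -(big_mkord xpredT (fun k => B k.+1 - B k)).
  by rewrite telescope_sumr// opprB.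
by rewrite EA EB E; ring.
Qed.

Section Delta_mean.
Context (R : realType) (d : nat) (T : R) d0 (Om : measurableType d0)
  (P : probability Om R).
Variables (f : R -> 'rV[R]_d -> 'rV[R]_d) (g : R -> R)
  (p : R -> 'rV[R]_d -> R) (shat : R -> 'rV[R]_d -> 'rV[R]_d) (gm gM h0 : R)
  (x0 : nat -> Om -> 'rV[R]_d) (eps zeta : nat -> nat -> Om -> 'rV[R]_d).
Hypotheses (T_gt0 : 0 < T)
  (noise : forall N, (0 < N)%N -> euler_noise P (p 0) N (x0 N) (eps N) (zeta N))
  (p_gt0 : forall t x, t \in `[0, T] -> 0 < p t x)
  (fokker_planck : forall t x, t \in `]0, T[ ->
     is_derive t 1 (fun t' => p t' x)
       (- divergence (fun z => p t z *: f t z) x +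
        2^-1 * laplacian (fun z => g t ^+ 2 * p t z) x))
  (gm0 : 0 < gm) (hg : forall t, t \in `[0, T] -> gm <= `|g t| <= gM)
  (cg : C1_time T g) (cf : classC_vec 1 3 T f) (cL : classC 2 4 T (logdens p))
  (cD : classC_vec 1 3 T (score_error p shat)).
Local Notation L := (logdens p).
Local Notation b := (reverse_drift f g shat).
Local Notation h := (step T).
Local Notation t_ N := (grid (step T N)).
Local Notation x_ := (scheme_x T f g x0 eps).
Local Notation y_ := (scheme_y T f g x0 eps zeta shat).

(** N + 1 nodes but N steps, hence two index sets; both are limited to h <= h0, where moments are
    controlled. *)
Definition grid_ok (i : nat * nat) := [/\ (0 < i.1)%N, h i.1 <= h0 & (i.2 <= i.1)%N].
Definition step_idx (i : nat * nat) := [/\ (0 < i.1)%N, h i.1 <= h0 & (i.2 < i.1)%N].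

Hypotheses (mx : weight_moments P grid_ok (fun i => x_ i.1 i.2))
  (my : weight_moments P grid_ok (fun i => y_ i.1 i.2)).

Let cf0 : classC_vec 0 3 T f := classC_vec0 cf.
Let cb0 : classC_vec 0 3 T b := classC_vec0 (reverse_drift_classC cg cf cL cD).

Lemma gridS (c : R) k : grid c k.+1 = grid c k + c.
Proof. by rewrite /grid -natr1 mulrDl mul1r. Qed.

Let tT i : step_idx i -> t_ i.1 i.2 \in `[0, T].
Proof. by case=> N0 _ kN; apply: grid_in => //; exact: ltnW. Qed.

Let hT i : step_idx i -> 0 <= h i.1 <= T.
Proof. by case=> N0 _ _; exact: step_in. Qed.

Let t'T i : step_idx i -> t_ i.1 i.2 + h i.1 \in `[0, T].
Proof. by case=> N0 _ kN; rewrite -gridS; exact: grid_in. Qed.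

Let mxi i : step_idx i -> measurable_fun setT (x_ i.1 i.2).
Proof.
case=> N0 _ kN.
exact: (measurable_x g T_gt0 N0 (noise N0) cf0 (ltnW kN)).
Qed.

Let myi i : step_idx i -> measurable_fun setT (y_ i.1 i.2.+1).
Proof.
by case=> N0 _ kN; exact: (measurable_y T_gt0 N0 (noise N0) cf0 cb0 kN).
Qed.

Let hei i : step_idx i -> has_density P (eps i.1 i.2) (gauss_pdf 0 1).
Proof. by case=> N0 _ kN; have [_ H _ _] := noise N0; exact: H. Qed.

Let hzi i : step_idx i -> has_density P (zeta i.1 i.2) (gauss_pdf 0 1).
Proof. by case=> N0 _ kN; have [_ _ H _] := noise N0; exact: H. Qed.

Let ixi i : step_idx i -> independent2 P (x_ i.1 i.2) (eps i.1 i.2).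
Proof.
case=> N0 _ kN A B mA mB.
exact: (independent_x_eps g T_gt0 N0 (noise N0) cf0 kN mA mB).
Qed.

Let iyi i : step_idx i -> independent2 P (y_ i.1 i.2.+1) (zeta i.1 i.2).
Proof.
case=> N0 _ kN A B mA mB.
exact: (independent_y_zeta T_gt0 N0 (noise N0) cf0 cb0 kN mA mB).
Qed.

Let wx : weight_moments P step_idx (fun i => x_ i.1 i.2).
Proof.
by apply: (@weight_moments_comp _ _ _ _ _ _ _ _ _ (fun i : nat * nat => i) _ _ mx) => i [h1 h2 /ltnW h3].
Qed.

Let wxS : weight_moments P step_idx (fun i => x_ i.1 i.2.+1).
Proof.
by apply: (@weight_moments_comp _ _ _ _ _ _ _ _ _ (fun i : nat * nat => (i.1, i.2.+1)) _ _ mx) => i [].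
Qed.

Let wy : weight_moments P step_idx (fun i => y_ i.1 i.2).
Proof.
by apply: (@weight_moments_comp _ _ _ _ _ _ _ _ _ (fun i : nat * nat => i) _ _ my) => i [h1 h2 /ltnW h3].
Qed.

Let wyS : weight_moments P step_idx (fun i => y_ i.1 i.2.+1).
Proof.
by apply: (@weight_moments_comp _ _ _ _ _ _ _ _ _ (fun i : nat * nat => (i.1, i.2.+1)) _ _ my) => i [].
Qed.

Lemma value_step_x u : classC 0 2 T u -> exists K, 0 <= K /\ forall N k,
  (0 < N)%N -> h N <= h0 -> (k < N)%N ->
  `|\int[P]_w u (t_ N k) (x_ N k.+1 w) - \int[P]_w u (t_ N k) (x_ N k w)| <= K * h N.
Proof.
move=> cu; have [K [K0 H]] := value_step hg tT hT mxi hei ixi wx cf0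
  (fun i w _ => erefl (x_ i.1 i.2.+1 w)) cu.
by exists K; split => // N k N0 hN kN; have [] := H (N, k) (And3 N0 hN kN).
Qed.

Lemma value_step_y u : classC 0 2 T u -> exists K, 0 <= K /\ forall N k,
  (0 < N)%N -> h N <= h0 -> (k < N)%N ->
  `|\int[P]_w u (t_ N k) (y_ N k w) - \int[P]_w u (t_ N k) (y_ N k.+1 w)| <= K * h N.
Proof.
move=> cu.
have VE i w : step_idx i -> y_ i.1 i.2 w = step_move b g (t_ i.1 i.2) (h i.1)
    (y_ i.1 i.2.+1 w) (zeta i.1 i.2 w).
  by case=> _ _ kN; exact: scheme_yS.
have [K [K0 H]] := value_step hg tT hT myi hzi iyi wyS cb0 VE cu.
by exists K; split => // N k N0 hN kN; have [] := H (N, k) (And3 N0 hN kN).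
Qed.

Lemma Delta_steps N w : (0 < N)%N -> Delta T f g p shat x0 eps zeta N w =
  \sum_(k < N) ((L (t_ N k + h N) (x_ N k.+1 w) - L (t_ N k) (x_ N k w) -
      step_log_ratio f b g (t_ N k) (h N) (x_ N k w) (eps N k w)) +
    (L (t_ N k) (y_ N k w) - L (t_ N k + h N) (y_ N k.+1 w) -
      step_log_ratio b f g (t_ N k) (h N) (y_ N k.+1 w) (zeta N k w))).
Proof.
move=> N0; have g0 t : t \in `[0, T] -> g t != 0 := diffusion_coef_neq0 gm0 hg (t := t).
rewrite (Delta_log_ratios _ _ _ _ _ T_gt0 N0 p_gt0 g0).
pose A k := L (t_ N k) (x_ N k w); pose B k := L (t_ N k) (y_ N k w).
have t0 : t_ N 0 = 0 by rewrite /grid mul0r.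
have E : A N = B N by rewrite /A /B scheme_yN.
have EA : L 0 (x_ N 0 w) = A 0%N by rewrite /A t0.
have EB : L 0 (y_ N 0 w) = B 0%N by rewrite /B t0.
rewrite EA EB.
apply: (etrans (telescope_two_way (fun k => fwd_log_ratio T f g shat x0 eps N k w)
  (fun k => bwd_log_ratio T f g shat x0 eps zeta N k w) E)).
apply: eq_bigr => k _.
by rewrite /A /B gridS.
Qed.

(** The N errors of order h^2 add up to (K1 + K2) T h, as N h = T. Backward losses sit at y_(k+1)
    but at time t_k, where the scheme evaluates its coefficients. *)
Lemma Delta_mean : exists K, 0 <= K /\ forall N, (0 < N)%N -> h N <= h0 ->
  rintegrable P (Delta T f g p shat x0 eps zeta N) /\
  `|\int[P]_w Delta T f g p shat x0 eps zeta N w +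
    h N * \sum_(k < N) (\int[P]_w fwd_loss g p shat (t_ N k) (x_ N k w) +
      \int[P]_w bwd_loss g p shat (t_ N k) (y_ N k.+1 w))| <= K * h N.
Proof.
have [K1 [K10 H1]] := fwd_loss_step p_gt0 fokker_planck gm0 hg cg cf cL cD tT hT t'T
  mxi hei ixi wx wxS (fun i w _ => erefl (x_ i.1 i.2.+1 w)).
have VE i w : step_idx i -> y_ i.1 i.2 w = step_move b g (t_ i.1 i.2) (h i.1)
    (y_ i.1 i.2.+1 w) (zeta i.1 i.2 w).
  by case=> _ _ kN; exact: scheme_yS.
have [K2 [K20 H2]] := bwd_loss_step p_gt0 fokker_planck gm0 hg cg cf cL cD tT hT t'T
  myi hzi iyi wyS VE.
exists ((K1 + K2) * T); split; first by rewrite !mulr_ge0 ?addr_ge0// ltW.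
move=> N N0 hN.
pose F (k : 'I_N) w := L (t_ N k + h N) (x_ N k.+1 w) - L (t_ N k) (x_ N k w) -
      step_log_ratio f b g (t_ N k) (h N) (x_ N k w) (eps N k w).
pose G (k : 'I_N) w := L (t_ N k) (y_ N k w) - L (t_ N k + h N) (y_ N k.+1 w) -
      step_log_ratio b f g (t_ N k) (h N) (y_ N k.+1 w) (zeta N k w).
have DE : Delta T f g p shat x0 eps zeta N = (fun w => \sum_(k < N) (F k w + G k w)).
  by apply/funext => w; exact: Delta_steps.
have HF (k : 'I_N) := H1 (N, nat_of_ord k) (And3 N0 hN (ltn_ord k)).
have HG (k : 'I_N) := H2 (N, nat_of_ord k) (And3 N0 hN (ltn_ord k)).
have iF k : rintegrable P (F k) := (HF k).1.
have iG k : rintegrable P (G k) := (HG k).1.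
have bF k : `|\int[P]_w F k w + h N * \int[P]_w fwd_loss g p shat (t_ N k) (x_ N k w)|
    <= K1 * h N ^+ 2 := (HF k).2.
have bG k : `|\int[P]_w G k w + h N * \int[P]_w bwd_loss g p shat (t_ N k) (y_ N k.+1 w)|
    <= K2 * h N ^+ 2 := (HG k).2.
have iFG k : rintegrable P (fun w => F k w + G k w) := rintegrableD (iF k) (iG k).
rewrite DE; split; first by apply: rintegrable_sum => k _; exact: iFG.
rewrite Rintegral_sum => [|k _]; last exact: iFG.
rewrite mulr_sumr -big_split /= (le_trans (ler_norm_sum _ _ _))//.
have -> : (K1 + K2) * T * h N = \sum_(k < N) (K1 + K2) * h N ^+ 2.
  have hT' : h N * N%:R = T by rewrite /step divfK// pnatr_eq0 -lt0n.
  by rewrite sumr_const card_ord -mulr_natr -{1}hT'; ring.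
apply: ler_sum => k _; rewrite RintegralD//; [|exact: iF|exact: iG].
rewrite mulrDr addrACA mulrDl; apply: (le_trans (ler_normD _ _)).
by apply: lerD; [exact: bF|exact: bG].
Qed.

End Delta_mean.

(** * The score-error energy along the diffusions *)

Section stein.
Context (R : realType) (d : nat) (T : R) d0 (Om : measurableType d0)
  (P : probability Om R).
Variables (g : R -> R) (p : R -> 'rV[R]_d -> R)
  (shat : R -> 'rV[R]_d -> 'rV[R]_d) (X : R -> Om -> 'rV[R]_d).
Hypotheses (p_gt0 : forall t x, t \in `[0, T] -> 0 < p t x)
  (cg : C1_time T g) (cL : classC 2 4 T (logdens p))
  (X_dens : forall t, t \in `[0, T] -> has_density P (X t) (p t))
  (wX : weight_moments P (fun t => t \in `[0, T]) X).

Let mX t : t \in `[0, T] -> measurable_fun setT (X t).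
Proof. by move=> /X_dens[]. Qed.

(** Multiplied by p, the integrand is the partial derivative of v p, because the gradient of p is p
    s. *)
Lemma stein (v : R -> 'rV[R]_d -> R) k t : classC 0 1 T v -> t \in `[0, T] ->
  \int[P]_w ('D_(basis_vec k) (v t) (X t w) + score p t (X t w) 0 k * v t (X t w)) = 0.
Proof.
move=> cv tT; have Xp := X_dens tT.
pose G x := 'D_(basis_vec k) (v t) x + score p t x 0 k * v t x.
have cs : classC 0 0 T (fun t x => score p t x 0 k).
  exact: classC_le (leq0n 2) (leq0n 3) (score_classC cL k).
have cv0 : classC 0 0 T v := classC_le (leqnn 0) (leq0n 1) cv.
have cG : classC 0 0 T (fun t x => 'D_(basis_vec k) (v t) x + score p t x 0 k * v t x).
  exact: classCD (classC_partial k cv) (classCM cs cv0).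
have [K [_ HG]] := rintegrable_growth_moments mX wX cG.
have [K' [_ HV]] := rintegrable_growth_moments mX wX cv0.
have [iG _] := HG t t tT tT; have [iV _] := HV t t tT tT.
have mG : measurable_fun setT G := measurable_classC cG tT.
have mV : measurable_fun setT (v t) := measurable_classC cv0 tT.
rewrite (Rintegral_has_density Xp mG iG).
have cp : continuous (p t).
  rewrite (_ : p t = fun x => expR (logdens p t x)).
    move=> x; apply: continuous_comp; last exact: continuous_expR.
    exact: (classC_continuous cL tT).
  by apply/funext => x; rewrite (densityE p_gt0 _ tT).
apply: (@integral_partial_eq0 _ _ k (fun x => v t x * p t x) (fun x => G x * p t x)).
- move=> x; have := is_derive_mulf (is_derive_classC k x cv tT)
    (is_derive_density p_gt0 cL x k tT).
  by congr is_derive; rewrite /G; ring.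
- move=> x; apply: continuousM; last exact: cp.
  exact: (classC_continuous cG tT).
- exact: (integrable_has_density Xp mV).1 iV.
- exact: (integrable_has_density Xp mG).1 iG.
Qed.

Hypothesis cD : classC_vec 1 3 T (score_error p shat).

(** The terms of div delta + <s, delta> have mean zero under p_t, one coordinate of delta at a
    time. *)
Lemma fwd_loss_mean t : t \in `[0, T] ->
  \int[P]_w fwd_loss g p shat t (X t w) = \int[P]_w bwd_loss g p shat t (X t w).
Proof.
move=> tT; pose dl k t x := score_error p shat t x 0 k.
have cd k : classC 0 1 T (dl k) := classC_le (leq0n 1) (isT : (1 <= 3)%N) (cD k).
pose S k w := 'D_(basis_vec k) (dl k t) (X t w) + score p t (X t w) 0 k * dl k t (X t w).
have iS k : rintegrable P (S k).
  have cs : classC 0 0 T (fun t x => score p t x 0 k).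
    exact: classC_le (leq0n 2) (leq0n 3) (score_classC cL k).
  have cG : classC 0 0 T (fun t x => 'D_(basis_vec k) (dl k t) x + score p t x 0 k * dl k t x).
    exact: classCD (classC_partial k (cd k)) (classCM cs (classC_le (leqnn 0) (leq0n 1) (cd k))).
  have [K [_ HG]] := rintegrable_growth_moments mX wX cG.
  by have [] := HG t t tT tT.
have [K [_ HB]] := rintegrable_growth_moments mX wX (bwd_loss_classC cg cD).
have [iB _] := HB t t tT tT.
have E w : fwd_loss g p shat t (X t w) =
    g t ^+ 2 * \sum_k S k w + bwd_loss g p shat t (X t w).
  by rewrite /fwd_loss /bwd_loss -mulrDr /divergence -big_split.
have iSS : rintegrable P (fun w => \sum_k S k w).
  by apply: rintegrable_sum => k _; exact: iS.
have -> : \int[P]_w fwd_loss g p shat t (X t w) =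
    \int[P]_w (g t ^+ 2 * \sum_k S k w + bwd_loss g p shat t (X t w)).
  by apply: eq_Rintegral => w _; exact: E.
rewrite RintegralD//; last exact: rintegrableZ.
rewrite RintegralZl// Rintegral_sum => [|k _]; last exact: iS.
rewrite big1 ?mulr0 ?add0r// => k _.
exact: (stein k (cd k) tT).
Qed.

End stein.

(** * Lipschitz continuity in time of mean energies *)

Section fatou.
Context d0 (Om : measurableType d0) (R : realType) (P : probability Om R).

(** Stated in the extended reals, so that it also yields the integrability of the limit. *)
Lemma fatou_lee (F : nat -> Om -> R) (G : Om -> R) (c : nat -> R) (l : R) :
  (forall n w, 0 <= F n w) -> (forall w, 0 <= G w) ->
  (forall n, measurable_fun setT (F n)) -> measurable_fun setT G ->
  {ae P, forall w, F ^~ w @ \oo --> G w} ->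
  (forall n, \int[P]_w (F n w)%:E <= (c n)%:E)%E -> c @ \oo --> l ->
  (\int[P]_w (G w)%:E <= l%:E)%E.
Proof.
move=> F0 G0 mF' mG' FG Fc cl.
have mF n : measurable_fun setT (EFin \o F n) by exact/measurable_EFinP.
have mG : measurable_fun setT (EFin \o G) by exact/measurable_EFinP.
apply: (@le_trans _ _ (\int[P]_w limn_einf (fun n => (F n w)%:E))%E).
  apply: ae_ge0_le_integral => //.
  - by move=> w _; rewrite lee_fin.
  - move=> w _; rewrite limn_einf_lim; apply: lime_ge; first exact: is_cvg_einfs.
    apply: nearW => n; apply: le_ereal_inf_tmp => _ [k _ <-].
    by rewrite lee_fin.
  - apply: (eq_measurable_fun (fun w => - limn_esup (fun n => - (F n w)%:E)))%E.
      by move=> w _; rewrite -limn_einfN; congr limn_einf; apply/funext => n /=; rewrite opprK.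
    apply: measurableT_comp => //; apply: measurable_fun_limn_esup => n.
    exact: measurableT_comp (mF n).
  - apply: filterS FG => w FGw _.
    have H : (fun n => (F n w)%:E) @ \oo --> (G w)%:E.
      by apply: cvg_EFin => //; exact: nearW.
    by rewrite (cvg_limn_einf_sup H).1.
apply: (le_trans (fatou P measurableT mF _)); first by move=> n w _; rewrite lee_fin.
rewrite limn_einf_lim.
have cl' : (EFin \o c) @ \oo --> l%:E by apply: cvg_EFin => //; exact: nearW.
rewrite -(cvg_lim _ cl')//; apply: lee_lim.
- exact: is_cvg_einfs.
- by apply/cvg_ex; exists l%:E.
apply: nearW => n; apply: (@le_trans _ _ (\int[P]_w (F n w)%:E)%E).
  by apply: ereal_inf_lbound; exists n => //=.
exact: Fc.
Qed.

Lemma fatou_le (F : nat -> Om -> R) (G : Om -> R) (c : nat -> R) (l : R) :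
  (forall n w, 0 <= F n w) -> (forall w, 0 <= G w) ->
  (forall n, rintegrable P (F n)) -> rintegrable P G ->
  {ae P, forall w, F ^~ w @ \oo --> G w} ->
  (forall n, \int[P]_w F n w <= c n) -> c @ \oo --> l ->
  \int[P]_w G w <= l.
Proof.
move=> F0 G0 iF iG FG Fc cl; rewrite -lee_fin -RintegralE//.
apply: (fatou_lee F0 G0 (fun n => rintegrable_measurable (iF n))
  (rintegrable_measurable iG) FG _ cl) => n.
by rewrite RintegralE// lee_fin.
Qed.

End fatou.

Section mean_along.
Context (R : realType) (d : nat) (T : R) d0 (Om : measurableType d0)
  (P : probability Om R) d1 (OmE : measurableType d1) (PE : probability OmE R).
Variables (h0 : R) (Z : R -> Om -> 'rV[R]_d) (z : nat -> nat -> OmE -> 'rV[R]_d)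
  (phi : R -> 'rV[R]_d -> R) (K C : R).
Local Notation h := (step T).
Local Notation t_ N := (grid (step T N)).
Hypotheses (T_gt0 : 0 < T) (h0_gt0 : 0 < h0)
  (cphi : classC 1 2 T phi) (phi_ge0 : forall t x, 0 <= phi t x)
  (mZ : forall t, t \in `[0, T] -> measurable_fun setT (Z t))
  (wZ : weight_moments P (fun t => t \in `[0, T]) Z)
  (Z_paths : {ae P, forall w, forall (s : nat -> R) t, (forall n, s n \in `[0, T]) ->
    t \in `[0, T] -> s @ \oo --> t -> (fun n => Z (s n) w) @ \oo --> Z t w}).

Definition mean_along t := \int[P]_w phi t (Z t w).
Definition mean_scheme N k := \int[PE]_w phi (t_ N k) (z N k w).

Hypotheses (K0 : 0 <= K) (C0 : 0 <= C)
  (weak : forall N k, (0 < N)%N -> h N <= h0 -> (k <= N)%N ->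
    `|mean_scheme N k - mean_along (t_ N k)| <= C * h N)
  (incr : forall N k, (0 < N)%N -> h N <= h0 -> (k < N)%N ->
    `|mean_scheme N k.+1 - mean_scheme N k| <= K * h N).

Lemma small_step e : 0 < e -> exists2 m, (0 < m)%N & T / m%:R <= e.
Proof.
move=> e0; exists (Num.truncn (T / e)).+1 => //.
rewrite ler_pdivrMr ?ltr0n// mulrC -ler_pdivrMr//.
by have /andP[_ /ltW] := truncn_itv (ltW (divr_gt0 T_gt0 e0)).
Qed.

Lemma step_mul N m : h (N * m) = h N / m%:R.
Proof. by rewrite /step natrM invfM mulrA. Qed.

Lemma grid_mul N m k : (0 < m)%N -> t_ (N * m) (k * m) = t_ N k.
Proof.
move=> m0; rewrite /grid step_mul natrM -mulrA; congr (_ * _).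
by rewrite mulrC divfK// pnatr_eq0 -lt0n.
Qed.

Lemma mean_scheme_incr N j k : (0 < N)%N -> h N <= h0 -> (j <= k)%N -> (k <= N)%N ->
  `|mean_scheme N k - mean_scheme N j| <= K * (t_ N k - t_ N j).
Proof.
move=> N0 hN jk; rewrite -(subnKC jk); elim: (k - j)%N => [|i IH] kN.
  by rewrite addn0 !subrr normr0 mulr0.
rewrite addnS gridS in kN *.
rewrite (_ : K * (_ + _ - _) = K * h N + K * (t_ N (j + i) - t_ N j)); last by ring.
rewrite -(subrKA (mean_scheme N (j + i))) (le_trans (ler_normD _ _))// lerD//.
  exact: incr.
by apply: IH; exact: ltnW.
Qed.

(** The weak error does not shrink with the distance of the two nodes. Passing to a multiple of N
    keeps both nodes and makes that error as small as desired, which leaves the increments of the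
    chain. *)
Lemma mean_along_grid N j k : (0 < N)%N -> (j <= k)%N -> (k <= N)%N ->
  `|mean_along (t_ N k) - mean_along (t_ N j)| <= K * (t_ N k - t_ N j).
Proof.
move=> N0 jk kN; apply/ler_addgt0Pr => e e0.
(* Each of the two nodes costs C h; [2 * C + 1] is positive even when C is zero. *)
have [|m m0 hm] := @small_step (Num.min h0 (e / (2 * C + 1))).
  by rewrite lt_min h0_gt0 divr_gt0// ltr_wpDl// mulr_ge0.
have Nm0 : (0 < N * m)%N by rewrite muln_gt0 N0.
have hNm : h (N * m) <= T / m%:R.
  by rewrite /step ler_pM2l// lef_pV2 ?posrE ?ltr0n// ler_nat leq_pmull.
have hmin := le_trans hNm hm; move: hmin; rewrite le_min => /andP[hh0 he].
have km : (k * m <= N * m)%N by rewrite leq_mul2r kN orbT.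
have jm : (j * m <= N * m)%N by rewrite leq_mul2r (leq_trans jk kN) orbT.
have w1 := weak Nm0 hh0 km; have w2 := weak Nm0 hh0 jm.
have w3 := mean_scheme_incr Nm0 hh0 (leq_mul jk (leqnn m)) km.
rewrite !grid_mul// in w1 w2 w3.
have Ce : 2 * C * h (N * m) <= e.
  apply: (@le_trans _ _ ((2 * C + 1) * h (N * m))).
    by rewrite ler_wpM2r ?lerDl// divr_ge0 ?ler0n ?ltW.
  by rewrite mulrC -ler_pdivlMr// ltr_wpDl// mulr_ge0.
rewrite (_ : mean_along _ - _ = (mean_scheme (N * m) (k * m) - mean_scheme (N * m) (j * m))
  - (mean_scheme (N * m) (k * m) - mean_along (t_ N k)) +
   (mean_scheme (N * m) (j * m) - mean_along (t_ N j))); last by ring.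
apply: (le_trans (ler_normD _ _)); apply: (le_trans (lerD (ler_normB _ _) w2)).
apply: (le_trans (lerD (lerD w3 w1) (lexx _))).
by rewrite -addrA lerD2l -mulr2n -mulr_natl mulrA.
Qed.

Lemma grid_approx t e : t \in `[0, T] -> 0 < e ->
  exists N k, [/\ (0 < N)%N, (k <= N)%N, t_ N k <= t & t - t_ N k <= e].
Proof.
rewrite in_itv /= => /andP[t0 tT] e0; have [N N0 hN] := small_step e0.
have h0N : 0 < h N by rewrite divr_gt0// ltr0n.
have := truncn_itv (divr_ge0 t0 (ltW h0N)).
set k := Num.truncn _ => /andP[k1 k2].
have kt : t_ N k <= t by rewrite /grid -ler_pdivlMr.
exists N, k; split => //.
  rewrite -(ler_nat R) (le_trans k1)// ler_pdivrMr// /step mulrC divfK//.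
  by rewrite pnatr_eq0 -lt0n.
rewrite (le_trans _ hN)// -/(h N) lerBlDl -gridS /grid.
by rewrite -ler_pdivrMr// ltW.
Qed.

Lemma grid_sequence t : t \in `[0, T] -> exists q : nat -> nat * nat,
  (forall n, [/\ (0 < (q n).1)%N, h (q n).1 <= h0 & ((q n).2 <= (q n).1)%N]) /\
  (fun n => t_ (q n).1 (q n).2) @ \oo --> t.
Proof.
move=> tT; have [m m0 hm] := small_step h0_gt0.
have sx n : exists q : nat * nat, [/\ (0 < q.1)%N, h q.1 <= h0, (q.2 <= q.1)%N,
      t_ q.1 q.2 <= t & t - t_ q.1 q.2 <= n.+1%:R^-1].
  have [|N [k [N0 kN t1 t2]]] := @grid_approx t n.+1%:R^-1 tT.
    by rewrite invr_gt0 ltr0n.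
  (* Refining by m keeps the node and brings the step below h0. *)
  exists (N * m, k * m)%N; split => /=; rewrite ?grid_mul//.
  - by rewrite muln_gt0 N0.
  - apply: le_trans hm; rewrite /step ler_pM2l// lef_pV2 ?posrE ?ltr0n ?muln_gt0 ?N0//.
    by rewrite ler_nat leq_pmull.
  - by rewrite leq_mul2r kN orbT.
have [q Hq] := choice sx; exists q; split; first by move=> n; have [] := Hq n.
apply: (@squeeze_cvgr _ _ _ _ (fun n => t - n.+1%:R^-1) (fun=> t)).
- apply: nearW => n; have [_ _ _ st1 st2] := Hq n.
  by rewrite st1 andbT lerBlDr -lerBlDl.
- rewrite -[X in _ --> X]subr0; apply: cvgB; first exact: cvg_cst.
  exact: cvg_harmonic.
- exact: cvg_cst.
Qed.

Lemma mean_along_cvg (s : nat -> R) t : (forall n, s n \in `[0, T]) ->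
  t \in `[0, T] -> s @ \oo --> t ->
  {ae P, forall w, (fun n => phi (s n) (Z (s n) w)) @ \oo --> phi t (Z t w)}.
Proof.
move=> sT tT st; apply: filterS Z_paths => w Hw.
have Zt : (fun n => Z (s n) w) @ \oo --> Z t w by exact: Hw.
have [D D0 [Dreg _ _]] := classC_jet cphi.
have [cD _] := Dreg 0%N [::] (leq0n _) (leq0n _).
have : (fun n => D 0%N [::] (s n) (Z (s n) w)) @ \oo --> D 0%N [::] t (Z t w).
  move=> A nA; have /subspace_continuousP/(_ (t, Z t w) (conj tT Logic.I)) := cD.
  move=> /(_ A nA) H.
  have {}H : nbhs (t, Z t w) (fun y => (`[0, T] `*` [set: 'rV[R]_d]) y ->
      A (D 0%N [::] y.1 y.2)) by exact: H.
  case: H => -[A1 A2] /= [nA1 nA2] sA.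
  have H1 : \forall n \near \oo, A1 (s n) := st _ nA1.
  have H2 : \forall n \near \oo, A2 (Z (s n) w) := Zt _ nA2.
  suff : \forall n \near \oo, A (D 0%N [::] (s n) (Z (s n) w)) by [].
  apply: filterS2 H1 H2 => n h1 h2.
  apply: (sA (s n, Z (s n) w)) => //.
  by split => //=; exact: sT.
rewrite D0//; apply: cvg_trans; apply: near_eq_cvg; apply: nearW => n.
by rewrite D0.
Qed.

(** Both points are nodes of the grid with N N' steps. *)
Lemma mean_along_grids N j N' k : (0 < N)%N -> (j <= N)%N -> (0 < N')%N ->
  (k <= N')%N ->
  `|mean_along (t_ N' k) - mean_along (t_ N j)| <= K * `|t_ N' k - t_ N j|.
Proof.
move=> N0 jN N'0 kN'; rewrite -(grid_mul N j N'0) -(grid_mul N' k N0) (mulnC N').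
have NN0 : (0 < N * N')%N by rewrite muln_gt0 N0.
have jm : (j * N' <= N * N')%N by rewrite leq_mul2r jN orbT.
have km : (k * N <= N * N')%N by rewrite (mulnC N) leq_mul2r kN' orbT.
have h_ge0 : 0 <= h (N * N') by rewrite divr_ge0 ?ler0n ?ltW.
have [jk|/ltnW kj] := leqP (j * N') (k * N).
  rewrite [X in _ <= _ * X]ger0_norm; first exact: mean_along_grid.
  by rewrite subr_ge0 /grid ler_wpM2r// ler_nat.
rewrite distrC [X in _ <= _ * X]distrC [X in _ <= _ * X]ger0_norm.
  exact: mean_along_grid.
by rewrite subr_ge0 /grid ler_wpM2r// ler_nat.
Qed.

(* The upper bound passes to the limit by Fatou's lemma for phi, the lower
   bound by Fatou's lemma for the nonnegative e phi^2 - phi + 1 / (4 e), as the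
   means of phi^2 are bounded. *)
Lemma mean_along_le t j N : t \in `[0, T] -> (0 < N)%N -> (j <= N)%N ->
  `|mean_along t - mean_along (t_ N j)| <= K * `|t - t_ N j|.
Proof.
move=> tT N0 jN.
have [M [_ HM]] := rintegrable_growth_moments mZ wZ cphi.
have [M2 [M20 HM2]] := rintegrable_growth_moments mZ wZ (classCM cphi cphi).
have [q [Hq st]] := grid_sequence tT.
pose s n := t_ (q n).1 (q n).2.
have sT n : s n \in `[0, T] by have [q0 _ qk] := Hq n; exact: grid_in.
have Hcvg := mean_along_cvg sT tT st.
have lip n : `|mean_along (s n) - mean_along (t_ N j)| <= K * `|s n - t_ N j|.
  by have [q0 _ qk] := Hq n; exact: mean_along_grids.
have lim_lip c : (fun n => c + K * `|s n - t_ N j|) @ \oo --> c + K * `|t - t_ N j|.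
  apply: cvgD; first exact: cvg_cst.
  apply: cvgMr; apply: cvg_norm; apply: cvgB => //; exact: cvg_cst.
have ip r : r \in `[0, T] -> rintegrable P (fun w => phi r (Z r w)).
  by move=> rT; have [] := HM r r rT rT.
have ip2 r : r \in `[0, T] -> rintegrable P (fun w => phi r (Z r w) * phi r (Z r w)).
  by move=> rT; have [] := HM2 r r rT rT.
have up : mean_along t <= mean_along (t_ N j) + K * `|t - t_ N j|.
  apply: (@fatou_le _ _ _ P (fun n w => phi (s n) (Z (s n) w))
    (fun w => phi t (Z t w)) _ _ (fun n w => phi_ge0 _ _) (fun w => phi_ge0 _ _)
    (fun n => ip _ (sT n)) (ip _ tT) Hcvg _ (lim_lip _)) => n.
  by have := lip n; rewrite ler_norml => /andP[_]; rewrite lerBlDl addrC.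
have low e : 0 < e -> mean_along (t_ N j) - K * `|t - t_ N j| - e * M2 <= mean_along t.
  (* This is e (y - 1 / (2 e))^2 at y = phi: nonnegative, yet with -phi in it, so that Fatou bounds
     the mean of phi from below. *)
  move=> e0; pose ps r w := (4 * e)^-1 + (e * (phi r (Z r w) * phi r (Z r w)) -
    phi r (Z r w)).
  have ps0 r w : 0 <= ps r w.
    rewrite /ps; move: (phi r (Z r w)) => y.
    rewrite (_ : (4 * e)^-1 + (e * (y * y) - y) = e * (y - (2 * e)^-1) ^+ 2).
      by rewrite mulr_ge0 ?sqr_ge0// ltW.
    by field; rewrite gt_eqF.
  have i1 : rintegrable P (fun=> (4 * e)^-1) by exact: finite_measure_integrable_cst.
  have ib r : r \in `[0, T] -> rintegrable P (fun w =>
      e * (phi r (Z r w) * phi r (Z r w)) - phi r (Z r w)).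
    by move=> rT; apply: rintegrableB; [apply: rintegrableZ; exact: ip2|exact: ip].
  have ips r : r \in `[0, T] -> rintegrable P (ps r).
    by move=> rT; exact: rintegrableD i1 (ib r rT).
  have Eps r : r \in `[0, T] -> \int[P]_w ps r w = (4 * e)^-1 +
      (e * \int[P]_w (phi r (Z r w) * phi r (Z r w)) - mean_along r).
    move=> rT; rewrite RintegralD//; last exact: ib.
    rewrite gauss_mean0 RintegralB//; [|apply: rintegrableZ; exact: ip2|exact: ip].
    by rewrite RintegralZl//; exact: ip2.
  have cps : {ae P, forall w, (fun n => ps (s n) w) @ \oo --> ps t w}.
    apply: filterS Hcvg => w Hw; apply: cvgD; first exact: cvg_cst.
    apply: cvgB; last exact: Hw.
    by apply: cvgMr; apply: cvgM; exact: Hw.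
  have := @fatou_le _ _ _ P (fun n => ps (s n)) (ps t) _ _ (fun n => ps0 (s n)) (ps0 t)
    (fun n => ips _ (sT n)) (ips t tT) cps _
    (lim_lip ((4 * e)^-1 + e * M2 - mean_along (t_ N j))).
  rewrite Eps// => /(_ _) H.
  have p2 : 0 <= e * \int[P]_w (phi t (Z t w) * phi t (Z t w)).
    apply: mulr_ge0; first exact: ltW.
    by apply: Rintegral_ge0 => // w _; exact: mulr_ge0.
  suff : (4 * e)^-1 + (e * \int[P]_w (phi t (Z t w) * phi t (Z t w)) - mean_along t) <=
    (4 * e)^-1 + e * M2 - mean_along (t_ N j) + K * `|t - t_ N j| by lra.
  apply: H => n; rewrite Eps//.
  have [_ b2] := HM2 (s n) (s n) (sT n) (sT n).
  have := ler_wpM2l (ltW e0) (le_trans (ler_norm _) b2).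
  have := lip n; rewrite ler_norml => /andP[+ _]; lra.
rewrite ler_norml; apply/andP; split; last by rewrite lerBlDl.
rewrite lerBrDl; apply/ler_addgt0Pr => e e0.
(* With this value in [low], the loss proportional to M2 is at most e. *)
have e1 : 0 < e / (M2 + 1) by rewrite divr_gt0// ltr_wpDl.
have := low _ e1.
have : e / (M2 + 1) * M2 <= e.
  by rewrite mulrAC ler_pdivrMr ?ltr_wpDl// ler_pM2l// lerDl.
lra.
Qed.

(** A grid node between t and t' splits the interval into two whose lengths add up, so the constant
    K is preserved. *)
Lemma mean_along_lip t t' : t \in `[0, T] -> t' \in `[0, T] -> t < t' ->
  `|mean_along t' - mean_along t| <= K * (t' - t).
Proof.
move=> tT t'T tt'.
have [|N [k [N0 kN kt' kd]]] := @grid_approx t' (t' - t) t'T; first by rewrite subr_gt0.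
have tk : t <= t_ N k by move: kd; lra.
have := mean_along_le t'T N0 kN; have := mean_along_le tT N0 kN.
rewrite (ger0_norm (_ : 0 <= t' - t_ N k)) ?subr_ge0//.
rewrite distrC [X in _ <= K * X]distrC (ger0_norm (_ : 0 <= t_ N k - t)) ?subr_ge0//.
move=> H1 H2; rewrite -(subrKA (mean_along (t_ N k))).
apply: (le_trans (ler_normD _ _)); apply: (le_trans (lerD H2 H1)).
by rewrite -mulrDr subrKA.
Qed.

End mean_along.

(** * Riemann sums of a Lipschitz function *)

Section riemann_sum.
Context (R : realType).
Local Notation mu := (@lebesgue_measure R).
Variables (T K : R) (u : R -> R).
Hypotheses (T_gt0 : 0 < T) (K_ge0 : 0 <= K)
  (lip : forall t t', t \in `[0, T] -> t' \in `[0, T] -> t < t' ->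
    `|u t' - u t| <= K * (t' - t)).

Lemma lip_abs t t' : t \in `[0, T] -> t' \in `[0, T] ->
  `|u t' - u t| <= K * `|t' - t|.
Proof.
move=> tT t'T; have [tt'|t't|->] := ltgtP t t'.
- by rewrite [X in _ <= _ * X]gtr0_norm ?subr_gt0//; exact: lip.
- by rewrite distrC [X in _ <= _ * X]distrC [X in _ <= _ * X]gtr0_norm ?subr_gt0//; exact: lip.
- by rewrite !subrr !normr0 mulr0.
Qed.

Lemma lip_within_continuous : {within `[0, T], continuous u}.
Proof.
apply/subspace_continuousP => t /= tT; apply/cvgrPdist_le => /= e e0.
have d0 : 0 < e / (K + 1) by rewrite divr_gt0// ltr_wpDl.
rewrite near_withinE; near=> t' => t'T.
rewrite (le_trans (lip_abs t'T tT))//.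
rewrite (@le_trans _ _ (K * (e / (K + 1))))//.
  apply: ler_wpM2l => //; near: t'; exact: cvgr_dist_le.
by rewrite mulrCA ger_pMr// ler_pdivrMr ?ltr_wpDl// mul1r lerDl.
Unshelve. all: by end_near. Qed.

Lemma lip_integrable a b : mu.-integrable `[0, T] (EFin \o u) ->
  0 <= a -> b <= T -> mu.-integrable `]a, b] (EFin \o u).
Proof.
move=> iu a0 bT; apply: integrableS iu => // t /=.
by rewrite !in_itv /= => /andP[at' tb]; rewrite (le_trans a0 (ltW at')) (le_trans tb).
Qed.

Lemma integral_itv_cst_bound a b c M : a <= b -> mu.-integrable `]a, b] (EFin \o u) ->
  (forall t, a < t <= b -> `|u t - c| <= M) ->
  `|\int[mu]_(t in `]a, b]) u t - c * (b - a)| <= M * (b - a).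
Proof.
move=> ab iu H.
have mab : mu `]a, b] = (b - a)%:E.
  rewrite lebesgue_measure_itv /= lte_fin.
  move: ab; rewrite le_eqVlt => /orP[/eqP->|->]; last by rewrite EFinB.
  by rewrite ltxx subrr.
have icst k : mu.-integrable `]a, b] (EFin \o (fun=> k : R)).
  apply/integrableP; split; first exact/measurable_EFinP.
  by rewrite integral_cst//= mab ltry.
have cE k : \int[mu]_(t in `]a, b]) k = k * (b - a) 
  by rewrite Rintegral_cst//; congr (_ * _); exact: (congr1 fine mab).
rewrite -!cE -RintegralB//.
have iB : mu.-integrable `]a, b] (EFin \o (fun t => u t - c)).
  exact: (integrableB _ iu (icst c)).
apply: (le_trans (le_normr_Rintegral _ iB)) => //.
have iN : mu.-integrable `]a, b] (EFin \o (fun t => `|u t - c|)).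
  exact: (integrable_norm iB).
have H' t : t \in `]a, b] -> `|u t - c| <= M by rewrite in_itv; exact: H.
exact: (le_Rintegral _ iN (icst M)).
Qed.

(** On each cell the integrand is within K h of its tag, so a cell costs K h^2 and the N cells cost
    K T h. *)
Lemma riemann_sum N (c : nat -> R) : (0 < N)%N ->
  (forall k t, (k < N)%N -> grid (step T N) k < t <= grid (step T N) k.+1 ->
     `|u t - c k| <= K * step T N) ->
  mu.-integrable `[0, T] (EFin \o u) /\
  `|\int[mu]_(t in `[0, T]) u t - step T N * \sum_(k < N) c k| <= K * T * step T N.
Proof.
move=> N0 Hc.
have iu : mu.-integrable `[0, T] (EFin \o u).
  apply: continuous_compact_integrable; first exact: segment_compact.
  exact: lip_within_continuous.
split => //; pose h := step T N; pose t_ k := grid h k.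
have h0 : 0 < h by exact: step_gt0.
have t_ge0 k : 0 <= t_ k by rewrite mulr_ge0 ?ler0n ?(ltW h0).
have tT k : (k <= N)%N -> t_ k <= T.
  by move=> kN; have := grid_in T_gt0 N0 kN; rewrite in_itv /= => /andP[].
have tS k : t_ k.+1 - t_ k = h by rewrite /t_ gridS addrAC subrr add0r.
suff H k : (k <= N)%N ->
    `|\int[mu]_(t in `[0, t_ k]) u t - h * \sum_(i < k) c i| <= K * t_ k * h.
  by have := H N (leqnn N); rewrite /t_ grid_end.
elim: k => [|k IH] kN.
  rewrite big_ord0 mulr0 subr0 /t_ /grid mul0r mulr0 mul0r set_itv1.
  by rewrite Rintegral_set1 normr0.
have kN' := ltnW kN.
have iuk : mu.-integrable `[0, t_ k.+1] (EFin \o u).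
  apply: integrableS iu => // t /=; rewrite !in_itv /= => /andP[-> tk] /=.
  by rewrite (le_trans tk) ?tT.
have tkS : t_ k <= t_ k.+1 by rewrite -subr_ge0 tS ltW.
have := @Rintegral_itvB R u (BLeft 0) (BRight (t_ k.+1)) (t_ k) iuk.
rewrite !bnd_simp => /(_ (t_ge0 k) tkS) /eqP; rewrite subr_eq => /eqP ->.
have ik : mu.-integrable `]t_ k, t_ k.+1] (EFin \o u).
  by apply: lip_integrable => //; exact: tT.
have := integral_itv_cst_bound tkS ik (fun t ht => Hc k t kN ht).
rewrite tS big_ord_recr /= mulrDr => B1.
rewrite (_ : _ + _ - _ = (\int[mu]_(t in `]t_ k, t_ k.+1]) u t - c k * h) +
  (\int[mu]_(t in `[0, t_ k]) u t - h * \sum_(i < k) c i)); last by ring.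
apply: (le_trans (ler_normD _ _)); apply: (le_trans (lerD B1 (IH kN'))).
have -> : t_ k.+1 = t_ k + h by rewrite -(tS k) addrC subrK.
by rewrite -mulrDl -mulrDr addrC.
Qed.

End riemann_sum.

(** * Change of measure and acceptance *)

Section change_of_measure.
Context (R : realType) (d : nat) (T : R) d0 (Om : measurableType d0)
  (P : probability Om R).

(** A normal density is even about its mean, so only |s| matters. *)
Lemma gauss_pdf_affine_neq0 (m : 'rV[R]_d) (s : R) x : s != 0 ->
  `|s| ^+ d * gauss_pdf m (s ^+ 2) (m + s *: x) = gauss_pdf 0 1 x.
Proof.
move=> s0; have s1 : 0 < `|s| by rewrite normr_gt0.
have sE : `|s| ^+ 2 = s ^+ 2 by rewrite real_normK ?num_real.
have E : enorm (m + s *: x - m) = enorm (m + `|s| *: x - m).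
  rewrite /enorm; congr Num.sqrt; apply: eq_bigr => k _.
  by rewrite !mxE (addrC (m 0 k)) addrK (addrC (m 0 k)) addrK !exprMn sE.
by rewrite -(gauss_pdf_affine m x s1) sE /gauss_pdf E.
Qed.

Variables (a a' : R -> 'rV[R]_d -> 'rV[R]_d) (g : R -> R) (t h : R).
Hypotheses (ca : classC_vec 0 3 T a) (ca' : classC_vec 0 3 T a')
  (tT : t \in `[0, T]) (h0 : 0 < h) (gt : g t != 0).

Definition density_ratio x z := expR (- step_log_ratio a a' g t h x z).

Let s := Num.sqrt h * g t.

Let s_neq0 : s != 0.
Proof. by rewrite mulf_neq0// gt_eqF// sqrtr_gt0. Qed.

Let sE : s ^+ 2 = g t ^+ 2 * h.
Proof. by rewrite exprMn sqr_sqrtr ?(ltW h0)// mulrC. Qed.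

Lemma measurable_gauss_pdf d1 (Om1 : measurableType d1) (U V : Om1 -> 'rV[R]_d) v :
  measurable_fun setT U -> measurable_fun setT V ->
  measurable_fun setT (fun w => gauss_pdf (V w) v (U w)).
Proof.
move=> mU mV; apply: measurable_funM => //; apply: measurableT_comp => //.
apply: measurableT_comp => //; apply: measurable_funM => //.
apply: measurable_funX; apply: measurable_enorm.
rewrite (_ : (fun w => U w - V w) = fun w => U w + -1 *: V w).
  by apply: measurable_rVD => //; exact: measurable_rVZ.
by apply/funext => w; rewrite scaleN1r.
Qed.

Lemma measurable_reverse_pdf d1 (Om1 : measurableType d1) (U V : Om1 -> 'rV[R]_d) v :
  measurable_fun setT U -> measurable_fun setT V ->
  measurable_fun setT (fun w => gauss_pdf (V w + h *: a' t (V w)) v (U w)).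
Proof.
move=> mU mV; apply: measurable_gauss_pdf => //.
apply: measurable_rVD => //; apply: measurable_rVZ.
by apply: (measurableT_comp (f := a' t)) => //; exact: measurable_classC_vec.
Qed.

(* With y the endpoint of the step, the ratio turns the density of y given x
   into the reversed density of x given y. *)
Lemma integral_density_ratio (e : Om -> 'rV[R]_d) (H : 'rV[R]_d -> \bar R) x :
  has_density P e (gauss_pdf 0 1) ->
  measurable_fun setT H -> (forall y, 0 <= H y)%E ->
  (\int[P]_w ((density_ratio x (e w))%:E * H (step_move a g t h x (e w))) =
   \int[lebesgue_rV R d]_y ((gauss_pdf (y + h *: a' t y) (g t ^+ 2 * h) x)%:E * H y))%E.
Proof.
move=> he mH H0.
have mm : measurable_fun setT (fun z => step_move a g t h x z).
  by apply: (measurable_step_move g ca h tT (U := fun=> x) (V := id)).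
have mr : measurable_fun setT (density_ratio x).
  apply: measurableT_comp => //; apply: measurableT_comp => //.
  exact: (measurable_step_log_ratio g ca ca' h tT (U := fun=> x) (V := id)).
pose F z := ((density_ratio x z)%:E * H (step_move a g t h x z))%E.
pose K y := ((gauss_pdf (y + h *: a' t y) (g t ^+ 2 * h) x)%:E * H y)%E.
have F0 z : (0 <= F z)%E by rewrite mule_ge0// lee_fin expR_ge0.
have K0 y : (0 <= K y)%E by rewrite mule_ge0// lee_fin gauss_pdf_ge0.
have mF : measurable_fun setT F.
  by apply: emeasurable_funM; [exact/measurable_EFinP|exact: measurableT_comp mH mm].
have mK : measurable_fun setT K.
  apply: emeasurable_funM => //; apply/measurable_EFinP.
  exact: (measurable_reverse_pdf (U := fun=> x) (V := id)).
rewrite (@ge0_integral_has_density _ _ _ _ P e _ he F)// -/K.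
rewrite (ge0_integral_rV_affine (x + h *: a t x) s_neq0 mK K0).
have mKs : measurable_fun setT (fun z : 'rV[R]_d => K (x + h *: a t x + s *: z)%R).
  by apply: measurableT_comp mK _; exact: measurable_rV_affine.
have sd0 : (0 <= (`|s| ^+ d)%:E)%E by rewrite lee_fin exprn_ge0.
apply: etrans (ge0_integralZl _ measurableT mKs (fun z _ => K0 _) sd0).
apply: eq_integral => z _; rewrite /F /K -/(step_move a g t h x z).
have := step_density_ratio a a' x z h0 gt; rewrite /= => ->.
rewrite -(gauss_pdf_affine_neq0 (x + h *: a t x) z s_neq0) sE.
rewrite -/(density_ratio x z) -/(step_move a g t h x z).
move: (gauss_pdf _ _ _) => q; rewrite [X in (_ * X)%E = _]EFinM.
rewrite [X in _ = (_ * (X * _))%E]EFinM [LHS]muleC -muleA; congr (_ * _)%E.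
by rewrite muleA [(q%:E * _)%E]muleC.
Qed.

Lemma integral_gauss_pdf (e : Om -> 'rV[R]_d) m : has_density P e (gauss_pdf 0 1) ->
  (\int[lebesgue_rV R d]_x (gauss_pdf m (g t ^+ 2 * h) x)%:E = 1)%E.
Proof.
move=> he; have [_ _ _ /(_ _ measurableT)] := he.
rewrite preimage_setT probability_setT => ->.
rewrite (ge0_integral_rV_affine m s_neq0); last 2 first.
- apply/measurable_EFinP; exact: (measurable_gauss_pdf (U := id) (V := fun=> m)).
- by move=> x; rewrite lee_fin gauss_pdf_ge0.
rewrite -ge0_integralZl//; last 2 first.
- apply/measurable_EFinP.
  by apply: (measurable_gauss_pdf (V := fun=> m)) => //; exact: measurable_rV_affine.
- by move=> x _; rewrite lee_fin gauss_pdf_ge0.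
apply: eq_integral => x _.
by rewrite -(gauss_pdf_affine_neq0 m x s_neq0) sE EFinM.
Qed.

(** The invariant is that S weights the law of the current point into Lebesgue measure. Integrating
    the noise out leaves the reversed density of x given y; integrating over x first, by Tonelli,
    this density has mass 1, and Lebesgue measure in y remains. *)
Lemma change_of_measure_step (S : Om -> R) (U e : Om -> 'rV[R]_d) :
  measurable_fun setT S -> measurable_fun setT U -> (forall w, 0 <= S w) ->
  has_density P e (gauss_pdf 0 1) ->
  independent2 P (fun w => (S w, U w) : measurableTypeR R * 'rV[R]_d) e ->
  (forall H, measurable_fun setT H -> (forall y, 0 <= H y)%E ->
    \int[P]_w ((S w)%:E * H (U w)) = \int[lebesgue_rV R d]_y H y)%E ->
  forall H, measurable_fun setT H -> (forall y, 0 <= H y)%E ->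
    (\int[P]_w ((S w * density_ratio (U w) (e w))%:E *
      H (step_move a g t h (U w) (e w))) = \int[lebesgue_rV R d]_y H y)%E.
Proof.
move=> mS mU S0 he SUe HSU H mH H0.
have me : measurable_fun setT e by case: he.
(* The absolute value makes F nonnegative on the whole product space and changes nothing on the
   range of S. *)
pose F (z : (measurableTypeR R * 'rV[R]_d) * 'rV[R]_d) :=
  ((`|z.1.1| * density_ratio z.1.2 z.2)%:E * H (step_move a g t h z.1.2 z.2))%E.
have m11 : measurable_fun setT (fun z : (measurableTypeR R * 'rV[R]_d) * 'rV[R]_d => z.1.1).
  by apply: (measurableT_comp (f := fst)) => //; exact: measurable_fst.
have m12 : measurable_fun setT (fun z : (measurableTypeR R * 'rV[R]_d) * 'rV[R]_d => z.1.2).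
  apply: (measurableT_comp (f := snd)); first exact: measurable_snd.
  exact: measurable_fst.
have m2 : measurable_fun setT (fun z : (measurableTypeR R * 'rV[R]_d) * 'rV[R]_d => z.2).
  exact: measurable_snd.
have mF : measurable_fun setT F.
  apply: emeasurable_funM.
    apply/measurable_EFinP; apply: measurable_funM; first exact: measurableT_comp.
    apply: measurableT_comp => //; apply: measurableT_comp => //.
    exact: measurable_step_log_ratio.
  by apply: measurableT_comp mH _; exact: measurable_step_move.
have F0 z : (0 <= F z)%E.
  by rewrite mule_ge0// lee_fin mulr_ge0// expR_ge0.
pose G x := (\int[lebesgue_rV R d]_y
  ((gauss_pdf (y + h *: a' t y) (g t ^+ 2 * h) x)%:E * H y))%E.
pose J (z : 'rV[R]_d * 'rV[R]_d) :=
  ((gauss_pdf (z.2 + h *: a' t z.2) (g t ^+ 2 * h) z.1)%:E * H z.2)%E.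
have mJ : measurable_fun setT J.
  apply: emeasurable_funM; last by apply: measurableT_comp mH _; exact: measurable_snd.
  apply/measurable_EFinP.
  apply: (measurable_reverse_pdf (U := fst) (V := snd)); first exact: measurable_fst.
  exact: measurable_snd.
have J0 z : (0 <= J z)%E by rewrite mule_ge0// lee_fin gauss_pdf_ge0.
have mG : measurable_fun setT G by exact: (measurable_fun_fubini_tonelli_F J mJ J0).
have G0 x : (0 <= G x)%E.
  by apply: integral_ge0 => y _; rewrite mule_ge0// lee_fin gauss_pdf_ge0.
have mSU : measurable_fun setT (fun w => (S w, U w) : measurableTypeR R * 'rV[R]_d).
  exact: measurable_fun_pair.
transitivity (\int[P]_w F ((S w, U w), e w))%E.
  by apply: eq_integral => w _; rewrite /F /= ger0_norm.
rewrite (ge0_integral_independent2 mSU me SUe mF F0).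
transitivity (\int[P]_w ((S w)%:E * G (U w)))%E.
  apply: eq_integral => w _.
  rewrite /G -(integral_density_ratio (U w) he mH H0) -ge0_integralZl//.
  - by apply: eq_integral => w' _; rewrite /F /= ger0_norm// EFinM muleA.
  - apply: emeasurable_funM.
      apply/measurable_EFinP.
      apply: (measurableT_comp (f := fun r : R => expR (- r))).
        by apply: measurableT_comp.
      exact: (measurable_step_log_ratio g ca ca' h tT (U := fun=> U w) (V := e)).
    by apply: measurableT_comp mH _; exact: (measurable_step_move g ca h tT (U := fun=> U w) (V := e)).
  - by move=> w' _; rewrite mule_ge0// lee_fin expR_ge0.
  - by rewrite lee_fin.
rewrite HSU//.
transitivity (\int[lebesgue_rV R d]_x \int[lebesgue_rV R d]_y J (x, y))%E; first by [].
rewrite fubini_tonelli//; apply: eq_integral => y _.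
rewrite /J /= ge0_integralZr//; last 2 first.
- apply/measurable_EFinP.
  exact: (measurable_gauss_pdf (U := id) (V := fun=> y + h *: a' t y)).
- by move=> x _; rewrite lee_fin gauss_pdf_ge0.
by rewrite (integral_gauss_pdf _ he) mul1e.
Qed.

End change_of_measure.

Section mean_expR_Delta.
Context (R : realType) (d : nat) (T : R) d0 (Om : measurableType d0)
  (P : probability Om R).
Variables (f : R -> 'rV[R]_d -> 'rV[R]_d) (g : R -> R)
  (p : R -> 'rV[R]_d -> R) (shat : R -> 'rV[R]_d -> 'rV[R]_d)
  (x0 : nat -> Om -> 'rV[R]_d) (eps zeta : nat -> nat -> Om -> 'rV[R]_d).
Variable N : nat.
Hypotheses (T_gt0 : 0 < T) (N_gt0 : (0 < N)%N)
  (noise : euler_noise P (p 0) N (x0 N) (eps N) (zeta N))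
  (p_gt0 : forall t x, t \in `[0, T] -> 0 < p t x)
  (g0 : forall t, t \in `[0, T] -> g t != 0)
  (cL : classC 2 4 T (logdens p)).
Local Notation L := (logdens p).
Local Notation b := (reverse_drift f g shat).
Local Notation h := (step T N).
Local Notation x_ := (scheme_x T f g x0 eps N).
Local Notation y_ := (scheme_y T f g x0 eps zeta shat N).
Local Notation rx := (fwd_log_ratio T f g shat x0 eps N).
Local Notation ry := (bwd_log_ratio T f g shat x0 eps zeta N).
Local Notation past := (@meas_past R d d0 Om x0 eps zeta N).
Hypotheses (cf : classC_vec 0 3 T f) (cb : classC_vec 0 3 T b).

(** The first factor is the inverse initial density, which turns the law of x_0 into Lebesgue
    measure; each density ratio then preserves it. *)
Definition fwd_weight k w := expR (- L 0 (x_ 0 w)) * \prod_(i < k) expR (- rx i w).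
(** Here i counts backward steps; counted from zero, the j-th one leads to index N - j - 1. *)
Definition bwd_weight i w := fwd_weight N w *
  \prod_(j < i) expR (- ry (N - j.+1) w).

Let zT : 0 \in `[0, T]. Proof. by rewrite in_itv /= lexx ltW. Qed.

Lemma fwd_weightS k w : fwd_weight k.+1 w = fwd_weight k w * expR (- rx k w).
Proof. by rewrite /fwd_weight big_ord_recr /= mulrA. Qed.

Lemma bwd_weightS i w : bwd_weight i.+1 w = bwd_weight i w * expR (- ry (N - i.+1) w).
Proof. by rewrite /bwd_weight big_ord_recr /= mulrA. Qed.

Lemma fwd_weight_ge0 k w : 0 <= fwd_weight k w.
Proof.
rewrite mulr_ge0 ?expR_ge0//.
by apply: prodr_ge0 => i _; exact: expR_ge0.
Qed.

Lemma bwd_weight_ge0 i w : 0 <= bwd_weight i w.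
Proof.
rewrite mulr_ge0 ?fwd_weight_ge0//.
by apply: prodr_ge0 => j _; exact: expR_ge0.
Qed.

Lemma measurable_expRN d1 (Om1 : measurableType d1) (F : Om1 -> R) :
  measurable_fun setT F -> measurable_fun setT (fun w => expR (- F w)).
Proof.
move=> mF; apply: (measurableT_comp (f := fun r : R => expR (- r))) => //.
by apply: measurableT_comp.
Qed.

Lemma fwd_weight_past j k : (k <= N)%N -> (k <= j)%N -> past j (fwd_weight k).
Proof.
elim: k => [|k IH] kN kj.
  have E : fwd_weight 0 = fun w => expR (- L 0 (x_ 0 w)).
    by apply/funext => w; rewrite /fwd_weight big_ord0 mulr1.
  rewrite E; apply: measurable_expRN.
  apply: (measurableT_comp (measurable_classC cL zT)).
  exact: (scheme_x_used g T_gt0 N_gt0 cf kN kj).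
have -> : fwd_weight k.+1 = fun w => fwd_weight k w * expR (- rx k w).
  by apply/funext => w; rewrite fwd_weightS.
apply: measurable_funM; first by apply: IH; exact: ltnW.
apply: measurable_expRN; apply: (measurable_step_log_ratio g cf cb h).
- exact: (grid_in T_gt0 N_gt0 (ltnW kN)).
- exact: (scheme_x_used g T_gt0 N_gt0 cf (ltnW kN) (ltnW kj)).
- exact: eps_used.
Qed.

Lemma bwd_weight_past j i : (i <= N)%N -> (N + i <= j)%N -> past j (bwd_weight i).
Proof.
elim: i => [|i IH] iN ij.
  have -> : bwd_weight 0 = fwd_weight N.
    by apply/funext => w; rewrite /bwd_weight big_ord0 mulr1.
  by apply: fwd_weight_past => //; rewrite addn0 in ij.
have kN : (N - i.+1 < N)%N by rewrite ltn_subrL.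
have ij' : (N + i <= j)%N by rewrite (leq_trans _ ij)// addnS.
have -> : bwd_weight i.+1 = fun w => bwd_weight i w * expR (- ry (N - i.+1) w).
  by apply/funext => w; rewrite bwd_weightS.
apply: measurable_funM; first by apply: IH => //; exact: ltnW.
apply: measurable_expRN; apply: (measurable_step_log_ratio g cb cf h).
- exact: (grid_in T_gt0 N_gt0 (ltnW kN)).
- apply: (scheme_y_used T_gt0 N_gt0 cf cb kN).
  by rewrite subnSK// subnBA ?(ltnW iN)// mul2n -addnn -addnA addKn.
- apply: zeta_used => //.
  by rewrite subnBA// mul2n -addnn -addnA addKn.
Qed.

Lemma mean_fwd_weight k H : (k <= N)%N -> measurable_fun setT H ->
  (forall y, 0 <= H y)%E ->
  (\int[P]_w ((fwd_weight k w)%:E * H (x_ k w)) = \int[lebesgue_rV R d]_y H y)%E.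
Proof.
elim: k H => [|k IH] H kN mH H0.
  have [x0p _ _ _] := noise.
  pose F x := ((expR (- L 0 x))%:E * H x)%E.
  have mF : measurable_fun setT F.
    apply: emeasurable_funM => //; apply/measurable_EFinP; apply: measurable_expRN.
    exact: measurable_classC cL zT.
  have F0 x : (0 <= F x)%E by rewrite mule_ge0// lee_fin expR_ge0.
  transitivity (\int[P]_w F (x0 N w))%E.
    by apply: eq_integral => w _; rewrite /fwd_weight big_ord0 mulr1.
  rewrite (ge0_integral_has_density x0p mF F0); apply: eq_integral => x _.
  rewrite /F muleC muleA -EFinM (densityE p_gt0 x zT) -expRD.
  by rewrite subrr expR0 mul1e.
have kN' := ltnW kN.
have me : measurable_fun setT (eps N k).
  by have [_ he _ _] := noise; case: (he k kN).
have he : has_density P (eps N k) (gauss_pdf 0 1) by have [_ he _ _] := noise; exact: he.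
have pS : past k (fwd_weight k) by exact: fwd_weight_past.
have pU : past k (x_ k) by exact: (scheme_x_used g T_gt0 N_gt0 cf kN' (leqnn k)).
have pSU : past k (fun w => (fwd_weight k w, x_ k w) : measurableTypeR R * 'rV[R]_d).
  exact: measurable_fun_pair.
have iSU := past_independent_eps noise kN (leqnn k) pSU.
have tk := grid_in T_gt0 N_gt0 kN'.
have := change_of_measure_step cf cb tk (step_gt0 T_gt0 N_gt0) (g0 tk)
  (past_measurable noise pS) (past_measurable noise pU) (fwd_weight_ge0 k) he iSU
  (fun H => IH H kN') mH H0.
move=> <-; apply: eq_integral => w _.
by rewrite fwd_weightS.
Qed.

Lemma mean_bwd_weight i H : (i <= N)%N -> measurable_fun setT H ->
  (forall y, 0 <= H y)%E ->
  (\int[P]_w ((bwd_weight i w)%:E * H (y_ (N - i) w)) = \int[lebesgue_rV R d]_y H y)%E.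
Proof.
elim: i H => [|i IH] H iN mH H0.
  rewrite -(mean_fwd_weight (leqnn N) mH H0); apply: eq_integral => w _.
  by rewrite /bwd_weight big_ord0 mulr1 subn0 scheme_yN.
have iN' := ltnW iN.
have kN : (N - i.+1 < N)%N by rewrite ltn_subrL.
have kS : (N - i.+1).+1 = (N - i)%N by rewrite subnSK.
have he : has_density P (zeta N (N - i.+1)) (gauss_pdf 0 1).
  by have [_ _ hz _] := noise; exact: hz.
have pS : past (N + i) (bwd_weight i) by exact: bwd_weight_past.
have pU : past (N + i) (y_ (N - i)).
  apply: (scheme_y_used T_gt0 N_gt0 cf cb (leq_subr _ _)).
  by rewrite subnBA// mul2n -addnn -addnA addKn.
have pSU : past (N + i) (fun w => (bwd_weight i w, y_ (N - i) w) : measurableTypeR R * 'rV[R]_d).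
  exact: measurable_fun_pair.
have lt : (N + i < 2 * N - (N - i.+1))%N.
  by rewrite subnBA// mul2n -addnn -addnA addKn addnS.
have iSU := past_independent_zeta noise kN lt pSU.
have tk := grid_in T_gt0 N_gt0 (ltnW kN).
have := change_of_measure_step cb cf tk (step_gt0 T_gt0 N_gt0) (g0 tk)
  (past_measurable noise pS) (past_measurable noise pU) (bwd_weight_ge0 i) he iSU
  (fun H => IH H iN') mH H0.
move=> <-; apply: eq_integral => w _.
by rewrite bwd_weightS (scheme_yS _ _ _ _ _ _ _ _ kN) /bwd_log_ratio kS.
Qed.

Lemma expR_Delta w : expR (Delta T f g p shat x0 eps zeta N w) =
  bwd_weight N w * p 0 (y_ 0 w).
Proof.
rewrite (Delta_log_ratios _ _ _ _ _ T_gt0 N_gt0 p_gt0 g0) (densityE p_gt0 _ zT).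
rewrite /bwd_weight /fwd_weight -!expR_sum -!expRD !sumrN; congr expR.
(* [bwd_weight] runs down from the end of the grid, hence the reversal. *)
rewrite -(big_mkord xpredT (fun j => ry (N - j.+1) w)) big_nat_rev /= add0n.
rewrite -(big_mkord xpredT (fun k => ry k w)).
have -> : \sum_(0 <= j < N) ry (N - (N - j.+1).+1) w = \sum_(0 <= j < N) ry j w.
  rewrite !big_nat; apply: eq_bigr => j /andP[_ jN].
  by rewrite subnSK// subKn// ltnW.
by ring.
Qed.

(** Weighted by the whole run, y_0 is distributed as Lebesgue measure, against which the last factor
    p integrates to 1. *)
Lemma mean_expR_Delta :
  (\int[P]_w (expR (Delta T f g p shat x0 eps zeta N w))%:E = 1)%E.
Proof.
have [x0p _ _ _] := noise; have [_ mp p0 HP] := x0p.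
have mp' : measurable_fun setT (fun y => (p 0 y)%:E) by exact/measurable_EFinP.
have p0' y : (0 <= (p 0 y)%:E)%E by rewrite lee_fin.
have := mean_bwd_weight (leqnn N) mp' p0'.
rewrite -HP// preimage_setT probability_setT => <-.
by apply: eq_integral => w _; rewrite expR_Delta EFinM subnn.
Qed.

End mean_expR_Delta.

(** * From the mean log-ratio to the acceptance probability *)

Section acceptance.
Context d0 (Om : measurableType d0) (R : realType) (P : probability Om R).

Lemma expectation_Rintegral (F : Om -> R) : rintegrable P F ->
  ('E_P[F] = (\int[P]_w F w)%:E)%E.
Proof. by move=> iF; rewrite unlock RintegralE. Qed.

(** exp (x / 2) is the geometric mean of min (1, e^x) and max (1, e^x). Below it lies its tangent at
    m, above it the AM-GM bound weighted by s, where max (1, e^x) <= 1 + e^x. *)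
Lemma expR_half_bounds (x m s : R) : s = expR (m / 2) ->
  s * (1 + 2^-1 * (x - m)) <= s^-1 * Num.min 1 (expR x) + s / 4 * (1 + expR x).
Proof.
move=> sE; have s0 : 0 < s by rewrite sE expR_gt0.
rewrite (mulrC 2^-1) (mulrC s^-1).
pose y := expR (x / 2); have y0 : 0 < y by exact: expR_gt0.
have xE : expR x = y ^+ 2 by rewrite /y expr2 -expRD; congr expR; lra.
apply: (@le_trans _ _ y).
  have -> : y = s * expR ((x - m) / 2) by rewrite /y sE -expRD; congr expR; lra.
  by rewrite ler_pM2l// expR_ge1Dx.
have amgm a b : 0 < a -> a <= 1 -> a * b <= a ^+ 2 / s + s / 4 * b ^+ 2.
  move=> a0 a1; rewrite -subr_ge0.
  rewrite (_ : _ - _ = s * (a / s - b / 2) ^+ 2); last by field; rewrite gt_eqF.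
  by rewrite mulr_ge0 ?sqr_ge0// ltW.
have [y1|/ltW y1] := leP y 1.
  have -> : Num.min 1 (expR x) = y ^+ 2.
    by rewrite min_r ?xE// expr_le1// ltW.
  have := amgm y 1 y0 y1; rewrite mulr1 expr1n mulr1 => /le_trans; apply.
  by rewrite lerD2l mulrDr mulr1 lerDl xE mulr_ge0 ?sqr_ge0// divr_ge0// ltW.
have -> : Num.min 1 (expR x) = 1.
  by rewrite min_l// xE exprn_ege1.
have := amgm 1 y ltr01 (lexx 1); rewrite mul1r expr1n => /le_trans; apply.
by rewrite lerD2l xE ler_wpM2l// ?lerDr// divr_ge0// ltW.
Qed.

(* Bretagnolle-Huber: integrate the tangent line of exp at the mean of D / 2
   against the AM-GM bound of exp (D / 2). *)
Lemma mean_min_expR (D : Om -> R) : rintegrable P D ->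
  (\int[P]_w (expR (D w))%:E = 1)%E ->
  rintegrable P (fun w => Num.min 1 (expR (D w))) /\
  2^-1 * expR (\int[P]_w D w) <= \int[P]_w Num.min 1 (expR (D w)).
Proof.
move=> iD HE; have mD := rintegrable_measurable iD.
have mE : measurable_fun setT (fun w => expR (D w)) by exact: measurableT_comp mD.
have i1 : rintegrable P (fun=> 1) by exact: finite_measure_integrable_cst.
have iE : rintegrable P (fun w => expR (D w)).
  apply/integrableP; split; first exact/measurable_EFinP.
  under eq_integral do rewrite /= ger0_norm ?expR_ge0//.
  by rewrite HE ltry.
have E1 : \int[P]_w expR (D w) = 1.
  by apply: EFin_inj; rewrite -RintegralE// HE.
have imin : rintegrable P (fun w => Num.min 1 (expR (D w))).
  apply: rintegrable_le i1; first exact: measurable_minr.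
  by move=> w; rewrite ger0_norm ?ge_min ?lexx// le_min ler01 expR_ge0.
split => //; set m := \int[P]_w D w; pose s := expR (m / 2).
have s0 : 0 < s by exact: expR_gt0.
have ic c : rintegrable P (fun=> c) by exact: finite_measure_integrable_cst.
have iDm : rintegrable P (fun w => D w - m) by exact: rintegrableB.
have iDm2 : rintegrable P (fun w => 2^-1 * (D w - m)) by exact: rintegrableZ.
have i1D : rintegrable P (fun w => 1 + 2^-1 * (D w - m)) by exact: rintegrableD.
have i1E : rintegrable P (fun w => 1 + expR (D w)) by exact: rintegrableD.
have ism : rintegrable P (fun w => s^-1 * Num.min 1 (expR (D w))) by exact: rintegrableZ.
have is1 : rintegrable P (fun w => s / 4 * (1 + expR (D w))) by exact: rintegrableZ.
have := le_Rintegral measurableT (rintegrableZ s i1D) (rintegrableD ism is1)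
  (fun w _ => expR_half_bounds (D w) (erefl s)).
have EL : \int[P]_w (s * (1 + 2^-1 * (D w - m))) = s.
  rewrite RintegralZl// RintegralD// gauss_mean0 RintegralZl// RintegralB//; last exact: ic.
  by rewrite gauss_mean0 subrr mulr0 addr0 mulr1.
have ER : \int[P]_w (s^-1 * Num.min 1 (expR (D w)) + s / 4 * (1 + expR (D w))) =
    s^-1 * \int[P]_w Num.min 1 (expR (D w)) + s / 4 * (1 + 1).
  rewrite RintegralD// [X in X + _ = _]RintegralZl// [X in _ + X = _]RintegralZl//.
  by rewrite [X in _ + _ * X = _]RintegralD// gauss_mean0 E1.
rewrite EL ER => H.
(* As E[e^D] = 1, the inequality reads s <= A / s + s / 2 with A the mean acceptance, so A >= s^2 /
   2. *)
have -> : expR m = s * s by rewrite /s -expRD; congr expR; lra.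
have {}H : 2^-1 * s <= s^-1 * \int[P]_w Num.min 1 (expR (D w)) by lra.
by have := ler_wpM2l (ltW s0) H; rewrite mulVKf ?gt_eqF// mulrCA.
Qed.

End acceptance.

(** * Weak convergence and the limit *)

Section diffusions.
Context (R : realType) (d : nat) (T : R) d0 (Om : measurableType d0)
  (P : probability Om R).
Implicit Types X Y : R -> Om -> 'rV[R]_d.

(** The exceptional null set is common to all sequences, so that the sequence may be chosen
    afterwards. *)
Definition sequential_paths X := {ae P, forall w, forall (s : nat -> R) t,
  (forall n, s n \in `[0, T]) -> t \in `[0, T] -> s @ \oo --> t ->
  (fun n => X (s n) w) @ \oo --> X t w}.

Lemma sde_measurable F B b sigma X t : sde_solution P T F B b sigma X ->
  t \in `[0, T] -> measurable_fun setT (X t).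
Proof.
move=> [[[_ Fm _] _ aX] _ _ _] tT _ A mA; rewrite setTI.
exact: (Fm t tT _ (aX t A tT mA)).
Qed.

Lemma sde_paths F B b sigma X : sde_solution P T F B b sigma X -> sequential_paths X.
Proof.
move=> [_ cX _ _]; apply: filterS cX => w /subspace_continuousP cXw s t sT tT st A nA.
have H := cXw t tT A nA.
have {}H : nbhs t (fun r => `[0, T]%classic r -> A (X r w)) by exact: H.
have H1 : \forall n \near \oo, `[0, T]%classic (s n) -> A (X (s n) w) := st _ H.
by apply: filterS H1 => n; apply; exact: sT.
Qed.

Lemma reverse_time_in t : t \in `[0, T] -> T - t \in `[0, T].
Proof. by rewrite !in_itv /= => /andP[t0 tT]; rewrite subr_ge0 tT gerBl. Qed.

Lemma reverse_measurable b g X W Y t : reverse_diffusion P T b g X W Y ->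
  t \in `[0, T] -> measurable_fun setT (Y t).
Proof.
move=> [_ _ [G H]] tT; have := sde_measurable H (reverse_time_in tT).
by rewrite subKr.
Qed.

Lemma reverse_paths b g X W Y : reverse_diffusion P T b g X W Y -> sequential_paths Y.
Proof.
move=> [_ _ [G /sde_paths]]; apply: filterS => w H s t sT tT st.
have := H (fun n => T - s n) (T - t) (fun n => reverse_time_in (sT n)) (reverse_time_in tT).
rewrite subKr (_ : (fun n => Y (T - (T - s n)) w) = fun n => Y (s n) w); last first.
  by apply/funext => n; rewrite subKr.
by apply; apply: cvgB => //; exact: cvg_cst.
Qed.

End diffusions.

Section means.
Context (R : realType) (d : nat) (T : R) d0 (Om : measurableType d0)
  (P : probability Om R) d1 (OmE : measurableType d1) (PE : probability OmE R).
Variables (h0 : R) (z : nat -> nat -> OmE -> 'rV[R]_d) (Z : R -> Om -> 'rV[R]_d)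
  (phi : R -> 'rV[R]_d -> R).
Local Notation h := (step T).
Local Notation t_ N := (grid (step T N)).
Local Notation ok := (grid_ok T h0).
Hypotheses (T_gt0 : 0 < T) (cphi : classC 1 2 T phi)
  (mz : forall i, ok i -> measurable_fun setT (z i.1 i.2))
  (wz : weight_moments PE ok (fun i => z i.1 i.2))
  (mZ : forall t, t \in `[0, T] -> measurable_fun setT (Z t))
  (wZ : weight_moments P (fun t => t \in `[0, T]) Z).

Lemma weak_order_mean : weak_order_one T P PE z Z h0 -> exists C, 0 <= C /\
  forall N k, (0 < N)%N -> h N <= h0 -> (k <= N)%N ->
  `|mean_scheme T PE z phi N k - mean_along P Z phi (t_ N k)| <= C * h N.
Proof.
move=> /(_ phi cphi)[C HC].
have [K [_ HK]] := rintegrable_growth_moments mz wz cphi.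
have [K' [_ HK']] := rintegrable_growth_moments mZ wZ cphi.
exists `|C|; split => // N k N0 hN kN.
have tT := grid_in T_gt0 N0 kN.
have [i1 _] := HK _ (N, k) tT (And3 N0 hN kN).
have [i2 _] := HK' _ _ tT tT.
have := HC N k N0 hN kN; rewrite /= !expectation_Rintegral// -EFinB abse_EFin lee_fin.
move=> /le_trans; apply; apply: ler_wpM2r; last exact: ler_norm.
by rewrite ltW// step_gt0.
Qed.

Lemma mean_time_lip : exists K, 0 <= K /\ forall t t' i, t \in `[0, T] ->
  t' \in `[0, T] -> t <= t' -> ok i ->
  `|\int[PE]_w phi t' (z i.1 i.2 w) - \int[PE]_w phi t (z i.1 i.2 w)| <= K * (t' - t).
Proof.
have [C [m [C0 HC]]] := classC_time_lip cphi.
have [M [M0 HM]] := wz m.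
have [K [_ HK]] := rintegrable_growth_moments mz wz cphi.
exists (C * M); split; first exact: mulr_ge0.
move=> t t' i tT t'T tt' ki; have [iw bw] := HM i ki.
have [i1 _] := HK t i tT ki; have [i2 _] := HK t' i t'T ki.
rewrite -RintegralB//.
have bd w : `|phi t' (z i.1 i.2 w) - phi t (z i.1 i.2 w)| <=
    C * (t' - t) * weight (z i.1 i.2 w) ^+ m by exact: HC.
have mB := rintegrable_measurable (rintegrableB i2 i1).
apply: (le_trans (Rintegral_norm_le mB (rintegrableZ _ iw) bd)).
rewrite RintegralZl// mulrAC; apply: ler_wpM2r; first by rewrite subr_ge0.
exact: ler_wpM2l.
Qed.

Lemma step_sum_bound (c : nat -> R) C N : (0 < N)%N ->
  (forall k, (k < N)%N -> `|c k| <= C * h N) ->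
  `|h N * \sum_(k < N) c k| <= T * C * h N.
Proof.
move=> N0 Hc; have hN0 : 0 <= h N := ltW (step_gt0 T_gt0 N0).
have hT : h N * N%:R = T by rewrite /step divfK// pnatr_eq0 -lt0n.
rewrite normrM (ger0_norm hN0); apply: (@le_trans _ _ (h N * \sum_(k < N) C * h N)).
  apply: ler_wpM2l => //.
  by apply: (le_trans (ler_norm_sum _ _ _)); apply: ler_sum => k _; exact: Hc.
by rewrite sumr_const card_ord -mulr_natr -{3}hT le_eqVlt; apply/orP; left; apply/eqP; ring.
Qed.

Hypotheses (h0_gt0 : 0 < h0) (phi_ge0 : forall t x, 0 <= phi t x)
  (Z_paths : sequential_paths T P Z) (weak : weak_order_one T P PE z Z h0)
  (incr : exists K, 0 <= K /\ forall N k, (0 < N)%N -> h N <= h0 -> (k < N)%N ->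
    `|mean_scheme T PE z phi N k.+1 - mean_scheme T PE z phi N k| <= K * h N).

(** Lipschitz continuity compares the integral with the sum of the means at grid times, and weak
    order one replaces the diffusion by the chain in that sum. *)
Lemma mean_riemann : lebesgue_measure.-integrable `[0, T] (EFin \o mean_along P Z phi) /\
  exists C, 0 <= C /\ forall N, (0 < N)%N -> h N <= h0 ->
  `|\int[lebesgue_measure]_(t in `[0, T]) mean_along P Z phi t -
    h N * \sum_(k < N) mean_scheme T PE z phi N k| <= C * h N.
Proof.
have [C [C0 HC]] := weak_order_mean weak; have [K [K0 HK]] := incr.
have lip t t' := @mean_along_lip R d T _ Om P _ OmE PE h0 Z z phi K C T_gt0 h0_gt0
  cphi phi_ge0 mZ wZ Z_paths C0 HC HK t t'.
have hr N : (0 < N)%N -> h N <= h0 -> _ := fun N0 hN =>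
  @riemann_sum R T K (mean_along P Z phi) T_gt0 K0 lip N
    (fun k => mean_along P Z phi (t_ N k)) N0.
have tags N k t : (0 < N)%N -> (k < N)%N -> t_ N k < t <= t_ N k.+1 ->
    `|mean_along P Z phi t - mean_along P Z phi (t_ N k)| <= K * h N.
  move=> N0 kN /andP[kt tk].
  have kT := grid_in T_gt0 N0 (ltnW kN); have kT' := grid_in T_gt0 N0 kN.
  have tT : t \in `[0, T].
    move: kT kT'; rewrite !in_itv /= => /andP[a1 _] /andP[_ a2].
    by rewrite (le_trans a1 (ltW kt)) (le_trans tk a2).
  apply: (le_trans (lip _ _ kT tT kt)); apply: ler_wpM2l => //.
  by rewrite lerBlDl -gridS.
split.
  have [m m0 hm] := small_step T_gt0 h0_gt0.
  by have [] := hr m m0 hm (fun k t kN ht => tags m k t m0 kN ht).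
exists (K * T + T * C); split; first by rewrite addr_ge0 ?mulr_ge0 ?(ltW T_gt0).
move=> N N0 hN; have [_ H1] := hr N N0 hN (fun k t kN ht => tags N k t N0 kN ht).
have H2 := @step_sum_bound (fun k => mean_along P Z phi (t_ N k) - mean_scheme T PE z phi N k) C N N0.
rewrite mulrDl (le_trans _ (lerD H1 (H2 _)))//; last first.
  by move=> k kN; rewrite distrC; apply: HC => //; exact: ltnW.
apply: (le_trans _ (ler_normD _ _)); rewrite sumrB.
by rewrite le_eqVlt; apply/orP; left; apply/eqP; congr `|_|; ring.
Qed.

End means.

Lemma integral_sum (R : realType) dd (S : measurableType dd)
    (mu : {measure set S -> \bar R}) (D : set S) (F G : S -> R) :
  measurable D -> mu.-integrable D (EFin \o F) -> mu.-integrable D (EFin \o G) ->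
  mu.-integrable D (fun t => (F t + G t)%:E) /\
  (\int[mu]_(t in D) (F t + G t)%:E =
   (\int[mu]_(t in D) F t + \int[mu]_(t in D) G t)%:E)%E.
Proof.
move=> mD iF iG; split; first exact: (integrableD mD iF iG).
rewrite /Rintegral EFinD !fineK ?integrable_fin_num//.
exact: (integralD mD iF iG).
Qed.

(** * Assembly of the expansion *)

Section expansion.
Context (R : realType) (d : nat) (T : R) d0 (Om : measurableType d0)
  (P : probability Om R) d1 (OmE : measurableType d1) (PE : probability OmE R).
Variables (f : R -> 'rV[R]_d -> 'rV[R]_d) (g : R -> R)
  (p : R -> 'rV[R]_d -> R) (shat : R -> 'rV[R]_d -> 'rV[R]_d) (gm gM h0 : R)
  (X Y : R -> Om -> 'rV[R]_d)
  (x0 : nat -> OmE -> 'rV[R]_d) (eps zeta : nat -> nat -> OmE -> 'rV[R]_d).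
Hypotheses (T_gt0 : 0 < T) (h0_gt0 : 0 < h0)
  (noise : forall N, (0 < N)%N -> euler_noise PE (p 0) N (x0 N) (eps N) (zeta N))
  (p_gt0 : forall t x, t \in `[0, T] -> 0 < p t x)
  (fokker_planck : forall t x, t \in `]0, T[ ->
     is_derive t 1 (fun t' => p t' x)
       (- divergence (fun z => p t z *: f t z) x +
        2^-1 * laplacian (fun z => g t ^+ 2 * p t z) x))
  (gm0 : 0 < gm) (hg : forall t, t \in `[0, T] -> gm <= `|g t| <= gM)
  (cg : C1_time T g) (cf : classC_vec 1 3 T f) (cL : classC 2 4 T (logdens p))
  (cD : classC_vec 1 3 T (score_error p shat)).
Local Notation h := (step T).
Local Notation t_ N := (grid (step T N)).
Local Notation x_ := (scheme_x T f g x0 eps).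
Local Notation y_ := (scheme_y T f g x0 eps zeta shat).
Local Notation ok := (grid_ok T h0).
Local Notation loss := (bwd_loss g p shat).
Hypotheses (wx : weight_moments PE ok (fun i => x_ i.1 i.2))
  (wy : weight_moments PE ok (fun i => y_ i.1 i.2))
  (X_dens : forall t, t \in `[0, T] -> has_density P (X t) (p t))
  (mY : forall t, t \in `[0, T] -> measurable_fun setT (Y t))
  (wX : weight_moments P (fun t => t \in `[0, T]) X)
  (wY : weight_moments P (fun t => t \in `[0, T]) Y)
  (X_paths : sequential_paths T P X) (Y_paths : sequential_paths T P Y)
  (weak_x : weak_order_one T P PE x_ X h0)
  (weak_y : weak_order_one T P PE y_ Y h0).

Let closs : classC 1 2 T loss := bwd_loss_classC cg cD.

Let closs0 : classC 0 2 T loss.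
Proof. exact: classC_le closs. Qed.

Let cf0 : classC_vec 0 3 T f := classC_vec0 cf.
Let cb0 : classC_vec 0 3 T (reverse_drift f g shat) :=
  classC_vec0 (reverse_drift_classC cg cf cL cD).

Let mx i : ok i -> measurable_fun setT (x_ i.1 i.2).
Proof. by case=> N0 _ kN; exact: (measurable_x g T_gt0 N0 (noise N0) cf0 kN). Qed.

Let my i : ok i -> measurable_fun setT (y_ i.1 i.2).
Proof. by case=> N0 _ kN; exact: (measurable_y T_gt0 N0 (noise N0) cf0 cb0 kN). Qed.

Let mX t : t \in `[0, T] -> measurable_fun setT (X t).
Proof. by move=> /X_dens[]. Qed.

Lemma bwd_loss_ge0 t x : 0 <= loss t x.
Proof.
rewrite /bwd_loss mulr_ge0 ?sqr_ge0// mulr_ge0// sumr_ge0// => k _.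
exact: sqr_ge0.
Qed.

Let grid_le N k : (0 < N)%N -> t_ N k <= t_ N k.+1.
Proof. by move=> N0; rewrite gridS lerDl ltW// step_gt0. Qed.

Let gridB N k : t_ N k.+1 - t_ N k = h N.
Proof. by rewrite gridS addrAC subrr add0r. Qed.

(** The time changes at the point x_(k+1), and the point moves from x_k to x_(k+1) at the fixed time
    t_k. *)
Lemma mean_incr_x : exists K, 0 <= K /\ forall N k, (0 < N)%N -> h N <= h0 ->
  (k < N)%N ->
  `|mean_scheme T PE x_ loss N k.+1 - mean_scheme T PE x_ loss N k| <= K * h N.
Proof.
have [K1 [K10 H1]] := mean_time_lip closs mx wx.
have [K2 [K20 H2]] := value_step_x T_gt0 noise hg cf wx closs0.
exists (K1 + K2); split; first exact: addr_ge0.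
move=> N k N0 hN kN.
rewrite -(subrKA (\int[PE]_w loss (t_ N k) (x_ N k.+1 w))) mulrDl.
apply: (le_trans (ler_normD _ _)); apply: lerD; last exact: H2.
have := H1 (t_ N k) (t_ N k.+1) (N, k.+1) (grid_in T_gt0 N0 (ltnW kN))
  (grid_in T_gt0 N0 kN) (grid_le k N0) (And3 N0 hN kN).
by rewrite gridB.
Qed.

Lemma mean_incr_y : exists K, 0 <= K /\ forall N k, (0 < N)%N -> h N <= h0 ->
  (k < N)%N ->
  `|mean_scheme T PE y_ loss N k.+1 - mean_scheme T PE y_ loss N k| <= K * h N.
Proof.
have [K1 [K10 H1]] := mean_time_lip closs my wy.
have [K2 [K20 H2]] := value_step_y T_gt0 noise hg cg cf cL cD wy closs0.
exists (K1 + K2); split; first exact: addr_ge0.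
move=> N k N0 hN kN.
rewrite -(subrKA (\int[PE]_w loss (t_ N k) (y_ N k.+1 w))) mulrDl.
apply: (le_trans (ler_normD _ _)); apply: lerD; last by rewrite distrC; exact: H2.
have := H1 (t_ N k) (t_ N k.+1) (N, k.+1) (grid_in T_gt0 N0 (ltnW kN))
  (grid_in T_gt0 N0 kN) (grid_le k N0) (And3 N0 hN kN).
by rewrite gridB.
Qed.

(** The factor g^2 / 2 of the score energy is contained in the loss. *)
Definition mean_energy :=
  \int[lebesgue_measure]_(t in `[0, T]) mean_along P X loss t +
  \int[lebesgue_measure]_(t in `[0, T]) mean_along P Y loss t.

Lemma mean_energy_integrable :
  lebesgue_measure.-integrable `[0, T] (EFin \o mean_along P X loss) /\
  lebesgue_measure.-integrable `[0, T] (EFin \o mean_along P Y loss).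
Proof.
split.
  by have [] := mean_riemann T_gt0 closs mx wx mX wX h0_gt0 bwd_loss_ge0 X_paths
    weak_x mean_incr_x.
by have [] := mean_riemann T_gt0 closs my wy mY wY h0_gt0 bwd_loss_ge0 Y_paths
    weak_y mean_incr_y.
Qed.

(** Four errors of order h: the one-step expansions, the two Riemann sums, and the discrepancy
    between the terms of these sums and the losses that the chains actually meet. *)
Lemma Delta_expansion : exists C, 0 <= C /\ forall N, (0 < N)%N -> h N <= h0 ->
  rintegrable PE (Delta T f g p shat x0 eps zeta N) /\
  `|\int[PE]_w Delta T f g p shat x0 eps zeta N w + mean_energy| <= C * h N.
Proof.
have [K1 [K10 H1]] := Delta_mean T_gt0 noise p_gt0 fokker_planck gm0 hg cg cf cL cD wx wy.
have [_ [Kx [Kx0 Hx]]] := mean_riemann T_gt0 closs mx wx mX wX h0_gt0 bwd_loss_ge0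
  X_paths weak_x mean_incr_x.
have [_ [Ky [Ky0 Hy]]] := mean_riemann T_gt0 closs my wy mY wY h0_gt0 bwd_loss_ge0
  Y_paths weak_y mean_incr_y.
have [Cx [Cx0 Wx]] := weak_order_mean T_gt0 closs mx wx mX wX weak_x.
have [Cf [Cf0 Wf]] := weak_order_mean T_gt0 (fwd_loss_classC cg cL cD) mx wx mX wX weak_x.
have [K2 [K20 H2]] := value_step_y T_gt0 noise hg cg cf cL cD wy closs0.
exists (K1 + Kx + Ky + T * (Cf + Cx + K2)); split.
  by rewrite !addr_ge0// mulr_ge0 ?addr_ge0// ltW.
move=> N N0 hN; have [iD bD] := H1 N N0 hN; split => //.
(* The discrepancy at k: a forward loss in place of g^2 |delta|^2 / 2, and y_(k+1) in place of
   y_k. *)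
pose c k := (\int[PE]_w fwd_loss g p shat (t_ N k) (x_ N k w) -
    mean_scheme T PE x_ loss N k) +
  (\int[PE]_w loss (t_ N k) (y_ N k.+1 w) - mean_scheme T PE y_ loss N k).
have cb k : (k < N)%N -> `|c k| <= (Cf + Cx + K2) * h N.
  move=> kN; rewrite mulrDl; apply: (le_trans (ler_normD _ _)); apply: lerD; last first.
    by rewrite distrC; exact: H2.
  rewrite -(subrKA (mean_along P X loss (t_ N k))) mulrDl.
  apply: (le_trans (ler_normD _ _)); apply: lerD; last first.
    by rewrite distrC; apply: Wx => //; exact: ltnW.
  have := Wf N k N0 hN (ltnW kN).
  (* The exchange of losses is exact along X, whose density is p_t; hence the detour from the chain
     to X and back. *)
  have EX : mean_along P X (fwd_loss g p shat) (t_ N k) = mean_along P X loss (t_ N k).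
    exact: (fwd_loss_mean p_gt0 cg cL X_dens wX cD (grid_in T_gt0 N0 (ltnW kN))).
  by rewrite EX.
have bc := step_sum_bound T_gt0 N0 cb.
have bx := Hx N N0 hN; have byy := Hy N N0 hN.
have E (A S1 S2 S3 S4 I1 I2 hh : R) : A + (I1 + I2) = (A + hh * (S1 + S3)) +
    (I1 - hh * S2) + (I2 - hh * S4) - hh * (S1 - S2 + (S3 - S4)) by ring.
rewrite /mean_energy (E _ (\sum_(k < N) \int[PE]_w fwd_loss g p shat (t_ N k) (x_ N k w))
  (\sum_(k < N) mean_scheme T PE x_ loss N k)
  (\sum_(k < N) \int[PE]_w loss (t_ N k) (y_ N k.+1 w))
  (\sum_(k < N) mean_scheme T PE y_ loss N k) _ _ (h N)).
rewrite -!sumrB -!big_split /= !mulrDl.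
apply: (le_trans (ler_normB _ _)); apply: lerD; last exact: bc.
apply: (le_trans (ler_normD _ _)); apply: lerD; last exact: byy.
apply: (le_trans (ler_normD _ _)); apply: lerD; last exact: bx.
exact: bD.
Qed.

(** All means are finite, so the extended-real energy comes from a real number; the factor 2 undoes
    the 1 / 2 inside the loss. *)
Lemma score_energyE : score_energy T g p shat P X Y = mean_energy%:E.
Proof.
have [iX iY] := mean_energy_integrable.
have [KX [_ HX]] := rintegrable_growth_moments mX wX closs.
have [KY [_ HY]] := rintegrable_growth_moments mY wY closs.
have sq Z t : measurable_fun setT (Z t) -> t \in `[0, T] ->
    rintegrable P (fun w => loss t (Z t w)) ->
    ((g t ^+ 2)%:E * mean_sqnorm P (fun w => score_error p shat t (Z t w)) =
     (2 * mean_along P Z loss t)%:E)%E.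
  move=> mZ tT iZ; have gt : g t ^+ 2 != 0.
    by rewrite sqrf_eq0 (diffusion_coef_neq0 gm0 hg).
  have E w : enorm (score_error p shat t (Z t w)) ^+ 2 =
      (2 / g t ^+ 2) * loss t (Z t w).
    by rewrite enorm_sqr /bwd_loss; field; rewrite -sqrf_eq0.
  rewrite /mean_sqnorm (_ : (fun w => _) = fun w => (2 / g t ^+ 2) * loss t (Z t w)).
    rewrite expectation_Rintegral; last exact: rintegrableZ.
    rewrite RintegralZl// -EFinM; congr EFin.
    by rewrite /mean_along; move: (\int[P]_w _) => I; field; rewrite -sqrf_eq0.
  by apply/funext => w; exact: E.
rewrite /score_energy (_ : (\int[lebesgue_measure]_(t in `[0%R, T]) _)%E =
  (\int[lebesgue_measure]_(t in `[0%R, T])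
    (2 * (mean_along P X loss t + mean_along P Y loss t))%:E)%E).
  have [iXY EXY] := @integral_sum _ _ _ (@lebesgue_measure R) `[0, T]
    (mean_along P X loss) (mean_along P Y loss) (measurable_itv _) iX iY.
  under eq_integral do rewrite EFinM.
  rewrite integralZl// EXY /mean_energy.
  by rewrite -!EFinM mulrA mulVf ?mul1r// pnatr_eq0.
apply: eq_integral => t; rewrite inE /= => tT.
rewrite ge0_muleDr; last 2 first.
- by rewrite /mean_sqnorm unlock; apply: integral_ge0 => w _; rewrite lee_fin sqr_ge0.
- by rewrite /mean_sqnorm unlock; apply: integral_ge0 => w _; rewrite lee_fin sqr_ge0.
have [i1 _] := HX t t tT tT; have [i2 _] := HY t t tT tT.
rewrite mulrDr EFinD; congr (_ + _)%E.
  exact: (sq X t (mX tT) tT i1).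
exact: (sq Y t (mY tT) tT i2).
Qed.

End expansion.

(** * Moments inherited through weak order one *)

Section weak_moments.
Context (R : realType) (d : nat) (T : R).
Implicit Types x : 'rV[R]_d.

(** A polynomial that dominates [weight] up to a factor, hence a smooth test function on which weak
    order one can be applied. *)
Definition sqweight x : R := 1 + \sum_(i < d) x 0 i ^+ 2.

Lemma weight_sqweight x : weight x <= 2 * sqweight x.
Proof.
have e0 : 0 <= enorm x by exact: sqrtr_ge0.
rewrite /sqweight -enorm_sqr /weight.
have := le_enorm x; nra.
Qed.

Lemma is_derive_coord x (v : 'rV[R]_d) (i : 'I_d) :
  is_derive x v (fun y : 'rV[R]_d => y 0 i) (v 0 i).
Proof.
have H : (fun e : R => e^-1 *: ((e *: v + x) 0 i - x 0 i)) @ 0^' --> v 0 i.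
  apply: cvg_near_cst; near=> e.
  rewrite !mxE addrK /GRing.scale /= mulKf//; near: e; exact: nbhs_dnbhs_neq.
by apply: DeriveDef; [apply/cvg_ex; exists (v 0 i)|exact: cvg_lim].
Unshelve. all: by end_near. Qed.

Lemma classC_coord r s (i : 'I_d) : classC r s T (fun _ x => x 0 i).
Proof.
pose D (a : nat) (al : seq 'I_d) (t : R) x : R := if a is 0%N then
  match al with [::] => x 0 i | [:: j] => (j == i)%:R | _ => 0 end else 0.
exists D; split => //.
- move=> a al _ _; split.
    case: a => [|a] /=; last by move=> z; exact: cvg_cst.
    case: al => [|j [|k al]] /=; [|by move=> z; exact: cvg_cst..].
    apply: continuous_subspaceT => -[t x] /=.
    apply: (@continuous_comp _ _ _ snd (fun x : 'rV[R]_d => x 0 i)).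
      exact: cvg_snd.
    exact: coord_continuous.
  exists 1, 1%N => t x _; rewrite mul1r expr1.
  have e0 : 0 <= enorm x by exact: sqrtr_ge0.
  case: a => [|a] /=; last by rewrite normr0 addr_ge0.
  case: al => [|j [|k al]] /=.
  + by rewrite (le_trans (coord_le_norm _ _))// (le_trans (le_enorm _))// lerDr.
  + by case: eqP => _; rewrite ?normr1 ?normr0 ?lerDl ?addr_ge0.
  + by rewrite normr0 addr_ge0.
- move=> a al t x _ _ _; case: a => [|a] /=; exact: is_derive_cst.
- move=> a al j t x _ _ _; case: a => [|a] /=; last exact: is_derive_cst.
  case: al => [|k al] /=; last first.
    case: al => [|l al]; exact: is_derive_cst.
  rewrite (_ : (j == i)%:R = basis_vec j 0 i); first exact: is_derive_coord.
  by rewrite /basis_vec mxE eqxx eq_sym.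
Qed.

Lemma classC_sqweight r s m : classC r s T (fun _ x => sqweight x ^+ m).
Proof.
elim: m => [|m IH]; first exact: classC_cst.
apply: classC_eq (classCM _ IH) => [t x _|]; first by rewrite exprS.
apply: classCD; first exact: classC_cst.
apply: classC_sum => i.
by apply: classC_eq (classCM (classC_coord r s i) (classC_coord r s i)) => t x _.
Qed.

Context d0 (Om : measurableType d0) (P : probability Om R)
  d1 (OmE : measurableType d1) (PE : probability OmE R).
Variables (h0 : R) (z : nat -> nat -> OmE -> 'rV[R]_d) (Z : R -> Om -> 'rV[R]_d).
Local Notation h := (step T).
Local Notation t_ N := (grid (step T N)).
Local Notation ok := (grid_ok T h0).

(** Weak order one, tested on a power of [sqweight], bounds the moments at grid times; continuity of
    the paths and Fatou's lemma extend the bound to all times. *)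
Lemma weak_weight_moments : 0 < T -> 0 < h0 ->
  (forall i, ok i -> measurable_fun setT (z i.1 i.2)) ->
  weight_moments PE ok (fun i => z i.1 i.2) ->
  (forall t, t \in `[0, T] -> measurable_fun setT (Z t)) ->
  sequential_paths T P Z -> weak_order_one T P PE z Z h0 ->
  weight_moments P (fun t => t \in `[0, T]) Z.
Proof.
move=> T_gt0 h0_gt0 mz wz mZ Z_paths weak m.
pose phi (_ : R) (x : 'rV[R]_d) := sqweight x ^+ m.
have cphi : classC 1 2 T phi by exact: classC_sqweight.
have s0 x : 0 <= sqweight x.
  by rewrite addr_ge0// sumr_ge0// => i _; exact: sqr_ge0.
have phi0 t x : 0 <= phi t x by rewrite exprn_ge0.
have [C HC] := weak phi cphi.
have [K [K0 HK]] := rintegrable_growth_moments mz wz cphi.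
have mphi t : t \in `[0, T] -> measurable_fun setT (fun w => phi t (Z t w)).
  move=> tT; apply: (measurableT_comp (f := phi t)); last exact: mZ.
  exact: measurable_classC cphi tT.
have bgrid N k : (0 < N)%N -> h N <= h0 -> (k <= N)%N ->
    (\int[P]_w (phi (t_ N k) (Z (t_ N k) w))%:E <= (K + `|C| * h0)%:E)%E.
  move=> N0 hN kN; have tT := grid_in T_gt0 N0 kN.
  have [i1 b1] := HK _ (N, k) tT (And3 N0 hN kN).
  have := HC N k N0 hN kN; rewrite /= expectation_Rintegral// unlock.
  have : (0 <= \int[P]_w (phi (t_ N k) (Z (t_ N k) w))%:E)%E.
    by apply: integral_ge0 => w _; rewrite lee_fin.
  (* The integral might a priori be infinite, but its distance to a real number is bounded. *)
  move: (\int[P]_w _)%E => [r _|//|//] /=.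
  rewrite !lee_fin => H.
  have h1 : C * h N <= `|C| * h0.
    apply: (@le_trans _ _ (`|C| * h N)).
      by rewrite ler_wpM2r ?ler_norm// ltW// step_gt0.
    by rewrite ler_wpM2l.
  move: H; rewrite ler_norml => /andP[H _].
  have := ler_norm (\int[PE]_w phi (t_ N k) (z N k w)); simpl in *; lra.
have ball t : t \in `[0, T] ->
    (\int[P]_w (phi t (Z t w))%:E <= (K + `|C| * h0)%:E)%E.
  move=> tT; have [q [Hq st]] := grid_sequence T_gt0 h0_gt0 tT.
  pose s n := t_ (q n).1 (q n).2.
  have sT n : s n \in `[0, T] by have [q0 _ qk] := Hq n; exact: grid_in.
  apply: (@fatou_lee _ _ _ P (fun n w => phi (s n) (Z (s n) w))
    (fun w => phi t (Z t w)) (fun=> K + `|C| * h0)) => //.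
  - by move=> n; exact: mphi.
  - exact: mphi.
  - apply: filterS Z_paths => w /(_ s t sT tT st) H.
    by apply: (cvg_comp _ _ H); exact: (classC_continuous cphi tT).
  - by move=> n; have [q0 qh qk] := Hq n; exact: bgrid.
  - exact: cvg_cst.
exists (2 ^+ m * (K + `|C| * h0)); split.
  by rewrite mulr_ge0 ?exprn_ge0// addr_ge0// mulr_ge0// ltW.
move=> t tT; have mt := mphi t tT; have bt := ball t tT.
have it : rintegrable P (fun w => phi t (Z t w)).
  apply/integrableP; split; first exact/measurable_EFinP.
  under eq_integral do rewrite /= ger0_norm//.
  exact: le_lt_trans bt (ltry _).
have mw : measurable_fun setT (fun w => weight (Z t w) ^+ m).
  exact: measurableT_comp (measurable_weight m) (mZ t tT).
have bw w : `|weight (Z t w) ^+ m| <= 2 ^+ m * phi t (Z t w).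
  rewrite ger0_norm ?weightX_ge0// -exprMn lerXn2r ?nnegrE ?weight_ge0 ?mulr_ge0//.
  exact: weight_sqweight.
have iB := rintegrableZ (2 ^+ m) it.
split; first exact: rintegrable_le mw bw iB.
apply: (le_trans (ler_norm _)); apply: (le_trans (Rintegral_norm_le mw iB bw)).
rewrite RintegralZl// ler_wpM2l ?exprn_ge0//.
by rewrite -lee_fin -RintegralE.
Qed.

End weak_moments.

Theorem mainTheorem6 (R : realType) (d : nat)
    (* horizon, drift, diffusion coefficient, densities p_t, approximate score *)
    (T : R) (f : R -> 'rV[R]_d -> 'rV[R]_d) (g : R -> R)
    (p : R -> 'rV[R]_d -> R) (shat : R -> 'rV[R]_d -> 'rV[R]_d)
    (* the exact and the approximate diffusions *)
    (dO : measure_display) (Om : measurableType dO) (P : probability Om R)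
    (B W X Y Yhat : R -> Om -> 'rV[R]_d)
    (* the inputs of the Euler schemes, for each number N of steps *)
    (dE : measure_display) (OmE : measurableType dE) (PE : probability OmE R)
    (x0 : nat -> OmE -> 'rV[R]_d) (eps zeta : nat -> nat -> OmE -> 'rV[R]_d)
    (h0 : R)
    (T_gt0 : 0 < T)
    (X_dens : forall t, t \in `[0, T] -> has_density P (X t) (p t))
    (noise : forall N, (0 < N)%N ->
       euler_noise PE (p 0) N (x0 N) (eps N) (zeta N))
    (standing : standing_assumptions T f g p)
    (h0_gt0 : 0 < h0)
    (assR : assumption_R T f g p P B W X Y PE x0 eps zeta h0)
    (assS : assumption_S T f g p shat P B W X Yhat PE x0 eps zeta h0) :
  let E_score := score_energy T g p shat P X Yhat in
  let Delta_ N := Delta T f g p shat x0 eps zeta N in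
  E_score \is a fin_num /\
  (exists r : nat -> R, r =O_\oo (fun N => step T N) /\
     \forall N \near \oo,
       ('E_PE[Delta_ N] = - E_score + (r N)%:E)%E) /\
  (exists r : nat -> R, r =O_\oo (fun N => step T N) /\
     \forall N \near \oo,
       ((2^-1)%:E * expeR (- E_score + (r N)%:E)
          <= 'E_PE[(fun w => Num.min 1 (expR (Delta_ N w)))%R])%E).
Proof.
move: standing => [p_gt0 fokker_planck _].
move: assR => [[cg [gm [gM [gm0 hg]]]] [cf cL] [[X0 [F X_sde]] _ _ _]
  [momX _ momx _] _].
move: assS => [cD [Y_rev _] momy _ [weak_x weak_y]].
have g0 t : t \in `[0, T] -> g t != 0.
  by move=> tT; exact: (diffusion_coef_neq0 gm0 hg tT).
have cf0 := classC_vec0 cf.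
have cb0 := classC_vec0 (reverse_drift_classC cg cf cL cD).
have mx i : grid_ok T h0 i -> measurable_fun setT (scheme_x T f g x0 eps i.1 i.2).
  by case=> N0 _ kN; exact: (measurable_x g T_gt0 N0 (noise _ N0) cf0 kN).
have my i : grid_ok T h0 i ->
    measurable_fun setT (scheme_y T f g x0 eps zeta shat i.1 i.2).
  by case=> N0 _ kN; exact: (measurable_y T_gt0 N0 (noise _ N0) cf0 cb0 kN).
have wx : weight_moments PE (grid_ok T h0) (fun i => scheme_x T f g x0 eps i.1 i.2).
  apply: Lq_weight_moments mx _ => q /momx[C HC].
  by exists C => i [N0 hN kN]; exact: HC.
have wy : weight_moments PE (grid_ok T h0)
    (fun i => scheme_y T f g x0 eps zeta shat i.1 i.2).
  apply: Lq_weight_moments my _ => q /momy[C HC].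
  by exists C => i [N0 hN kN]; exact: HC.
have mX t : t \in `[0, T] -> measurable_fun setT (X t) by move=> /X_dens[].
have mY t : t \in `[0, T] -> measurable_fun setT (Yhat t).
  exact: reverse_measurable Y_rev.
have Y_paths := reverse_paths Y_rev.
have wX : weight_moments P (fun t => t \in `[0, T]) X by exact: Lq_weight_moments.
(* The moments of [Yhat] are inherited from its Euler scheme. *)
have wY := weak_weight_moments T_gt0 h0_gt0 my wy mY Y_paths weak_y.
have X_paths := sde_paths X_sde.
have EE := score_energyE T_gt0 h0_gt0 noise gm0 hg cg cf cL cD wx wy X_dens mY
  wX wY X_paths Y_paths weak_x weak_y.
have [C [C0 HD]] := Delta_expansion T_gt0 h0_gt0 noise p_gt0 fokker_planck gm0 hg
  cg cf cL cD wx wy X_dens mY wX wY X_paths Y_paths weak_x weak_y.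
move=> E_score Delta_; rewrite /E_score {}EE; split; first by [].
set I := mean_energy _ _ _ _ _ _ _.
(* With the remainder defined as a difference the expansion is exact, and only its order has to be
   shown; the same r serves for the acceptance bound. *)
pose r N : R := \int[PE]_w Delta_ N w + I.
have near_ok : \forall N \near \oo, (0 < N)%N /\ step T N <= h0.
  have [m m0 hm] := small_step T_gt0 h0_gt0.
  exists m => // N /= mN; have N0 := leq_trans m0 mN; split => //.
  apply: le_trans hm; rewrite /step ler_pM2l// lef_pV2 ?posrE ?ltr0n//.
  by rewrite ler_nat.
have rO : r =O_\oo (fun N => step T N).
  (* The constant must be positive, and C may be zero. *)
  apply/eqO_exP; exists (C + 1); first by rewrite ltr_wpDl.
  apply: filterS near_ok => N [N0 hN]; have [_ H] := HD N N0 hN.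
  apply: (le_trans H); rewrite ger0_norm ?(ltW (step_gt0 T_gt0 N0))//.
  by rewrite ler_wpM2r ?(ltW (step_gt0 T_gt0 N0))// lerDl.
have rE N : (- I%:E + (r N)%:E)%E = (\int[PE]_w Delta_ N w)%:E.
  by rewrite -EFinN -EFinD /r addrC addrK.
split; exists r; split => //; apply: filterS near_ok => N [N0 hN].
  have [iD _] := HD N N0 hN.
  by rewrite rE expectation_Rintegral.
have [iD _] := HD N N0 hN; rewrite rE.
have [iM H] := mean_min_expR iD (mean_expR_Delta T_gt0 N0 (noise N N0) p_gt0 g0 cL cf0 cb0).
by rewrite expectation_Rintegral// -EFinM lee_fin.
Qed.
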